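(* Let $A$ be a compact complex torus, let $Z\subset A$ be a closed analytic subset of codimension at least two and let $M$ be a countable subset of $A\setminus Z$. Then there exists an entire curve $h:\mathbb{C}\to A\setminus Z$ with dense image and $M\subset h(\mathbb{C})$. Moreover, every hypersurface $D\subset A$ intersects $h(\mathbb{C})$ transversally in some point, i.e. there is a point $p=h(t)\in h(\mathbb{C})\cap D$ with $h'(t)\notin T_pD$.
   Context: An entire curve is a holomorphic map from $\mathbb{C}$; density is for the metric (Euclidean) topology. A hypersurface is a non-empty (reduced) closed analytic subset of pure codimension one. *)

(* Defs.v *)
From HB Require Import structures.
From mathcomp Require Export all_boot all_order all_algebra.
From mathcomp Require Export generic_quotient complex.
From mathcomp Require Export all_classical all_reals all_analysis.

Set Implicit Arguments.
Unset Strict Implicit.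
Unset Printing Implicit Defensive.

Export numFieldNormedType.Exports.
Import Order.TTheory GRing.Theory Num.Theory.

Local Open Scope classical_set_scope.
Local Open Scope ring_scope.
Local Open Scope complex_scope.
Local Open Scope quotient_scope.

(* R[i] packed as a numClosedFieldType, from which it gets the topology of its
   norm. C^n is 'rV[Cplx R]_n, a normed module over Cplx R; hence
   [differentiable] is complex Frechet differentiability. *)
Definition Cplx (R : realType) : numClosedFieldType := R[i].

Section Torus.
Context {R : realType} {n : nat}.
Local Notation C := (Cplx R).
Implicit Type Om : 'M[C]_(n.*2, n).

(* The 2n rows of Om are linearly independent over the reals, so that their
   integral span is a lattice of full rank in C^n. *)
Definition period_matrix Om : Prop :=
  forall x : 'rV[R]_(n.*2), map_mx (real_complex R) x *m Om = 0 -> x = 0.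

Definition in_lattice Om (z : 'rV[C]_n) : Prop :=
  exists m : 'rV[int]_(n.*2), z = map_mx intr m *m Om.

Definition lattice_rel Om : rel 'rV[C]_n :=
  fun x y => `[< in_lattice Om (x - y) >].

Lemma lattice_rel_refl Om : reflexive (lattice_rel Om).
Proof.
by move=> x; apply/asboolP; exists 0; rewrite subrr raddf0 mul0mx.
Qed.

Lemma lattice_rel_sym Om : symmetric (lattice_rel Om).
Proof.
move=> x y; apply/asboolP/asboolP => -[m xy];
  by exists (- m); rewrite raddfN mulNmx -xy opprB.
Qed.

Lemma lattice_rel_trans Om : transitive (lattice_rel Om).
Proof.
move=> y x z /asboolP[m xy] /asboolP[p yz]; apply/asboolP; exists (m + p).
by rewrite raddfD mulmxDl -xy -yz addrA subrK.
Qed.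

Canonical lattice_equiv Om :=
  EquivRel (lattice_rel Om)
    (lattice_rel_refl Om) (@lattice_rel_sym Om) (@lattice_rel_trans Om).

Definition torus Om := quotient_topology {eq_quot lattice_equiv Om}.

HB.instance Definition _ Om := Topological.on (torus Om).
HB.instance Definition _ Om := Quotient.on (torus Om).

Definition torus_pi Om (z : 'rV[C]_n) : torus Om := \pi_(torus Om) z.

End Torus.

Section Analytic.
Context {R : realType} {n : nat} {Om : 'M[Cplx R]_(n.*2, n)}.
Local Notation C := (Cplx R).
Local Notation A := (torus Om).
Local Notation pi := (torus_pi Om).
Implicit Types (U Z D : set A) (f : A -> C) (h : C -> A).

(* The complex structure of A makes pi locally biholomorphic. *)
Definition holomorphic_on U f : Prop :=
  forall z, U (pi z) -> differentiable (f \o pi) z.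

(* T_a A is identified with C^n through the differential of pi; since f \o pi
   is periodic, the value does not depend on the chosen preimage of a. *)
Definition differential f (a : A) (v : 'rV[C]_n) : C :=
  'd (f \o pi) (repr a) v.

(* Zero sets near every point of A, so such a set is closed. *)
Definition analytic_set Z : Prop :=
  forall a : A, exists U : set A, open_nbhs a U /\
    exists (k : nat) (f : 'I_k -> A -> C),
      (forall i, holomorphic_on U (f i)) /\
      (forall b, U b -> (Z b <-> forall i, f i b = 0)).

(* Near a, Z is a complex submanifold of codimension c: the fibre over 0 of a
   holomorphic map to C^c that is submersive at a. *)
Definition regular_point Z (c : nat) (a : A) : Prop :=
  Z a /\ exists U : set A, open_nbhs a U /\
    exists f : 'I_c -> A -> C,
      [/\ forall i, holomorphic_on U (f i),
          forall b, U b -> (Z b <-> forall i, f i b = 0) &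
          forall w : 'I_c -> C, exists v : 'rV[C]_n,
            forall i, differential (f i) a v = w i].

(* The dimension of Z at a is the limsup, as regular points z of Z tend to a,
   of the dimension of the manifold Z near z; so the codimension is a liminf. *)
Definition codim_at_ge Z (a : A) (k : nat) : Prop :=
  \forall z \near a, forall c, regular_point Z c z -> (k <= c)%N.

Definition codim_at Z (a : A) (k : nat) : Prop :=
  codim_at_ge Z a k /\ ~ codim_at_ge Z a k.+1.

Definition codim_ge Z (k : nat) : Prop := forall a, Z a -> codim_at_ge Z a k.

Definition pure_codim Z (k : nat) : Prop := forall a, Z a -> codim_at Z a k.

Definition hypersurface D : Prop :=
  [/\ analytic_set D, D !=set0 & pure_codim D 1].

(* Zariski tangent space of the reduced analytic set D at a point p of D: the
   usual tangent space at regular points, and all of T_p A at the singular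
   points of a hypersurface. *)
Definition tangent_space D (p : A) : set 'rV[C]_n :=
  [set v | forall (U : set A) f, open_nbhs p U -> holomorphic_on U f ->
     (forall b, U b -> D b -> f b = 0) -> differential f p v = 0].

Definition local_lift h (t : C) (g : C -> 'rV[C]_n) : Prop :=
  \forall s \near t, differentiable g s /\ h s = pi (g s).

Definition entire_curve h : Prop := forall t, exists g, local_lift h t g.

(* v is h'(t); local lifts differ by lattice constants, so v is unique. *)
Definition velocity h (t : C) (v : 'rV[C]_n) : Prop :=
  exists2 g, local_lift h t g & v = derive1 g t.

Definition meets_transversally h D : Prop :=
  exists t : C, D (h t) /\
    exists2 v, velocity h t v & ~ tangent_space D (h t) v.

End Analytic.

(* Main.v *)
(** Lift everything to C^n. The curve is the limit of entire maps H_j obtained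
    by two alternating corrections. First, an entire approximation of the
    characteristic function of a far away disc is used to make H_j nearly equal
    to a prescribed affine line q + (t - b) v on that disc, with H_j(b) = q,
    hardly changing it elsewhere. Then H_j is replaced by H_j + g l, where g is
    a polynomial vanishing exactly at the points b used so far and l is a small
    vector such that the new curve avoids Z on a large disc. Density and
    M follow by letting q run through M and the rational points outside Z.
    A hypersurface has a regular point of codimension one, near which it is
    {f = 0} with df <> 0; a line through a nearby rational point, in a direction
    v with df(v) <> 0, crosses it transversally, and by Newton iteration so does
    every curve close enough to that line.

    The vector l exists because a generic l is good. Near a common zero, let
    f_i be the equations of Z and F_i(t, l) = f_i(H(t) + g(t) l). If the curves
    with parameter in an open set all meet Z, then, shrinking this set, there is
    a largest m such that all of them meet Z to order m in t, at a point
    t = tau(l); some derivative G of F_i with respect to t, of order m - 1, then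
    has a simple zero there, and Z is locally given by the single equation
    G = 0. So Z has a regular point of codimension one or, when tau is constant,
    an interior point.

    The complex analysis needed rests on Goursat's lemma for squares, proved for
    Riemann sums: they are exactly additive under subdivision and vanish on
    affine functions, so no integral is needed. *)
From HB Require Import structures.
Require Import Defs.
From mathcomp Require Import ring lra.

Set Implicit Arguments.
Unset Strict Implicit.
Unset Printing Implicit Defensive.

Import Order.TTheory GRing.Theory Num.Theory.

Local Open Scope classical_set_scope.
Local Open Scope ring_scope.
Local Open Scope complex_scope.
Local Open Scope quotient_scope.

(** * Norms and Frechet derivatives *)

(** Codimension at least two is used only as the absence of regular points of codimension 0 and 1,
    so no dimension count shows that bad parameters are rare. Hence the detour through orders of
    vanishing: if all parameters of a ball are bad, a forbidden regular point has to be produced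
    from the bad times themselves. Where g t is nonzero, l -> H t + g t l is an affine isomorphism
    of C^n and carries such a point back to Z; where g vanishes, the curve passes through a
    prescribed point outside Z and a small l does no harm.

    Hypersurfaces are uncountable in number, stages are countable. The line that crosses D can
    nevertheless come from a list fixed in advance (rational base point, direction in the standard
    basis, precision 2^-k), because the admissible distance and error depend on f, the point and the
    direction, not on the curve.

    Limits are taken at the rate 2^-k, so that convergence, uniqueness and the passage of estimates
    to the limit reduce to one real inequality. Tolerances are at least halved from stage to stage,
    which keeps the limit inside the room left by every stage. *)

Section RealNorm.
Context {R : realType}.
Local Notation C := (Cplx R).

(* The norm of a normed module over C takes its values in C. *)
Definition nm (V : normedModType C) (v : V) : R := complex.Re (`|v| : R[i]).

Section Basic.
Context {V : normedModType C}.
Implicit Types (u v w : V) (a : C).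

Lemma nmE v : `|v| = (nm v)%:C :> C.
Proof.
have := normr_ge0 v; rewrite lecE /nm /= => /andP[/eqP im _].
by case: `|v| im => x y /= ->.
Qed.

Lemma nm_ge0 v : 0 <= nm v.
Proof. by have := normr_ge0 v; rewrite nmE lecR. Qed.

Lemma nm0 : nm (0 : V) = 0.
Proof. by rewrite /nm normr0. Qed.

Lemma nm_eq0 v : (nm v == 0) = (v == 0).
Proof.
rewrite -(normr_eq0 v) nmE; apply/eqP/eqP => [->//|]; exact: complexI.
Qed.

Lemma nm_gt0 v : (0 < nm v) = (v != 0).
Proof. by rewrite lt_neqAle nm_ge0 andbT eq_sym nm_eq0. Qed.

Lemma nmN v : nm (- v) = nm v.
Proof. by rewrite /nm normrN. Qed.

Lemma nmD u v : nm (u + v) <= nm u + nm v.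
Proof. by have := ler_normD u v; rewrite !nmE -rmorphD lecR. Qed.

Lemma nm_distC u v : nm (u - v) = nm (v - u).
Proof. by rewrite -nmN opprB. Qed.

Lemma nmB u v : nm (u - v) <= nm u + nm v.
Proof. by rewrite -(nmN v) nmD. Qed.

Lemma nm_tri w u v : nm (u - v) <= nm (u - w) + nm (w - v).
Proof. by rewrite -[u - v](subrKA w) nmD. Qed.

Lemma nmBl u v : nm u - nm v <= nm (u - v).
Proof. by rewrite lerBlDr -{1}(subrK v u) nmD. Qed.

Lemma nmZ a v : nm (a *: v) = nm (a : C^o) * nm v.
Proof. by apply: (@complexI R); rewrite -nmE normrZ !nmE rmorphM. Qed.

End Basic.

Local Notation nmc := (@nm C).

Lemma nmM (a b : C) : nmc (a * b) = nmc a * nmc b.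
Proof. by apply: (@complexI R); rewrite -nmE normrM !nmE rmorphM. Qed.

Lemma nmZc (V : normedModType C) (a : C) (v : V) : nm (a *: v) = nmc a * nm v.
Proof. exact: nmZ. Qed.

Lemma nm1 : nmc 1 = 1.
Proof. by rewrite /nm normr1. Qed.

Lemma nmV (a : C) : nmc a^-1 = (nmc a)^-1.
Proof. by apply: (@complexI R); rewrite -nmE normfV nmE fmorphV. Qed.

Lemma nmX (a : C) k : nmc (a ^+ k) = nmc a ^+ k.
Proof. by elim: k => [|k ih]; rewrite ?expr0 ?nm1// !exprS nmM ih. Qed.

Lemma nm_sqrt (z : C) :
  nmc z = Num.sqrt (complex.Re z ^+ 2 + complex.Im z ^+ 2).
Proof. by rewrite /nm normc_def. Qed.

Lemma nm_real (x : R) : nmc (x%:C : C) = `|x|.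
Proof. by rewrite nm_sqrt /= expr0n addr0 sqrtr_sqr. Qed.

Definition ic : C := 0 +i* 1.

Lemma nm_i : nmc ic = 1.
Proof. by rewrite nm_sqrt /= expr0n add0r expr1n sqrtr1. Qed.

Lemma nm_nat k : nmc (k%:R : C) = k%:R.
Proof. by rewrite -(rmorph_nat (real_complex R)) nm_real normr_nat. Qed.

Lemma Re_le_nm (z : C) : `|complex.Re z| <= nmc z.
Proof. by rewrite nm_sqrt -sqrtr_sqr ler_wsqrtr// lerDl sqr_ge0. Qed.

Lemma Im_le_nm (z : C) : `|complex.Im z| <= nmc z.
Proof. by rewrite nm_sqrt -sqrtr_sqr ler_wsqrtr// lerDr sqr_ge0. Qed.

Lemma nm_le_ReIm (z : C) : nmc z <= `|complex.Re z| + `|complex.Im z|.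
Proof.
case: z => x y /=; rewrite -[X in nm X]/((x +i* y : C)) [x +i* y]complexE /=.
by apply: le_trans (nmD _ _) _; rewrite nmM -/ic nm_i mul1r !nm_real.
Qed.

Lemma nearP (V : normedModType C) (z : V) (P : set V) :
  (\forall w \near z, P w) <-> exists2 d : R, 0 < d & forall w, nm (w - z) < d -> P w.
Proof.
split=> [/nbhs_ballP[e /= e0 zP]|[d d0 zP]].
  have := e0; rewrite ltcE /= => /andP[/eqP im re].
  exists (complex.Re e) => // w wz; apply: zP; rewrite -ball_normE /=.
  by rewrite distrC nmE ltcE /= im eqxx.
apply/nbhs_ballP; exists (d%:C : C) => /=; first by rewrite ltcR.
by move=> w; rewrite -ball_normE /= distrC nmE ltcR => /zP.
Qed.

Lemma contP (V W : normedModType C) (f : V -> W) z :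
  {for z, continuous f} <-> forall e : R, 0 < e ->
    exists2 d : R, 0 < d & forall w, nm (w - z) < d -> nm (f w - f z) < e.
Proof.
split=> [cf e e0|cf].
  have : \forall y \near f z, nm (y - f z) < e by apply/nearP; exists e.
  by move=> /cf /nearP.
move=> A /nearP[e e0 eA]; have [d d0 dA] := cf e e0.
by apply/nearP; exists d => // w /dA /eA.
Qed.

Definition bounded_linear (V W : normedModType C) (L : V -> W) : Prop :=
  linear L /\ exists K : R, forall v, nm (L v) <= K * nm v.

Definition frechet (V W : normedModType C) (f : V -> W) z (L : V -> W) : Prop :=
  forall e : R, 0 < e -> exists2 d : R, 0 < d &
    forall w, nm w < d -> nm (f (z + w) - f z - L w) <= e * nm w.

Section Frechet.
Context {V W : normedModType C}.
Implicit Types (f : V -> W) (z : V).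

Lemma linear_bound (L : {linear V -> W}) : continuous L ->
  exists2 K : R, 0 <= K & forall v, nm (L v) <= K * nm v.
Proof.
move=> /(_ 0) /contP /(_ 1 ltr01)[d d0 dL]; exists (2 / d); first by rewrite divr_ge0 ?ltW.
move=> v; have [->|v0] := eqVneq v 0; first by rewrite linear0 !nm0 mulr0.
have nv : 0 < nm v by rewrite nm_gt0.
pose a : R := d / (2 * nm v).
have a0 : 0 < a by rewrite divr_gt0// mulr_gt0.
have : nm (a%:C *: v - 0) < d.
  rewrite subr0 nmZc nm_real gtr0_norm// /a invfM mulrA mulfVK ?gt_eqF//.
  by rewrite ltr_pdivrMr// ltr_pMr// ltr1n.
move=> /dL; rewrite linear0 subr0 linearZ nmZc nm_real gtr0_norm//.
move=> /ltW; rewrite -ler_pdivlMl// mulr1 /a invf_div.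
by rewrite mulrAC.
Qed.

Lemma diff_frechet f z : differentiable f z -> frechet f z ('d f z).
Proof.
move=> df e e0; have /eqaddoP/(_ (e%:C)) := diff_locally df.
rewrite ltcR => /(_ e0) /nearP[d d0 dP]; exists d => // w wd.
have := dP w; rewrite subr0 => /(_ wd) /=.
rewrite !fctE /= !nmE -rmorphM lecR [w + z]addrC.
by rewrite opprD addrA.
Qed.

(** Boundedness of L supplies the continuity that uniqueness of the differential needs. Nearly every
    derivative below is computed by guessing L and checking the epsilon-delta condition. *)
Lemma frechet_is_diff f z (L : V -> W) :
  bounded_linear L -> frechet f z L -> differentiable f z /\ forall v, 'd f z v = L v.
Proof.
move=> [linL [K LK]] fL.
pose L' : {linear V -> W} := HB.pack L (GRing.isLinear.Build _ _ _ _ L linL).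
have cL : continuous L'.
  move=> x; apply/contP => e e0; exists (e / (`|K| + 1)).
    by rewrite divr_gt0// ltr_wpDl.
  move=> w; rewrite ltr_pdivlMr ?ltr_wpDl// => we.
  rewrite -linearB; apply: le_lt_trans (LK _) _.
  apply: le_lt_trans _ we; rewrite mulrC ler_wpM2l ?nm_ge0//.
  by rewrite (le_trans (ler_norm _))// lerDl.
have E : f \o shift z = cst (f z) + L' +o_ 0 id.
  apply/eqaddoP => _/posnumP[e].
  have := [elaborate gt0 e]; rewrite ltcE /= => /andP[/eqP im re].
  have [d d0 dP] := fL _ re; apply/nearP; exists d => // w; rewrite subr0 => /dP.
  rewrite !fctE /= [w + z]addrC opprD addrA !nmE /= => le1.
  have -> : e%:num = (complex.Re e%:num)%:C.
    by case: (e%:num) im => /= x y ->.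
  by rewrite -rmorphM lecR.
have dE := diff_unique cL E; split; last by move=> v; rewrite dE.
by apply/diff_locallyP; rewrite dE.
Qed.

End Frechet.
End RealNorm.

(** * Geometric convergence, the mean value inequality, compactness of discs *)

Section Geometric.
Context {R : realType}.
Local Notation C := (Cplx R).

Lemma half_gt0 k : 0 < (2 : R) ^- k.
Proof. by rewrite invr_gt0 exprn_gt0. Qed.

Lemma half_small (K e : R) : 0 < e -> exists N, forall k, (N <= k)%N -> K * 2 ^- k < e.
Proof.
move=> e0; pose N := Num.bound (K / e); exists N => k Nk.
rewrite ltr_pdivrMr ?exprn_gt0// mulrC -ltr_pdivrMr//.
apply: le_lt_trans (ler_norm _) _; apply: lt_le_trans (archi_boundP (normr_ge0 _)) _.
have -> : Num.bound `|K / e| = N by rewrite /N /Num.bound normr_id.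
by rewrite -natrX ler_nat (leq_trans Nk)// ltnW// ltn_expl.
Qed.

Lemma geom_le0 (K x : R) : (forall k, x <= K * 2 ^- k) -> x <= 0.
Proof.
move=> xK; rewrite leNgt; apply/negP => /(half_small K)[N /(_ N (leqnn _))].
by rewrite ltNge xK.
Qed.

Lemma halfS k : (2 : R) ^- k.+1 = 2 ^- k / 2.
Proof. by rewrite exprS invfM mulrC. Qed.

(** The intervals with centre u k and radius 2 K 2^-k are nested; the supremum of their lower ends
    lies in all of them. *)
Lemma real_geom_cvg (u : nat -> R) (K : R) :
  (forall k, `|u k.+1 - u k| <= K * 2 ^- k) ->
  exists l, forall k, `|u k - l| <= 2 * K * 2 ^- k.
Proof.
move=> uK.
pose lo k := u k - 2 * K * 2 ^- k; pose hi k := u k + 2 * K * 2 ^- k.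
have K0 : 0 <= K by have := le_trans (normr_ge0 _) (uK 0); rewrite expr0 invr1 mulr1.
have loS k : lo k <= lo k.+1.
  by have := uK k; rewrite /lo halfS ler_norml => /andP[]; lra.
have hiS k : hi k.+1 <= hi k.
  by have := uK k; rewrite /hi halfS ler_norml => /andP[]; lra.
have lohi k : lo k <= hi k.
  have := mulr_ge0 K0 (ltW (half_gt0 k)); rewrite /lo /hi; lra.
have lomono : {homo lo : m n / (m <= n)%N >-> m <= n}.
  by apply: homo_leq => //; apply: le_trans.
have himono : {homo hi : m n / (m <= n)%N >-> n <= m}.
  by apply: homo_leq => // x y z yx zy; apply: le_trans zy yx.
have all m n : lo m <= hi n.
  case/orP: (leq_total m n) => mn.
    exact: le_trans (lomono _ _ mn) (lohi n).
  exact: le_trans (lohi m) (himono _ _ mn).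
exists (sup (range lo)) => k.
have s1 : lo k <= sup (range lo).
  apply: ub_le_sup; last by exists k.
  by exists (hi 0) => _ [m _ <-].
have s2 : sup (range lo) <= hi k.
  by apply: ge_sup; [exists (lo 0), 0%N | move=> _ [m _ <-]].
by move: s1 s2; rewrite /lo /hi ler_norml => s1 s2; apply/andP; split; lra.
Qed.

Lemma geom_cvg (u : nat -> C) (K : R) :
  (forall k, nm (u k.+1 - u k) <= K * 2 ^- k) ->
  exists l, forall k, nm (u k - l) <= 4 * K * 2 ^- k.
Proof.
move=> uK.
have reB (a b : C) : complex.Re (a - b) = complex.Re a - complex.Re b by case: a b => [? ?] [].
have imB (a b : C) : complex.Im (a - b) = complex.Im a - complex.Im b by case: a b => [? ?] [].
have [k|x xP] := @real_geom_cvg (fun k => complex.Re (u k)) K.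
  by rewrite -reB; apply: le_trans (Re_le_nm _) _.
have [k|y yP] := @real_geom_cvg (fun k => complex.Im (u k)) K.
  by rewrite -imB; apply: le_trans (Im_le_nm _) _.
exists (x +i* y) => k; apply: le_trans (nm_le_ReIm _) _.
rewrite reB imB /=; have := xP k; have := yP k; lra.
Qed.

(** Total limit operator, so that a limit function can be written down before its convergence is
    known. Any constant K is allowed, and by [geom_le0] the limit does not depend on it. *)
Definition glim (u : nat -> C) : C :=
  xget 0 [set l | exists K, forall k, nm (u k - l) <= K * 2 ^- k].

Lemma glimP (u : nat -> C) (K : R) :
  (forall k, nm (u k.+1 - u k) <= K * 2 ^- k) ->
  forall k, nm (u k - glim u) <= 4 * K * 2 ^- k.
Proof.
move=> uK; have [l lP] := geom_cvg uK.
rewrite /glim; case: xgetP => [m _ [K' mP]|/(_ l)]; last by case; exists (4 * K).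
suff -> : m = l by [].
apply/eqP; rewrite -subr_eq0 -nm_eq0 eq_le nm_ge0 andbT.
apply: (@geom_le0 (K' + 4 * K)) => k.
rewrite mulrDl; apply: le_trans (nm_tri (u k) _ _) _.
by rewrite lerD// nm_distC.
Qed.

Lemma glimE (u : nat -> C) (K : R) l :
  (forall k, nm (u k - l) <= K * 2 ^- k) -> glim u = l.
Proof.
move=> lP; rewrite /glim; case: xgetP => [m _ [K' mP]|/(_ l)]; last by case; exists K.
apply/eqP; rewrite -subr_eq0 -nm_eq0 eq_le nm_ge0 andbT.
apply: (@geom_le0 (K' + K)) => k.
rewrite mulrDl; apply: le_trans (nm_tri (u k) _ _) _.
by rewrite lerD// nm_distC.
Qed.

(* Continuous induction: the supremum of the initial segments on which the
   bound [K + e] holds cannot be smaller than 1. *)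
Lemma mean_value_path (V : normedModType C) (p : R -> V) (K : R) :
  (forall s, 0 <= s <= 1 -> forall e, 0 < e -> exists2 d, 0 < d &
     forall t, 0 <= t <= 1 -> `|t - s| < d -> nm (p t - p s) <= (K + e) * `|t - s|) ->
  nm (p 1 - p 0) <= K.
Proof.
move=> pK; apply/ler_addgt0Pr => e e0.
pose S := [set s : R | 0 <= s <= 1 /\
  forall x, 0 <= x <= s -> nm (p x - p 0) <= (K + e) * x].
have S0 : S 0.
  split; first by rewrite lexx ler01.
  move=> x; rewrite -eq_le => /eqP <-; by rewrite subrr nm0 mulr0.
have Sub : ubound S 1 by move=> s [/andP[]].
have hS : has_ubound S by exists 1.
pose c := sup S.
have c01 : 0 <= c <= 1.
  by apply/andP; split; [apply: ub_le_sup | apply: ge_sup => //; exists 0].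
have [d d0 dP] := pK c c01 e e0.
have [s [[/andP[s0 s1] sS] sc]] : exists s, S s /\ c - d < s.
  have [|s Ss cs] := @sup_adherent _ S d d0; first by split => //; exists 0.
  by exists s.
have sc' : s <= c by apply: ub_le_sup => //; split => //; apply/andP.
have key x : 0 <= x <= 1 -> x < c + d -> nm (p x - p 0) <= (K + e) * x.
  move=> /andP[x0 x1] xcd; have [xs|sx] := leP x s; first by apply: sS; apply/andP.
  have n1 : nm (p s - p c) <= (K + e) * (c - s).
    have := dP s; rewrite distrC ger0_norm ?subr_ge0//.
    by apply; [apply/andP | lra].
  have n0 : nm (p s - p 0) <= (K + e) * s by apply: sS; rewrite s0 lexx.
  have [xc|cx] := ltP x c; last first.
    have n2 : nm (p x - p c) <= (K + e) * (x - c).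
      have := dP x; rewrite ger0_norm ?subr_ge0//.
      by apply; [apply/andP | lra].
    apply: le_trans (nm_tri (p c) _ _) _.
    have := nm_tri (p s) (p c) (p 0); rewrite (nm_distC (p c) (p s)); lra.
  have cx : 0 < c - x by rewrite subr_gt0.
  have [|y [_ yS] xy] := @sup_adherent _ S _ cx; first by split => //; exists 0.
  by apply: yS; rewrite x0 /=; move: xy; rewrite -/c; lra.
have : ~ c < 1.
  move=> c1; pose y := Num.min 1 (c + d / 2).
  have cy : c < y by rewrite lt_min c1 /=; lra.
  have y1 : y <= 1 by rewrite ge_min lexx.
  have yd : y <= c + d / 2 by rewrite ge_min lexx orbT.
  case/andP: c01 => c0 _.
  suff : S y by move=> /(ub_le_sup hS); rewrite -/c leNgt cy.
  split; first by apply/andP; split; lra.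
  by move=> x /andP[x0 xy]; apply: key; [apply/andP; split|]; lra.
move=> /negP; rewrite -leNgt => c1.
have := key 1; rewrite mulr1; apply; [by rewrite ler01 lexx | lra].
Qed.

(** The sets A for which Q holds on K minus A form a filter. If Q K failed, this filter would be
    proper and would cluster at a point of K, where the local hypothesis puts the complement of a
    neighbourhood into it. This replaces finite subcovers throughout. *)
Lemma compact_local_global (T : topologicalType) (K : set T) (Q : set T -> Prop) :
  compact K -> Q set0 ->
  (forall A B, Q B -> A `<=` B -> Q A) ->
  (forall A B, Q A -> Q B -> Q (A `|` B)) ->
  (forall x, K x -> exists2 U, nbhs x U & Q U) -> Q K.
Proof.
move=> cK Q0 Qmono QU Qloc; apply: contrapT => nQ.
pose F := [set A : set T | Q (K `\` A)].
have FF : Filter F.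
  split; rewrite /F /=.
  - by rewrite setDT.
  - move=> A B QA QB; change (Q (K `\` (A `&` B))).
    have -> : K `\` (A `&` B) = (K `\` A) `|` (K `\` B) by rewrite !setDE setCI setIUr.
    exact: QU.
  - by move=> A B AB QA; apply: Qmono QA _; apply: setDS.
have PF : ProperFilter F.
  by split=> // F0; apply: nQ; move: F0; rewrite /F /= setD0.
have FK : F K by rewrite /F /= setDv.
have [x [Kx clx]] := cK F PF FK.
have [U Ux QUx] := Qloc x Kx.
have FU : F (~` U) by rewrite /F /= setDE setCK; apply: Qmono QUx _ => y [].
by have [y [nUy Uy]] := clx _ _ FU Ux.
Qed.

Lemma compact_square (c : C) (r : R) :
  compact [set z : C | `|complex.Re (z - c)| <= r /\ `|complex.Im (z - c)| <= r].
Proof.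
pose g (x : R * R) : C := c + (x.1 +i* x.2).
have -> : [set z : C | `|complex.Re (z - c)| <= r /\ `|complex.Im (z - c)| <= r]
   = g @` (`[- r, r] `*` `[- r, r]).
  apply/seteqP; split=> z /=.
    move=> [zr zi]; exists (complex.Re (z - c), complex.Im (z - c)) => /=.
      by rewrite !in_itv /= -!ler_norml.
    by rewrite /g /=; case: z c {g zr zi} => [x y] [a b]; rewrite /= ; congr Complex; ring.
  move=> [[x y]]; rewrite /= !in_itv /= -!ler_norml => xy <-.
  by rewrite /g addrC addKr.
apply: continuous_compact; last by apply: compact_setX; exact: segment_compact.
apply: continuous_subspaceT => x; apply/cvgrPdist_lt => e e0.
have := e0; rewrite ltcE /= => /andP[/eqP im re].
have e2 : 0 < complex.Re e / 2 by rewrite divr_gt0.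
have xe : \forall y \near x, ball x (complex.Re e / 2) y by exact: nbhsx_ballx.
near=> y; have [h1 h2] : ball x (complex.Re e / 2) y by near: y.
rewrite -ball_normE /= in h1; rewrite -ball_normE /= in h2.
rewrite nmE ltcE /= im eqxx /=; apply: le_lt_trans (nm_le_ReIm _) _.
have -> : g x - g y = (x.1 - y.1) +i* (x.2 - y.2) :> C.
  by rewrite /g opprD addrACA subrr add0r.
by rewrite /=; lra.
Unshelve. all: by end_near. Qed.

Lemma compact_disc (c : C) (r : R) : compact [set z : C | nm (z - c) <= r].
Proof.
apply: subclosed_compact (@compact_square c r) _; last first.
  move=> z /= zr; split; apply: le_trans zr; [exact: Re_le_nm | exact: Im_le_nm].
rewrite -[X in closed X]setCK; apply: open_closedC; rewrite openE => z /= /negP.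
rewrite -ltNge => rz; apply: (proj2 (@nearP R C z _)); exists (nm (z - c) - r); first by rewrite subr_gt0.
move=> w wz /=; apply/negP; rewrite -ltNge.
have := nm_tri w z c; rewrite (nm_distC z w); lra.
Qed.

End Geometric.

(** * Goursat and the maximum modulus *)

Section Lines.
Context {R : realType}.
Local Notation C := (Cplx R).
Context {V W : normedModType C}.

Lemma diff_line (F : V -> W) (z v : V) (s : C) :
  differentiable F (z + s *: v) ->
  differentiable (fun u : C => F (z + u *: v)) s /\
  forall u, 'd (fun u : C => F (z + u *: v)) s u = u *: 'd F (z + s *: v) v.
Proof.
move=> dF; apply: frechet_is_diff.
  split; first by move=> a x y; rewrite scalerDl scalerA.
  by exists (nm ('d F (z + s *: v) v)) => u; rewrite nmZc mulrC.
move=> e e0; have e'0 : 0 < e / (nm v + 1).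
  by rewrite divr_gt0// ltr_wpDl// nm_ge0.
have v1 : 0 < nm v + 1 by rewrite ltr_wpDl// nm_ge0.
have [d d0 dP] := diff_frechet dF e'0; exists (d / (nm v + 1)); first by rewrite divr_gt0.
move=> w; rewrite ltr_pdivlMr// => wd.
have wv : nm (w *: v) <= nm w * (nm v + 1).
  by rewrite nmZc ler_wpM2l ?nm_ge0// lerDl.
have := dP (w *: v) (le_lt_trans wv wd).
rewrite linearZ scalerDl addrA => /le_trans; apply.
by rewrite mulrAC ler_pdivrMr// -mulrA ler_pM2l.
Unshelve. all: by []. Qed.

Lemma mean_value (F : V -> W) (z v : V) (K : R) :
  (forall s : R, 0 <= s <= 1 -> differentiable F (z + s%:C *: v) /\
     nm ('d F (z + s%:C *: v) v) <= K) ->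
  nm (F (z + v) - F z) <= K.
Proof.
move=> FK; have := @mean_value_path R W (fun s : R => F (z + s%:C *: v)) K.
rewrite scale1r scale0r addr0; apply => s /FK[dF leK] e e0.
have v1 : 0 < nm v + 1 by rewrite ltr_wpDl// nm_ge0.
have e'0 : 0 < e / (nm v + 1) by rewrite divr_gt0.
have [d d0 dP] := diff_frechet dF e'0; exists (d / (nm v + 1)); first by rewrite divr_gt0.
move=> t _; rewrite ltr_pdivlMr// => td.
have -> : z + t%:C *: v = z + s%:C *: v + (t - s)%:C *: v.
  by rewrite rmorphB scalerBl addrA addrAC addrK.
have tsv : nm ((t - s)%:C *: v) <= `|t - s| * (nm v + 1).
  by rewrite nmZc nm_real ler_wpM2l// lerDl.
have := dP _ (le_lt_trans tsv td); set A := F _; set B := F _ => le1.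
have le2 : e / (nm v + 1) * nm ((t - s)%:C *: v) <= e * `|t - s|.
  by rewrite mulrAC ler_pdivrMr// -mulrA ler_pM2l.
have le3 : nm ('d F (z + s%:C *: v) ((t - s)%:C *: v)) <= K * `|t - s|.
  by rewrite linearZ nmZc nm_real mulrC ler_wpM2r.
have := nmBl (A - B) ('d F (z + s%:C *: v) ((t - s)%:C *: v)).
rewrite mulrDl; lra.
Qed.

End Lines.

Section Goursat.
Context {R : realType}.
Local Notation C := (Cplx R).
Implicit Types (f g : C -> C) (p z d : C) (h : R).

(* The Riemann sum of the boundary integral of f over the square with lower
   left corner p, mesh d and n steps on each side. *)
Definition bsum f (n : nat) p d : C :=
  d * \sum_(k < n) (f (p + d * k%:R) - f (p + d * n%:R * ic + d * k%:R)
    + ic * (f (p + d * n%:R + d * k%:R * ic) - f (p + d * k%:R * ic))).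

Lemma sum_row_split (u : C -> C) (n q : nat) (e : C) p :
  \sum_(k < q * n) u (p + e * k%:R) =
  \sum_(a < q) \sum_(k < n) u (p + e * n%:R * a%:R + e * k%:R).
Proof.
elim: q p => [|q ih] p; first by rewrite !big_ord0.
rewrite mulSn big_split_ord big_ord_recl /= mulr0 addr0; congr (_ + _).
under eq_bigr do rewrite natrD mulrDr addrA.
rewrite ih; apply: eq_bigr => a _; apply: eq_bigr => k _.
by rewrite /bump /= add1n -natr1 mulrDr mulr1 -(addrA p) [e * _ + _]addrC.
Qed.

(** All subsquares share the mesh d, so a common edge gives literally the same sum with opposite
    signs. Horizontal edges ([hh]) telescope within a column, vertical ones ([gg]) within a row, and
    the outer boundary remains. *)
Lemma bsum_split f (n q : nat) p d :
  bsum f (q * n) p d =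
  \sum_(a < q) \sum_(b < q) bsum f n (p + d * n%:R * (a%:R + b%:R * ic)) d.
Proof.
pose H x := \sum_(k < n) f (x + d * k%:R).
pose G x := \sum_(k < n) f (x + d * k%:R * ic).
have bE m x : bsum f m x d = d * (\sum_(k < m) f (x + d * k%:R)
    - \sum_(k < m) f (x + d * m%:R * ic + d * k%:R)
    + ic * (\sum_(k < m) f (x + d * m%:R + d * k%:R * ic)
    - \sum_(k < m) f (x + d * k%:R * ic))).
  by rewrite -!sumrB mulr_sumr -big_split.
have tele (u : nat -> C) : \sum_(b < q) (u b - u b.+1) = u 0%N - u q.
  have := telescope_sumr u (leq0n q); rewrite big_mkord => E.
  by rewrite -[RHS]opprB -E -sumrN; apply: eq_bigr => i _; rewrite opprB.
have row x : \sum_(k < q * n) f (x + d * k%:R) = \sum_(a < q) H (x + d * n%:R * a%:R).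
  by rewrite sum_row_split.
have col x : \sum_(k < q * n) f (x + d * k%:R * ic)
    = \sum_(b < q) G (x + d * n%:R * b%:R * ic).
  under eq_bigr do rewrite -mulrA [_ * ic]mulrC mulrA.
  rewrite sum_row_split; apply: eq_bigr => a _; apply: eq_bigr => k _.
  by congr (f _); ring.
pose hh a b := H (p + d * n%:R * (a%:R + b%:R * ic)).
pose gg a b := G (p + d * n%:R * (a%:R + b%:R * ic)).
have -> : \sum_(a < q) \sum_(b < q) bsum f n (p + d * n%:R * (a%:R + b%:R * ic)) d
    = \sum_(a < q) \sum_(b < q) (d * (hh a b - hh a b.+1) + d * ic * (gg a.+1 b - gg a b)).
  apply: eq_bigr => a _; apply: eq_bigr => b _; rewrite bE mulrDr mulrA.
  congr (d * (_ - _) + d * ic * (_ - _)); apply: eq_bigr => k _; congr (f _);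
    by rewrite -natr1; ring.
under eq_bigr do rewrite big_split /= -!mulr_sumr (tele (hh _)).
rewrite big_split /= -!mulr_sumr exchange_big /=.
under [X in _ + _ * X]eq_bigr => b _.
  under eq_bigr do rewrite -opprB; rewrite sumrN (tele (gg^~ b)) opprB; over.
rewrite bE !row !col -!sumrB mulrDr -!mulrA.
congr (d * _ + d * (ic * _)); apply: eq_bigr => k _; congr (_ - _);
  by rewrite /hh /gg; congr (_ (_ : C)); ring.
Qed.

Lemma nm_sum (V : normedModType C) (I : finType) (F : I -> V) (E : R) :
  (forall i, nm (F i) <= E) -> nm (\sum_i F i) <= E *+ #|I|.
Proof.
move=> FE; rewrite -sum1_card -sumrMnr mulr1n.
elim/big_rec2: _ => [|i x y _ le1]; first by rewrite nm0.
by apply: le_trans (nmD _ _) _; rewrite lerD.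
Qed.

Lemma bsum_le f n p d (E : R) :
  (forall k, (k < n)%N ->
    [/\ nm (f (p + d * k%:R)) <= E, nm (f (p + d * n%:R * ic + d * k%:R)) <= E,
        nm (f (p + d * n%:R + d * k%:R * ic)) <= E & nm (f (p + d * k%:R * ic)) <= E]) ->
  nm (bsum f n p d) <= 4 * (nm d * n%:R) * E.
Proof.
move=> fE; rewrite /bsum nmM; set S := \sum_(k < n) _.
suff le1 : nm S <= 4 * E * n%:R.
  apply: le_trans (ler_wpM2l (nm_ge0 d) le1) _.
  by rewrite le_eqVlt; apply/orP; left; apply/eqP; ring.
rewrite mulr_natr -[n in _ *+ n]card_ord; apply: (@nm_sum C) => k.
have [e1 e2 e3 e4] := fE k (ltn_ord k).
apply: le_trans (nmD _ _) _; rewrite nmM nm_i mul1r.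
have := nmB (f (p + d * k%:R)) (f (p + d * n%:R * ic + d * k%:R)).
have := nmB (f (p + d * n%:R + d * k%:R * ic)) (f (p + d * k%:R * ic)).
lra.
Qed.

Lemma bsum_sub f g n p d :
  bsum (fun z => f z - g z) n p d = bsum f n p d - bsum g n p d.
Proof.
rewrite /bsum -mulrBr -sumrB; congr (d * _); apply: eq_bigr => k _; ring.
Qed.

Lemma bsumZ f (c : C) n p d : bsum (fun z => c * f z) n p d = c * bsum f n p d.
Proof.
rewrite /bsum mulrCA; congr (d * _); rewrite mulr_sumr; apply: eq_bigr => k _; ring.
Qed.

Lemma ic_sqr : ic * ic = -1 :> C. Proof. exact: sqr_i. Qed.

(** Bottom minus top is the constant - b d n i, right minus left is b d n; the weight i on the
    latter makes the two cancel for every mesh. *)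
Lemma bsum_affine (a b : C) n p d : bsum (fun z => a + b * z) n p d = 0.
Proof.
rewrite /bsum big1 ?mulr0// => k _.
have := ic_sqr; move: (ic : C) => I I2.
by transitivity (b * d * n%:R * (- I - I * I * I + I * (1 + I * I))); [ring | rewrite I2; ring].
Qed.

Definition sq p h : set C :=
  [set z | 0 <= complex.Re (z - p) <= h /\ 0 <= complex.Im (z - p) <= h].

Lemma ReD (a b : C) : complex.Re (a + b) = complex.Re a + complex.Re b.
Proof. by case: a b => [? ?] []. Qed.
Lemma ImD (a b : C) : complex.Im (a + b) = complex.Im a + complex.Im b.
Proof. by case: a b => [? ?] []. Qed.
Lemma ReN (a : C) : complex.Re (- a) = - complex.Re a.
Proof. by case: a. Qed.
Lemma ImN (a : C) : complex.Im (- a) = - complex.Im a.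
Proof. by case: a. Qed.

Lemma sq_nm p h z : sq p h z -> nm (z - p) <= 2 * h.
Proof.
move=> [/andP[a b] /andP[c e]]; apply: le_trans (nm_le_ReIm _) _.
rewrite !ger0_norm//; lra.
Qed.

Lemma nth_mesh (h : R) (n k : nat) : (0 < n)%N ->
  (h / n%:R)%:C * k%:R = (h * (k%:R / n%:R))%:C :> C.
Proof.
by move=> n0; rewrite -(rmorph_nat (real_complex R)) -rmorphM mulrAC -mulrA.
Qed.

Lemma mesh_all (h : R) (n : nat) : (0 < n)%N -> (h / n%:R)%:C * n%:R = h%:C :> C.
Proof. by move=> n0; rewrite nth_mesh// divff ?mulr1// pnatr_eq0 -lt0n. Qed.

Lemma bsum_sq_le f n p h (E : R) : (0 < n)%N -> 0 <= h ->
  (forall z, sq p h z -> [\/ complex.Re (z - p) = 0, complex.Re (z - p) = h,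
       complex.Im (z - p) = 0 | complex.Im (z - p) = h] -> nm (f z) <= E) ->
  nm (bsum f n p (h / n%:R)%:C) <= 4 * h * E.
Proof.
move=> n0 h0 fE; have := @bsum_le f n p (h / n%:R)%:C E.
have nn : n%:R != 0 :> R by rewrite pnatr_eq0 -lt0n.
rewrite nm_real ger0_norm ?divr_ge0// divfK//; apply => k kn.
rewrite mesh_all// nth_mesh//; set x : R := h * _.
have x0 : 0 <= x <= h.
  rewrite /x mulr_ge0 ?divr_ge0//= ler_piMr// ler_pdivrMr ?ltr0n// mul1r ler_nat.
  exact: ltnW.
have hh : 0 <= h <= h by rewrite h0 lexx.
have zz : 0 <= (0 : R) <= h by rewrite h0 lexx.
have rei (y : R) : complex.Re (y%:C * ic) = 0 by rewrite /= mulr0 mul0r subr0.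
have imi (y : R) : complex.Im (y%:C * ic) = y by rewrite /= mulr1 mul0r addr0.
have c1 a : p + a - p = a by rewrite addrC addKr.
have c2 a b : p + a + b - p = a + b by rewrite -(addrA p) c1.
by split; apply: fE; rewrite /sq /= ?c2 ?c1 ?ReD ?ImD ?rei ?imi /= ?add0r ?addr0 //;
  [constructor 3 | constructor 4 | constructor 2 | constructor 1].
Qed.

(** The bound is proportional to the area, hence additive under bisection. The factor n stays free
    because the subdivisions into nine squares below multiply the number of steps by powers of 3. *)
Definition small_bsum f n (eta : R) p h : Prop :=
  exists K, forall k, (K <= k)%N ->
    nm (bsum f (n * 2 ^ k) p (h / (n * 2 ^ k)%:R)%:C) <= eta * h ^+ 2.

Lemma small_bsum_split f n eta p h : (0 < n)%N ->
  (forall a b : 'I_2, small_bsum f n eta (p + (h / 2)%:C * (a%:R + b%:R * ic)) (h / 2)) ->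
  small_bsum f n eta p h.
Proof.
move=> n0 H.
have /choice[K KP] : forall ab : 'I_2 * 'I_2, exists K, forall k, (K <= k)%N ->
    nm (bsum f (n * 2 ^ k) (p + (h / 2)%:C * (ab.1%:R + ab.2%:R * ic))
      (h / 2 / (n * 2 ^ k)%:R)%:C) <= eta * (h / 2) ^+ 2.
  by move=> [a b]; exact: H.
(* One of the k doublings of the number of steps is spent on the bisection itself. *)
exists (\max_ab K ab).+1 => -[//|k] kK.
have n2 : (0 < n * 2 ^ k)%N by rewrite muln_gt0 n0 expn_gt0.
rewrite expnS mulnCA bsum_split natrM.
have -> : h / (2 * (n * 2 ^ k)%:R) = h / 2 / (n * 2 ^ k)%:R by rewrite invfM mulrA.
rewrite mesh_all// pair_big /=.
have -> : eta * h ^+ 2 = eta * (h / 2) ^+ 2 *+ #|{: 'I_2 * 'I_2}|.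
  by rewrite card_prod !card_ord -mulr_natr; field.
apply: (@nm_sum C) => ab; apply: KP.
by move: kK; rewrite ltnS; apply: leq_trans; apply: leq_bigmax.
Qed.

(** Otherwise nested squares violating the bound shrink to a point [z0]. There f is affine up to a
    small multiple of the distance, and the affine part contributes nothing at any mesh. *)
Lemma goursat f n eta p h : (0 < n)%N -> 0 < h -> 0 < eta ->
  (forall z, sq p h z -> differentiable f z) -> small_bsum f n eta p h.
Proof.
move=> n0 h0 eta0 df; apply: contrapT => bad0.
pose bad x k := ~ small_bsum f n eta x (h / 2 ^+ k).
have h2 k : h / 2 ^+ k.+1 = h / 2 ^+ k / 2 by rewrite exprSr invfM mulrA.
have hk k : 0 < h / 2 ^+ k by rewrite divr_gt0// exprn_gt0.
have next x k : exists ab : 'I_2 * 'I_2, bad x k ->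
    bad (x + (h / 2 ^+ k.+1)%:C * (ab.1%:R + ab.2%:R * ic)) k.+1.
  have [bx|] := pselect (bad x k); last by exists (ord0, ord0).
  apply: contrapT => nex; apply: bx; apply: small_bsum_split => // a b.
  apply: contrapT => nab; apply: nex; exists (a, b) => _.
  by rewrite /bad h2.
have [c cP] := @choice (C * nat) ('I_2 * 'I_2)%type (fun xk ab => bad xk.1 xk.2 ->
    bad (xk.1 + (h / 2 ^+ xk.2.+1)%:C * (ab.1%:R + ab.2%:R * ic)) xk.2.+1)
  (fun xk => next xk.1 xk.2).
pose u := fix u k := if k is j.+1 then
  u j + (h / 2 ^+ j.+1)%:C * ((c (u j, j)).1%:R + (c (u j, j)).2%:R * ic) else p.
have ubad k : bad (u k) k.
  elim: k => [|k ih]; first by rewrite /bad expr0 divr1.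
  exact: (cP (u k, k)).
have le1 (a : 'I_2) : 0 <= (a%:R : R) <= 1 by rewrite ler0n -[1]/(1%:R) ler_nat -ltnS ltn_ord.
have reu (x : R) (a b : 'I_2) :
    complex.Re (x%:C * (a%:R + b%:R * ic) : C) = x * a%:R /\
    complex.Im (x%:C * (a%:R + b%:R * ic) : C) = x * b%:R.
  rewrite -!(rmorph_nat (real_complex R)) /= !(mulr0, mulr1, mul0r, subr0, addr0, add0r).
  by [].
have step k x : sq (u k.+1) (h / 2 ^+ k.+1) x -> sq (u k) (h / 2 ^+ k) x.
  rewrite /sq /= opprD addrA !ReD !ImD !ReN !ImN.
  have [-> ->] := reu (h / 2 ^+ k.+1) (c (u k, k)).1 (c (u k, k)).2.
  move: (le1 (c (u k, k)).1) (le1 (c (u k, k)).2) (hk k); rewrite h2.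
  move: (_ / 2 ^+ k) => y; move: (_%:R) (_%:R) => a b /andP[a0 a1] /andP[b0 b1] y0.
  move=> [/andP[r0 r1] /andP[i0 i1]]; split; apply/andP; split; nra.
have usq k : sq (u k) (h / 2 ^+ k) (u k).
  by rewrite /sq /= subrr /= lexx ltW.
have uu k m x : sq (u (k + m)%N) (h / 2 ^+ (k + m)) x -> sq (u k) (h / 2 ^+ k) x.
  elim: m => [|m ih]; rewrite ?addn0// addnS => /step; exact: ih.
have [|z0 z0P] := @geom_cvg R u (2 * h).
  move=> k; rewrite -mulrA; apply: sq_nm; apply: (uu k 1%N); rewrite addn1; exact: usq.
have zsq : sq p h z0.
  have usq0 k : sq p h (u k).
    have := uu 0%N k (u k); rewrite add0n expr0 divr1; apply; exact: usq.
  have small e : 0 < e -> exists k, nm (u k - z0) <= e.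
    move=> e0; have [N NP] := half_small (4 * (2 * h)) e0.
    by exists N; apply: le_trans (z0P N) (ltW (NP N _)).
  have clos (x y : R) : (forall e, 0 < e -> x <= y + e) -> x <= y.
    by move=> xy; apply/ler_addgt0Pr.
  split; apply/andP; split; apply: clos => e e0; have [k kP] := small e e0;
    have := le_trans (Re_le_nm _) kP; have := le_trans (Im_le_nm _) kP;
    have := usq0 k; rewrite /sq /= !ReD !ImD !ReN !ImN !ler_norml;
    move=> [/andP[? ?] /andP[? ?]] /andP[? ?] /andP[? ?]; lra.
(* 48 = 4 * 12: the perimeter of the square number K is 4 hK, and its points are within 2 hK + 8 hK
   <= 12 hK of [z0]. *)
have e0 : 0 < eta / 48 by rewrite divr_gt0.
have [d d0 dP] := diff_frechet (df _ zsq) e0.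
have [K KP] := half_small (12 * h) d0.
apply: (ubad K); exists 0%N => m _.
set N := (n * 2 ^ m)%N; have N0 : (0 < N)%N by rewrite muln_gt0 n0 expn_gt0.
set hK := h / 2 ^+ K.
pose b := 'd f z0 1; pose aff z := (f z0 - b * z0) + b * z.
have -> : bsum f N (u K) (hK / N%:R)%:C = bsum (fun z => f z - aff z) N (u K) (hK / N%:R)%:C.
  by rewrite bsum_sub bsum_affine subr0.
apply: le_trans (@bsum_sq_le (fun z => f z - aff z) N (u K) hK (eta / 48 * (12 * hK)) _ _ _) _ => //.
- exact: ltW (hk K).
- move=> z zK _.
  have zz : nm (z - z0) <= 12 * hK.
    apply: le_trans (nm_tri (u K) _ _) _.
    have le8 : nm (u K - z0) <= 8 * hK.
      by apply: le_trans (z0P K) _; rewrite /hK le_eqVlt; apply/orP; left; apply/eqP; ring.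
    have := sq_nm zK; have := hk K; rewrite -/hK; lra.
  have := dP (z - z0); rewrite [z0 + _]addrC subrK.
  have zd : nm (z - z0) < d by apply: le_lt_trans zz _; rewrite /hK mulrA; apply: KP.
  move=> /(_ zd); have -> : f z - f z0 - 'd f z0 (z - z0) = f z - aff z.
    have -> : 'd f z0 (z - z0) = (z - z0) * b.
      by rewrite -[in LHS](mulr1 (z - z0)) [LHS]linearZ.
    rewrite /aff; ring.
  by move=> /le_trans; apply; rewrite ler_wpM2l// ltW.
- by rewrite le_eqVlt; apply/orP; left; apply/eqP; field.
Qed.

End Goursat.

Section Rules.
Context {R : realType}.
Local Notation C := (Cplx R).
Context {V : normedModType C}.

Lemma diff_mul (f g : V -> C) z : differentiable f z -> differentiable g z ->
  differentiable (fun w => f w * g w) z.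
Proof. exact: differentiableM. Qed.

Lemma diff_subc (f : V -> C) (c : C) z : differentiable f z ->
  differentiable (fun w => f w - c) z.
Proof. by move=> df; exact: (differentiableB df (differentiable_cst c z)). Qed.

Lemma diff_sub (W : normedModType C) (f g : V -> W) z : differentiable f z -> differentiable g z ->
  differentiable (fun w => f w - g w) z /\
  forall v, 'd (fun w => f w - g w) z v = 'd f z v - 'd g z v.
Proof.
by move=> df dg; split=> [|v]; [exact: differentiableB | exact: (congr1 (@^~ v) (diffB df dg))].
Qed.

Lemma diff_inv (z : C) : z != 0 -> differentiable (fun w : C => w^-1) z.
Proof. exact: differentiable_Rinv. Qed.

End Rules.

Section MaximumModulus.
Context {R : realType}.
Local Notation C := (Cplx R).
Implicit Types (f g : C -> C) (z : C) (s : R).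

Lemma Re_inv z : complex.Re z^-1 = complex.Re z / (complex.Re z ^+ 2 + complex.Im z ^+ 2).
Proof. by case: z. Qed.

Lemma Im_inv z : complex.Im z^-1 = - complex.Im z / (complex.Re z ^+ 2 + complex.Im z ^+ 2).
Proof. by case: z => x y /=; rewrite mulNr. Qed.

Definition corner s : C := (- s) +i* (- s).

Lemma sq_corner s z : sq (corner s) (2 * s) z <->
  - s <= complex.Re z <= s /\ - s <= complex.Im z <= s.
Proof.
rewrite /sq /= !ReD !ImD !ReN !ImN /=.
by split=> -[/andP[? ?] /andP[? ?]]; split; apply/andP; split; lra.
Qed.

(** A subdivision into nine squares isolates the puncture 0 in the middle one; Goursat makes each of
    the other eight contribute at most eta / 9. *)
Lemma bsum_annulus g n s eta : (0 < n)%N -> 0 < s -> 0 < eta ->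
  (forall z, sq (corner s) (2 * s) z -> z != 0 -> differentiable g z) ->
  exists K, forall k, (K <= k)%N ->
    nm (bsum g (3 * (n * 2 ^ k)) (corner s) (2 * s / (3 * (n * 2 ^ k))%:R)%:C
      - bsum g (n * 2 ^ k) (corner (s / 3)) (2 * (s / 3) / (n * 2 ^ k)%:R)%:C) <= eta.
Proof.
move=> n0 s0 eta0 dg.
have h0 : 0 < 2 * (s / 3) by lra.
pose eta' := eta / 9 / (2 * (s / 3)) ^+ 2.
have eta'0 : 0 < eta' by rewrite !divr_gt0// exprn_gt0.
pose q (ab : 'I_3 * 'I_3) := corner s + (2 * (s / 3))%:C * (ab.1%:R + ab.2%:R * ic).
pose mid : 'I_3 * 'I_3 := (inord 1, inord 1).
have qE ab : q ab = (- s + 2 * (s / 3) * ab.1%:R) +i* (- s + 2 * (s / 3) * ab.2%:R).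
  rewrite /q -!(rmorph_nat (real_complex R)) /corner; apply/eqP; rewrite eq_complex /=.
  by rewrite !(mulr0, mulr1, mul0r, subr0, addr0, add0r) !eqxx.
have le2 (a : 'I_3) : [\/ (a : nat) = 0%N, (a : nat) = 1%N | (a : nat) = 2%N].
  by case: a => -[|[|[|//]]] ?; [constructor 1|constructor 2|constructor 3].
have qsub ab z : sq (q ab) (2 * (s / 3)) z -> sq (corner s) (2 * s) z.
  rewrite sq_corner /sq /= !ReD !ImD !ReN !ImN qE /=.
  have s3 : s = 3 * (s / 3) by field.
  have : 0 < s / 3 by lra.
  move: (s / 3) s3 => t s3 t0.
  have ab2 (a : 'I_3) : 0 <= (a%:R : R) <= 2 by rewrite ler0n ler_nat -ltnS ltn_ord.
  move: (ab2 ab.1) (ab2 ab.2) => /andP[a0 a2] /andP[b0 b2].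
  have [? ?] := (mulr_ge0 (ltW t0) a0, mulr_ge0 (ltW t0) b0).
  have [? ?] := (ler_wpM2l (ltW t0) a2, ler_wpM2l (ltW t0) b2).
  by move=> -[/andP[? ?] /andP[? ?]]; split; apply/andP; split; lra.
have q0 ab : sq (q ab) (2 * (s / 3)) 0 -> ab = mid.
  rewrite /sq /= !ReD !ImD !ReN !ImN qE /= => -[/andP[A1 A2] /andP[A3 A4]].
  case: ab A1 A2 A3 A4 => a b /= A1 A2 A3 A4; congr pair; apply/val_inj; rewrite /= inordK//.
    by case: (le2 a) => // e; exfalso; move: A1 A2; rewrite e; clear -s0; lra.
  by case: (le2 b) => // e; exfalso; move: A3 A4; rewrite e; clear -s0; lra.
have qmid : q mid = corner (s / 3).
  rewrite qE /mid /= inordK// /corner; congr Complex; lra.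
have small ab : exists K, forall k, (K <= k)%N -> ab != mid ->
    nm (bsum g (n * 2 ^ k) (q ab) (2 * (s / 3) / (n * 2 ^ k)%:R)%:C) <= eta / 9.
  have [->|abm] := eqVneq ab mid; first by exists 0%N.
  have [|K KP] := @goursat R g n eta' (q ab) (2 * (s / 3)) n0 h0 eta'0.
    move=> z zq; apply: dg; first exact: qsub zq.
    by apply: contraNneq abm => z0; rewrite z0 in zq; apply/eqP/q0.
  exists K => k kK _; apply: le_trans (KP k kK) _.
  by rewrite /eta' divfK// gt_eqF// exprn_gt0.
have /choice[K KP] := small.
exists (\max_ab K ab)%N => k kK.
have n2 : (0 < n * 2 ^ k)%N by rewrite muln_gt0 n0 expn_gt0.
rewrite bsum_split natrM.
have -> : 2 * s / (3 * (n * 2 ^ k)%:R) = 2 * (s / 3) / (n * 2 ^ k)%:R.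
  by rewrite invfM !mulrA.
rewrite mesh_all// pair_big /= (bigD1 mid)//= -/(q mid) qmid [X in nm X]addrC addKr.
rewrite big_mkcond /=.
have -> : eta = (eta / 9) *+ #|{: 'I_3 * 'I_3}|.
  by rewrite card_prod !card_ord -mulr_natr; field.
apply: (@nm_sum R C) => ab; case: ifP => abm; last by rewrite nm0 divr_ge0// ltW.
by apply: KP => //; apply: leq_trans kK; apply: leq_bigmax.
Qed.

(** Iterating the previous lemma moves the contour to an arbitrarily small square around the
    puncture. Both meshes must agree, whence 3 ^ m times as many steps on the outer square. *)
Lemma bsum_shrink g m n s eta : (0 < n)%N -> 0 < s -> 0 < eta ->
  (forall z, sq (corner s) (2 * s) z -> z != 0 -> differentiable g z) ->
  exists K, forall k, (K <= k)%N ->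
    nm (bsum g (3 ^ m * (n * 2 ^ k)) (corner s) (2 * s / (3 ^ m * (n * 2 ^ k))%:R)%:C
      - bsum g (n * 2 ^ k) (corner (s / 3 ^+ m)) (2 * (s / 3 ^+ m) / (n * 2 ^ k)%:R)%:C)
    <= eta.
Proof.
elim: m n s eta => [|m ih] n s eta n0 s0 eta0 dg.
  by exists 0%N => k _; rewrite expn0 mul1n expr0 divr1 subrr nm0 ltW.
have n30 : (0 < 3 ^ m * n)%N by rewrite muln_gt0 expn_gt0.
have e20 : 0 < eta / 2 by rewrite divr_gt0.
have s30 : 0 < s / 3 by rewrite divr_gt0.
have [K1 K1P] := bsum_annulus n30 s0 e20 dg.
have [|K2 K2P] := ih n (s / 3) (eta / 2) n0 s30 e20.
  move=> z zs; apply: dg; move: zs; rewrite !sq_corner => -[/andP[? ?] /andP[? ?]].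
  by split; apply/andP; split; lra.
exists (maxn K1 K2) => k; rewrite geq_max => /andP[/K1P le1 /K2P le2].
have -> : s / 3 ^+ m.+1 = s / 3 / 3 ^+ m by rewrite exprS invfM mulrA.
move: le1; rewrite -mulnA mulnA -expnS => le1.
by apply: le_trans (nm_tri _ _ _) _; last (apply: le_trans (lerD le1 le2) _; lra).
Qed.

(* Cauchy's formula on a square, with the integral of dz/z only bounded below:
   each side contributes at least 1 to its imaginary part. *)
Lemma center_bound f (M : R) :
  (forall z, `|complex.Re z| <= 1 -> `|complex.Im z| <= 1 -> z != 0 -> differentiable f z) ->
  {for 0, continuous f} ->
  (forall z, 1 <= nm z <= 2 -> `|complex.Re z| <= 1 -> `|complex.Im z| <= 1 -> nm (f z) <= M) ->
  nm (f 0) <= 2 * M.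
Proof.
move=> df cf fM.
have bdz s z : 0 <= s -> sq (corner s) (2 * s) z ->
  [\/ complex.Re (z - corner s) = 0, complex.Re (z - corner s) = 2 * s,
       complex.Im (z - corner s) = 0 | complex.Im (z - corner s) = 2 * s] ->
  s <= nm z <= 2 * s.
  move=> s0; rewrite sq_corner !ReD !ImD !ReN !ImN /= => -[zr zi] bd.
  have le1 := Re_le_nm z; have le2 := Im_le_nm z; have le3 := nm_le_ReIm z.
  have rs : `|complex.Re z| <= s by rewrite ler_norml.
  have is_ : `|complex.Im z| <= s by rewrite ler_norml.
  apply/andP; split; last by lra.
  have [ar ai] := (ler_norm (complex.Re z), ler_norm (complex.Im z)).
  have := ler_norm (- complex.Re z); have := ler_norm (- complex.Im z); rewrite !normrN.
  by clear -rs is_ ar ai bd le1 le2; move=> ? ?; case: bd; lra.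
pose g z := (f z - f 0) * z^-1.
have dg z : sq (corner 1) (2 * 1) z -> z != 0 -> differentiable g z.
  rewrite sq_corner -!ler_norml => -[zr zi] z0.
  by apply: diff_mul; [apply: diff_subc; apply: df | apply: diff_inv].
(* The 4 is the lower bound for the sum of dz/z. The perimeter is 8 and 1/z is at most 1 in norm on
   it, which gives 8 M. Of the 9 e, one e pays for moving the contour of [g], and 8 e bounds the sum
   over the small square, where f z - f 0 is at most e by continuity and the size of 1/z compensates
   the perimeter. *)
suff key e : 0 < e -> 4 * nm (f 0) <= 8 * M + 9 * e.
  rewrite -(ler_pM2l (_ : 0 < 4)) //; apply/ler_addgt0Pr => e e0.
  have e9 : 0 < e / 9 by rewrite divr_gt0.
  by apply: le_trans (key _ e9) _; lra.
move=> e0; have [d d0 dP] := (proj1 (@contP _ _ _ f 0)) cf e e0.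
have [m mP] := half_small 2 d0.
have s3 : 0 < (3 : R) ^- m by rewrite invr_gt0 exprn_gt0.
have s3d : 2 * 3 ^- m < d.
  apply: le_lt_trans (mP m (leqnn _)); rewrite ler_pM2l//.
  by rewrite lef_pV2 ?posrE ?exprn_gt0// lerXn2r// ?nnegrE// ler_nat.
have [K KP] := @bsum_shrink g m 1 1 e erefl ltr01 e0 dg.
have := KP K (leqnn _); rewrite mul1n div1r mulr1.
set N := (3 ^ m * 2 ^ K)%N; set p := 2 / N%:R.
have N0 : (0 < N)%N by rewrite muln_gt0 !expn_gt0.
move=> le1.
have le2 : nm (bsum g (2 ^ K) (corner (3 ^- m)) (2 * 3 ^- m / (2 ^ K)%:R)%:C) <= 8 * e.
  have -> : 8 * e = 4 * (2 * 3 ^- m) * (e / 3 ^- m) by field; rewrite gt_eqF ?exprn_gt0.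
  apply: bsum_sq_le => [||z zs bd]; first by rewrite expn_gt0.
    by apply: mulr_ge0 => //; apply: ltW.
  have /andP[z1 z2] := bdz _ z (ltW s3) zs bd.
  rewrite /g nmM nmV; apply: ler_pM; rewrite ?nm_ge0 ?invr_ge0 ?nm_ge0//.
    by apply/ltW/dP; rewrite subr0; apply: le_lt_trans z2 s3d.
  by rewrite lef_pV2// posrE (lt_le_trans s3).
have nmg : nm (bsum g N (corner 1) p%:C) <= 9 * e.
  have := nm_tri (bsum g (2 ^ K) (corner (3 ^- m)) (2 * 3 ^- m / (2 ^ K)%:R)%:C)
    (bsum g N (corner 1) p%:C) 0.
  by rewrite !subr0; lra.
have gE : bsum g N (corner 1) p%:C =
    bsum (fun z => f z * z^-1) N (corner 1) p%:C - f 0 * bsum (fun z => z^-1) N (corner 1) p%:C.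
  by rewrite -bsumZ -bsum_sub /g; congr bsum; apply: funext => z; rewrite mulrBl.
have le3 : nm (bsum (fun z => f z * z^-1) N (corner 1) p%:C) <= 8 * M.
  have -> : 8 * M = 4 * (2 * 1) * M by lra.
  have -> : p = 2 * 1 / N%:R by rewrite mulr1.
  apply: bsum_sq_le => [||z zs bd]; [by [] | by rewrite mulr1 |].
  have /andP[z1 z2] := bdz _ z ler01 zs bd.
  have zM : nm (f z) <= M.
    move: zs; rewrite sq_corner -!ler_norml => -[zr zi].
    by apply: fM => //; rewrite z1 /=; move: z2; rewrite mulr1.
  rewrite nmM nmV -[M]mulr1; apply: ler_pM; rewrite ?nm_ge0 ?invr_ge0 ?nm_ge0//.
  by rewrite invf_le1// (lt_le_trans ltr01).
have le4 : 4 <= nm (bsum (fun z : C => z^-1) N (corner 1) p%:C).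
  apply: le_trans _ (Im_le_nm _); apply: le_trans _ (ler_norm _).
  rewrite /bsum; set S := \sum_(k < N) _.
  have -> : complex.Im (p%:C * S) = p * complex.Im S by case: S => a b /=; rewrite mul0r addr0.
  have -> : 4 = p * (2 * N%:R) by rewrite /p; field; rewrite pnatr_eq0 -lt0n.
  rewrite ler_pM2l ?divr_gt0 ?ltr0n// mulr_natr /S.
  have ImS (F : 'I_N -> C) : complex.Im (\sum_k F k) = \sum_k complex.Im (F k).
    by elim/big_rec2: _ => // k y1 y2 _ <-; rewrite ImD.
  rewrite ImS -[N in _ *+ N]card_ord -sumr_const; apply: ler_sum => k _.
  have pN : p%:C * N%:R = 2%:C :> C by rewrite /p mesh_all.
  rewrite pN /p nth_mesh// !ImD !ImN.
  (* With x as coordinate along a side, in [-1, 1], each of the four terms has imaginary part 1 / (1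
     + x^2) >= 1/2. *)
  pose x : R := 2 * (k%:R / N%:R) - 1.
  have xx : 2 * (k%:R / N%:R) = x + 1 by rewrite /x subrK.
  have x2 : x ^+ 2 <= 1.
    have k1 : 0 <= (k%:R / N%:R : R) <= 1.
      apply/andP; split; first by apply: divr_ge0; rewrite ler0n.
      by rewrite ler_pdivrMr ?ltr0n// mul1r ler_nat ltnW.
    rewrite /x; nra.
  have Imi (z : C) : complex.Im (ic * z) = complex.Re z by case: z => a b /=; rewrite mul0r mul1r add0r.
  rewrite Imi ReD ReN xx.
  have -> : corner 1 + (x + 1)%:C = x +i* (- 1) :> C.
    by rewrite /corner; apply/eqP; rewrite eq_complex /=; apply/andP; split; apply/eqP; ring.
  have -> : corner 1 + 2%:C * ic + (x + 1)%:C = x +i* 1 :> C.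
    by rewrite /corner; apply/eqP; rewrite eq_complex /=; apply/andP; split; apply/eqP; ring.
  have -> : corner 1 + 2%:C + (x + 1)%:C * ic = 1 +i* x :> C.
    by rewrite /corner; apply/eqP; rewrite eq_complex /=; apply/andP; split; apply/eqP; ring.
  have -> : corner 1 + (x + 1)%:C * ic = (- 1) +i* x :> C.
    by rewrite /corner; apply/eqP; rewrite eq_complex /=; apply/andP; split; apply/eqP; ring.
  rewrite !Im_inv !Re_inv /= !sqrrN !expr1n opprK [1 + x ^+ 2]addrC !mulNr opprK mul1r.
  have : 2^-1 <= (x ^+ 2 + 1)^-1.
    by rewrite lef_pV2 ?posrE ?ltr_wpDl// ?sqr_ge0//; lra.
  lra.
have := nmBl (f 0 * bsum (fun z : C => z^-1) N (corner 1) p%:C)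
  (bsum (fun z => f z * z^-1) N (corner 1) p%:C).
rewrite nm_distC -gE nmM.
have : nm (f 0) * 4 <= nm (f 0) * nm (bsum (fun z : C => z^-1) N (corner 1) p%:C).
  by rewrite ler_wpM2l ?nm_ge0.
lra.
Qed.
End MaximumModulus.

(** * Cauchy estimates and the Weierstrass theorem *)

Section Cauchy.
Context {R : realType}.
Local Notation C := (Cplx R).

Lemma diff_bounded_linear (V W : normedModType C) (F : V -> W) z :
  differentiable F z -> bounded_linear ('d F z).
Proof.
move=> dF; split; first exact: linearP.
by have [K _ KP] := linear_bound (diff_continuous dF); exists K.
Qed.

Lemma near_diff (V W : normedModType C) (F G : V -> W) z (d : R) : 0 < d ->
  (forall y, nm (y - z) < d -> F y = G y) -> differentiable F z ->
  differentiable G z /\ forall v, 'd G z v = 'd F z v.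
Proof.
move=> d0 FG dF; apply: frechet_is_diff; first exact: diff_bounded_linear.
move=> e e0; have [d' d'0 dP] := diff_frechet dF e0.
exists (Num.min d d'); first by rewrite lt_min d0.
move=> w; rewrite lt_min => /andP[wd wd']; rewrite -!FG ?subrr ?nm0//; first exact: dP.
by rewrite addrC addKr.
Qed.

Section Vec.
Context {V : normedModType C}.
Implicit Types (F : V -> C) (z v w : V).

Definition holo_ball F z (r : R) := forall y, nm (y - z) < r -> differentiable F y.

Lemma diff_shift F z c : differentiable F (z + c) ->
  differentiable (fun y => F (y + c)) z /\ forall v, 'd (fun y => F (y + c)) z v = 'd F (z + c) v.
Proof.
move=> dF; apply: frechet_is_diff; first exact: diff_bounded_linear.
move=> e e0; have [d d0 dP] := diff_frechet dF e0; exists d => // w wd.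
by rewrite (addrAC z); apply: dP.
Qed.

Lemma linear_mul (L : {linear V -> C}) (a : C) v : L (a *: v) = a * L v.
Proof. by rewrite linearZ. Qed.

(** [center_bound] is applied to the difference quotient along u -> z + u w', completed at u = 0 by
    the derivative; continuity at 0 is all it asks there. With w' of length s / 3 the square,
    contained in |u| <= 2, stays inside the ball. The constant is 12 = 3 * 2 * 2: the scaling of w',
    the factor of [center_bound], and the bound 2 M of the difference. *)
Lemma cauchy_est F z (s M : R) : 0 < s -> holo_ball F z s ->
  (forall y, nm (y - z) < s -> nm (F y) <= M) ->
  forall w, nm ('d F z w) <= 12 * M / s * nm w.
Proof.
move=> s0 hF FM w; have [->|w0] := eqVneq w 0; first by rewrite linear0 !nm0 mulr0.
have nw : 0 < nm w by rewrite nm_gt0.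
pose a := s / (3 * nm w); have a0 : 0 < a by rewrite divr_gt0// mulr_gt0.
pose w' := a%:C *: w.
have nw' : nm w' = s / 3.
  by rewrite /w' nmZc nm_real gtr0_norm// /a; field; rewrite gt_eqF.
have inb (u : C) : nm u <= 2 -> nm (z + u *: w' - z) < s.
  by move=> u2; rewrite addrC addKr nmZc nw'; nra.
pose phi (u : C) := F (z + u *: w').
have dphi u : nm u <= 2 -> differentiable phi u.
  by move=> u2; have [] := diff_line (hF _ (inb u u2)).
have F0 : F z = phi 0 by rewrite /phi scale0r addr0.
pose psi (u : C) : C := if u == 0 then 'd F z w' else (phi u - phi 0) * u^-1.
have n2 (u : C) : `|complex.Re u| <= 1 -> `|complex.Im u| <= 1 -> nm u <= 2.
  by move=> u1 u2; apply: le_trans (nm_le_ReIm _) _; lra.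
have zF : differentiable F z by apply: hF; rewrite subrr nm0.
have psi0 : psi 0 = 'd F z w' by rewrite /psi eqxx.
have := @center_bound R psi (2 * M); rewrite psi0.
have -> : 'd F z w' = a%:C * 'd F z w by rewrite /w' linear_mul.
rewrite nmM nm_real gtr0_norm// => H.
suff : a * nm ('d F z w) <= 2 * (2 * M).
  rewrite -ler_pdivlMl// => /le_trans; apply.
  rewrite /a; rewrite le_eqVlt; apply/orP; left; apply/eqP; field.
  by rewrite !gt_eqF.
apply: H.
- move=> u u1 u2 u0.
  have : differentiable (fun u => (phi u - phi 0) * u^-1) u.
    by apply: diff_mul; [apply: diff_subc; apply: dphi; apply: n2 | apply: diff_inv].
  move=> /(@near_diff _ _ _ psi _ (nm u)); case; rewrite ?nm_gt0// => y yu.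
  rewrite /psi ifN//; apply: contraTneq yu => ->.
  by rewrite sub0r nmN ltxx.
- apply/contP => e e0; have e2 : 0 < e / (2 * nm w') by rewrite divr_gt0// mulr_gt0// nw' divr_gt0.
  have nw'0 : 0 < nm w' by rewrite nw' divr_gt0.
  have [d d0 dP] := diff_frechet zF e2; exists (d / nm w'); first by rewrite divr_gt0.
  move=> u; rewrite subr0 ltr_pdivlMr// => ud; rewrite /psi eqxx.
  case: eqVneq => [_|u0]; first by rewrite subrr nm0.
  have nu : 0 < nm u by rewrite nm_gt0.
  have := dP (u *: w'); rewrite nmZc => /(_ ud); rewrite linear_mul F0 -/(phi u) => le1.
  have -> : (phi u - phi 0) * u^-1 - 'd F z w' = (phi u - phi 0 - u * 'd F z w') * u^-1.
    by rewrite [in RHS]mulrBl mulrAC divff// mul1r.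
  rewrite nmM nmV ltr_pdivrMr//; apply: le_lt_trans le1 _.
  have -> : e / (2 * nm w') * (nm u * nm w') = e / 2 * nm u.
    by field; rewrite gt_eqF.
  by rewrite ltr_pM2r// ltr_pdivrMr// ltr_pMr// ltr1n.
- move=> u /andP[u1 u2] _ _; rewrite /psi ifN; last by rewrite -nm_gt0 (lt_le_trans ltr01).
  rewrite nmM nmV; apply: le_trans (_ : 2 * M * 1 <= _); last by rewrite mulr1.
  apply: ler_pM; rewrite ?nm_ge0 ?invr_ge0 ?nm_ge0//.
    apply: le_trans (nmB _ _) _.
    have := FM _ (inb u u2); rewrite -/(phi u) -F0.
    have := FM z; rewrite subrr nm0 => /(_ s0); lra.
  by rewrite invf_le1// (lt_le_trans ltr01).
Qed.

End Vec.
End Cauchy.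

Section Weierstrass.
Context {R : realType}.
Local Notation C := (Cplx R).
Context {V : normedModType C}.
Implicit Types (F : V -> C) (z v w : V).

Lemma holo_sub F z (r : R) y s : holo_ball F z r -> nm (y - z) <= r - s -> holo_ball F y s.
Proof.
by move=> hF yz x xy; apply: hF; apply: le_lt_trans (nm_tri y _ _) _; lra.
Qed.

Lemma nm_segment z0 z v (r s : R) : nm (z - z0) < r -> nm (z + v - z0) < r ->
  0 <= s <= 1 -> nm (z + s%:C *: v - z0) < r.
Proof.
move=> h0 h1 /andP[s0 s1].
have -> : z + s%:C *: v - z0 = (1 - s)%:C *: (z - z0) + s%:C *: (z + v - z0).
  have -> : z + v - z0 = (z - z0) + v by rewrite addrAC.
  by rewrite [in RHS](scalerDr s%:C) addrA -scalerDl -rmorphD subrK rmorph1 scale1r addrAC.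
apply: le_lt_trans (nmD _ _) _; rewrite !nmZc !nm_real !ger0_norm ?subr_ge0//.
move: (nm (z - z0)) (nm (z + v - z0)) h0 h1 => A B Ar Br.
have s1' : 0 <= 1 - s by rewrite subr_ge0.
by case: (leP A B) => [AB|/ltW AB]; [have := ler_wpM2l s1' AB | have := ler_wpM2l s0 AB]; lra.
Qed.

(** Two Cauchy estimates in succession: 12 * (24 M / r) / (r / 4). *)
Definition taylor_const (M r : R) : R := 1152 * M / r ^+ 2.

Lemma taylor_const_ge0 (M r : R) : 0 <= M -> 0 <= taylor_const M r.
Proof. move=> M0; exact: (divr_ge0 (mulr_ge0 (ler0n _ _) M0) (sqr_ge0 _)). Qed.

Lemma holo_lip F z0 (r M : R) : 0 < r -> holo_ball F z0 r ->
  (forall y, nm (y - z0) < r -> nm (F y) <= M) ->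
  forall z v, nm (z - z0) < r / 2 -> nm (z + v - z0) < r / 2 ->
  nm (F (z + v) - F z) <= 24 * M / r * nm v.
Proof.
move=> r0 hF FM z v z1 z2; apply: mean_value => s s01.
have zs := nm_segment z1 z2 s01.
split; first by apply: hF; lra.
have -> : 24 * M / r * nm v = 12 * M / (r / 2) * nm v by field; rewrite gt_eqF.
apply: cauchy_est; first by rewrite divr_gt0.
  by apply: holo_sub hF _; lra.
by move=> y yz; apply: FM; apply: le_lt_trans (nm_tri (z + s%:C *: v) _ _) _; lra.
Qed.

(** Second derivatives are not yet at hand. But y -> F (y + v) - F y is holomorphic and, by
    [holo_lip], bounded by a multiple of nm v, so a Cauchy estimate bounds its differential. *)
Lemma diff_lip F z0 (r M : R) : 0 < r -> holo_ball F z0 r ->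
  (forall y, nm (y - z0) < r -> nm (F y) <= M) ->
  forall z v w, nm (z - z0) < r / 4 -> nm (z + v - z0) < r / 4 ->
  nm ('d F (z + v) w - 'd F z w) <= taylor_const M r * nm v * nm w.
Proof.
move=> r0 hF FM z v w z1 z2.
have [d1 d1E] : differentiable (fun y => F (y + v)) z /\
    forall w, 'd (fun y => F (y + v)) z w = 'd F (z + v) w.
  by apply: diff_shift; apply: hF; lra.
have d2 : differentiable F z by apply: hF; lra.
have dE : 'd F (z + v) w - 'd F z w = 'd (fun y => F (y + v) - F y) z w.
  have [_ dsE] := diff_sub d1 d2.
  exact: (esym (etrans (dsE w) (congr1 (fun x => x - 'd F z w) (d1E w)))).
rewrite dE.
have -> : taylor_const M r * nm v * nm w = 12 * (24 * M / r * nm v) / (r / 4) * nm w.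
  by rewrite /taylor_const; field; rewrite gt_eqF.
apply: cauchy_est; first by rewrite divr_gt0.
  move=> y yz.
  have y1 : nm (y - z0) < r by apply: le_lt_trans (nm_tri z _ _) _; lra.
  have y2 : nm (y + v - z0) < r.
    apply: le_lt_trans (nm_tri (z + v) _ _) _.
    have -> : y + v - (z + v) = y - z by rewrite opprD addrACA subrr addr0.
    lra.
  have [dy _] := diff_shift (hF _ y2).
  by have [] := diff_sub dy (hF _ y1).
move=> y yz; apply: (holo_lip r0 hF FM).
  by apply: le_lt_trans (nm_tri z _ _) _; lra.
apply: le_lt_trans (nm_tri (z + v) _ _) _.
have -> : y + v - (z + v) = y - z by rewrite opprD addrACA subrr addr0.
lra.
Qed.

Lemma taylor_order2 F z0 (r M : R) : 0 < r -> holo_ball F z0 r ->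
  (forall y, nm (y - z0) < r -> nm (F y) <= M) ->
  forall w, nm w < r / 4 ->
  nm (F (z0 + w) - F z0 - 'd F z0 w) <= taylor_const M r * nm w ^+ 2.
Proof.
move=> r0 hF FM w wr.
have M0 : 0 <= M by apply: le_trans (nm_ge0 (F z0)) (FM _ _); rewrite subrr nm0.
have d0 : differentiable F z0 by apply: hF; rewrite subrr nm0.
have cL := diff_continuous d0.
have -> : F (z0 + w) - F z0 - 'd F z0 w =
   (F (z0 + w) - 'd F z0 (z0 + w)) - (F z0 - 'd F z0 z0).
  by rewrite linearD; ring.
apply: (@mean_value R V C (fun y => F y - 'd F z0 y)) => s s01.
have sw : nm (s%:C *: w) <= nm w.
  by move/andP: s01 => [s0 s1]; rewrite nmZc nm_real ger0_norm// ler_piMl// nm_ge0.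
have dF : differentiable F (z0 + s%:C *: w).
  apply: hF; rewrite addrC addKr; apply: le_lt_trans sw _; lra.
have dL := @linear_differentiable _ _ _ ('d F z0) (z0 + s%:C *: w) cL.
have [dFL dFLE] := diff_sub dF dL; split=> //.
have -> : 'd (fun y => F y - 'd F z0 y) (z0 + s%:C *: w) w =
    'd F (z0 + s%:C *: w) w - 'd F z0 w.
  exact: (etrans (dFLE w) (congr1 (fun h => _ - h w) (diff_lin _ cL))).
apply: le_trans (diff_lip r0 hF FM w _ _) _.
- by rewrite subrr nm0 divr_gt0.
- rewrite addrC addKr; lra.
rewrite expr2 mulrA ler_wpM2r ?nm_ge0// ler_wpM2l//.
exact: taylor_const_ge0.
Qed.

(** The remainder in [taylor_order2] depends only on M and r, so it survives the limit. The
    candidate L is the limit of the differentials of F k, which converge geometrically by the Cauchy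
    estimate for F k.+1 - F k. *)
Lemma weierstrass (F : nat -> V -> C) (G : V -> C) z0 (r K M : R) : 0 < r ->
  (forall k, holo_ball (F k) z0 r) ->
  (forall k y, nm (y - z0) < r -> nm (F k y) <= M) ->
  (forall k y, nm (y - z0) < r -> nm (F k y - G y) <= K * 2 ^- k) ->
  differentiable G z0.
Proof.
move=> r0 hF FM FG.
have z0r : nm (z0 - z0) < r by rewrite subrr nm0.
have dF k : differentiable (F k) z0 by exact: hF.
pose K' := 12 * (2 * K) / r.
have stepF k y : nm (y - z0) < r -> nm (F k.+1 y - F k y) <= 2 * K * 2 ^- k.
  move=> yr; apply: le_trans (nm_tri (G y) _ _) _; rewrite (nm_distC (G y)).
  have := FG k.+1 y yr; have := FG k y yr; rewrite halfS.
  have K0 : 0 <= K * 2 ^- k by apply: le_trans (nm_ge0 _) (FG k y yr).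
  lra.
have stepD w k : nm ('d (F k.+1) z0 w - 'd (F k) z0 w) <= K' * nm w * 2 ^- k.
  have -> : 'd (F k.+1) z0 w - 'd (F k) z0 w = 'd (fun y => F k.+1 y - F k y) z0 w.
    by have [_ dsE] := diff_sub (dF k.+1) (dF k); exact: (esym (dsE w)).
  have -> : K' * nm w * 2 ^- k = 12 * (2 * K * 2 ^- k) / r * nm w by rewrite /K'; ring.
  apply: (cauchy_est r0) => [|y yr]; last exact: stepF.
  by move=> y yr; have [] := diff_sub (hF k.+1 _ yr) (hF k _ yr).
pose L w := glim (fun k => 'd (F k) z0 w).
have LP w k : nm ('d (F k) z0 w - L w) <= 4 * (K' * nm w) * 2 ^- k.
  exact: (@glimP R (fun k => 'd (F k) z0 w)).
pose A := taylor_const M r.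
suff : forall w, nm w < r / 4 -> nm (G (z0 + w) - G z0 - L w) <= A * nm w ^+ 2.
  move=> GL; suff [] : differentiable G z0 /\ forall v, 'd G z0 v = L v by [].
  apply: frechet_is_diff.
    split.
      move=> a x y; apply: (@glimE R _ (nm (a : C) * (4 * (K' * nm x)) + 4 * (K' * nm y))) => k.
      rewrite linearP /= -[a *: 'd _ _ _]/(a * _) -[a *: L x]/(a * L x).
      have -> : a * 'd (F k) z0 x + 'd (F k) z0 y - (a * L x + L y) =
         a * ('d (F k) z0 x - L x) + ('d (F k) z0 y - L y) by ring.
      apply: le_trans (nmD _ _) _; rewrite nmM mulrDl lerD// -mulrA.
      by rewrite ler_wpM2l ?nm_ge0.
    have [B B0 BP] := linear_bound (diff_continuous (dF 0%N)).
    exists (B + 4 * K') => w.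
    have := LP w 0%N; rewrite expr0 invr1 mulr1 nm_distC => le1.
    have := nmBl (L w) ('d (F 0%N) z0 w); have := BP w; lra.
  move=> e e0; have A1 : 0 < `|A| + 1 by rewrite ltr_wpDl.
  exists (Num.min (r / 4) (e / (`|A| + 1))).
    by rewrite lt_min !divr_gt0.
  move=> w; rewrite lt_min => /andP[w1]; rewrite ltr_pdivlMr// => w2; apply: le_trans (GL w w1) _.
  rewrite expr2 mulrA ler_wpM2r ?nm_ge0//; apply: le_trans _ (ltW w2).
  by rewrite mulrC ler_wpM2l ?nm_ge0//; have := ler_norm A; lra.
move=> w wr; rewrite -subr_le0.
apply: (@geom_le0 R (2 * K + 4 * (K' * nm w))) => k.
have wr' : nm (z0 + w - z0) < r by rewrite addrC addKr; lra.
have t1 := taylor_order2 r0 (hF k) (FM k) wr.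
have t2 := FG k _ wr'; have t3 := FG k _ z0r; have t4 := LP w k.
have -> : G (z0 + w) - G z0 - L w =
  (F k (z0 + w) - F k z0 - 'd (F k) z0 w) - (F k (z0 + w) - G (z0 + w)) +
  (F k z0 - G z0) + ('d (F k) z0 w - L w) by ring.
rewrite -/A in t1.
set a := F k (z0 + w) - F k z0 - _ in t1 *; set b := _ - G (z0 + w) in t2 *.
set c := _ - G z0 in t3 *; set d := _ - L w in t4 *.
have := nmD (a - b + c) d; have := nmD (a - b) c; have := nmB a b; lra.
Qed.

(** The difference quotients in direction v with steps 2^-(k + N) are holomorphic and converge
    geometrically to the derivative, so [weierstrass] applies; N keeps the displaced points inside
    the ball. *)
Theorem holo_derive F z0 v (r' : R) : 0 < r' -> holo_ball F z0 r' ->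
  differentiable (fun z => 'd F z v) z0.
Proof.
move=> r0' hF'.
have [r [r0 hF [M FM]]] : exists r, [/\ 0 < r, holo_ball F z0 r &
    exists M, forall y, nm (y - z0) < r -> nm (F y) <= M].
  have dF : differentiable F z0 by apply: hF'; rewrite subrr nm0.
  have [d d0 dP] := (proj1 (contP _ _)) (differentiable_continuous dF) 1 ltr01.
  exists (Num.min r' d); rewrite lt_min r0' d0; split => //.
    by move=> y; rewrite lt_min => /andP[yr _]; apply: hF'.
  exists (nm (F z0) + 1) => y; rewrite lt_min => /andP[_ /dP le1].
  by have := nmBl (F y) (F z0); lra.
have M0 : 0 <= M by apply: le_trans (nm_ge0 (F z0)) (FM _ _); rewrite subrr nm0.
have r8 : 0 < r / 8 by rewrite divr_gt0.
have [N NP] := half_small (nm v) r8.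
have [A A0 AE] : exists2 A, 0 <= A & A = taylor_const M (r / 2).
  by exists (taylor_const M (r / 2)); first exact: taylor_const_ge0.
pose h k : R := 2 ^- (k + N).
have h0 k : 0 < h k by exact: half_gt0.
pose G k z : C := ((h k)^-1)%:C * (F (z + (h k)%:C *: v) - F z).
have hv k : nm ((h k)%:C *: v) < r / 8.
  rewrite nmZc nm_real gtr0_norm// mulrC; apply: NP; exact: leq_addl.
have hh k : h k <= 2 ^- k.
  by rewrite lef_pV2 ?posrE ?exprn_gt0// ler_eXn2l ?ltr1n// leq_addr.
have est k y : nm (y - z0) < r / 2 -> nm (G k y - 'd F y v) <= A * nm v ^+ 2 * 2 ^- k.
  move=> yr.
  have r2 : 0 < r / 2 by rewrite divr_gt0.
  have hFy : holo_ball F y (r / 2) by apply: holo_sub hF _; lra.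
  have FMy x : nm (x - y) < r / 2 -> nm (F x) <= M.
    by move=> xy; apply: FM; apply: le_lt_trans (nm_tri y _ _) _; lra.
  have hvk : nm ((h k)%:C *: v) < r / 2 / 4 by have := hv k; lra.
  have := taylor_order2 r2 hFy FMy hvk; rewrite -AE linear_mul => le1.
  have -> : G k y - 'd F y v = ((h k)^-1)%:C *
      (F (y + (h k)%:C *: v) - F y - (h k)%:C * 'd F y v).
    by rewrite [RHS]mulrBr mulrA -rmorphM mulVf ?gt_eqF// rmorph1 mul1r.
  rewrite nmM nm_real gtr0_norm ?invr_gt0// ler_pdivrMl//; apply: le_trans le1 _.
  rewrite nmZc nm_real gtr0_norm// exprMn.
  have -> : h k * (A * nm v ^+ 2 * 2 ^- k) = (h k * 2 ^- k) * (A * nm v ^+ 2) by ring.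
  have -> : A * (h k ^+ 2 * nm v ^+ 2) = (h k * h k) * (A * nm v ^+ 2) by ring.
  exact: (ler_wpM2r (mulr_ge0 A0 (sqr_ge0 _)) (ler_wpM2l (ltW (h0 k)) (hh k))).
apply: (@weierstrass G _ z0 (r / 2) (A * nm v ^+ 2)
   (12 * M / (r / 2) * nm v + A * nm v ^+ 2)); first by rewrite divr_gt0.
- move=> k y yr.
  apply: diff_mul; first exact: differentiable_cst.
  have dy : differentiable F y by apply: hF; lra.
  have [|d1 _] := @diff_shift R V F y ((h k)%:C *: v); last by have [] := diff_sub d1 dy.
  apply: hF; rewrite addrAC; apply: le_lt_trans (nmD _ _) _.
  by have := hv k; lra.
- move=> k y yr; have le1 := est k y yr.
  have : nm ('d F y v) <= 12 * M / (r / 2) * nm v.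
    apply: cauchy_est; first by rewrite divr_gt0.
      by apply: holo_sub hF _; lra.
    by move=> x xy; apply: FM; apply: le_lt_trans (nm_tri y _ _) _; lra.
  have : A * nm v ^+ 2 * 2 ^- k <= A * nm v ^+ 2.
    rewrite -[X in _ <= X]mulr1; apply: (ler_wpM2l (mulr_ge0 A0 (sqr_ge0 _))).
    by rewrite invf_le1 ?exprn_gt0// exprn_ege1// ler1n.
  have := nmBl (G k y) ('d F y v); lra.
- exact: est.
Qed.

End Weierstrass.

(** * Order of vanishing *)

Section Order.
Context {R : realType}.
Local Notation C := (Cplx R).
Implicit Types (f : nat -> C -> C) (t c : C) (r K M : R).

(** The successive derivatives are given as data because the instances are partial derivatives in t
    of a function of (t, l), with l frozen. *)
Definition deriv_seq f (m : nat) t r := forall l s, (l < m)%N -> nm (s - t) < r ->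
  differentiable (f l) s /\ 'd (f l) s 1 = f l.+1 s.

Lemma frechet_deriv (g : C -> C) (t b : C) :
  (forall e : R, 0 < e -> exists2 d : R, 0 < d &
    forall w : C, nm w < d -> nm (g (t + w) - g t - b * w) <= e * nm w) ->
  differentiable g t /\ 'd g t 1 = b.
Proof.
move=> gt; have [||dg dE] := @frechet_is_diff R C C g t (fun w => b * w).
- split; first by move=> x y z; rewrite -[x *: y]/(x * y) -[x *: _]/(x * _); ring.
  by exists (nm (b : C)) => w; rewrite nmM.
- exact: gt.
- by split=> //; rewrite dE mulr1.
Qed.

Lemma diff_deriv (g : C -> C) (t : C) v : differentiable g t -> 'd g t v = v * 'd g t 1.
Proof. by move=> dg; rewrite -{1}[v]mulr1 [LHS]linear_mul. Qed.

Lemma diff_mul_deriv (g h : C -> C) t a b :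
  differentiable g t /\ 'd g t 1 = a -> differentiable h t /\ 'd h t 1 = b ->
  differentiable (fun s => g s * h s) t /\ 'd (fun s => g s * h s) t 1 = a * h t + g t * b.
Proof.
move=> [dg <-] [dh <-]; split; first exact: diff_mul.
rewrite addrC [X in _ + X]mulrC.
exact: (congr1 (fun L => L 1) (diffM dg dh)).
Qed.

Lemma diff_pow (a t0 : C) k t :
  differentiable (fun s : C => a * (s - t0) ^+ k) t /\
  'd (fun s : C => a * (s - t0) ^+ k) t 1 = a * (k%:R * (t - t0) ^+ k.-1).
Proof.
have dlin : differentiable (fun s : C => s - t0) t /\ 'd (fun s : C => s - t0) t 1 = 1.
  apply: frechet_deriv => e e0; exists 1 => // w _.
  have -> : t + w - t0 - (t - t0) - 1 * w = 0 by ring.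
  by rewrite nm0 mulr_ge0 ?nm_ge0// ltW.
elim: k => [|k ih].
  apply: frechet_deriv => e e0; exists 1 => // w _.
  by rewrite !expr0 subrr mul0r mulr0 mul0r subrr nm0 mulr_ge0 ?nm_ge0// ltW.
have E : (fun s : C => a * (s - t0) ^+ k.+1) = (fun s => (a * (s - t0) ^+ k) * (s - t0)).
  by apply: funext => s; rewrite exprSr mulrA.
rewrite E; have [dd dE] := diff_mul_deriv ih dlin; split => //.
apply: (etrans dE); rewrite -natr1.
by case: k {ih E dd dE} => [|k] /=; rewrite ?exprS; ring.
Qed.

Lemma taylor_zero f m c r t0 K : deriv_seq f m c r -> nm (t0 - c) < r ->
  (forall l, (l < m)%N -> f l t0 = 0) ->
  (forall t, nm (t - c) < r -> nm (f m t) <= K) ->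
  forall t, nm (t - c) < r -> nm (f 0%N t) <= K * nm (t - t0) ^+ m.
Proof.
elim: m f => [|m ih] f df t0r f0 fK t tr; first by rewrite expr0 mulr1; apply: fK.
have K0 : 0 <= K by apply: le_trans (nm_ge0 _) (fK _ t0r).
have ih' := ih (fun l => f l.+1) (fun l s lm => df l.+1 s lm) t0r (fun l lm => f0 l.+1 lm) fK.
rewrite -[f 0%N t]subr0 -(f0 0%N (ltn0Sn _)).
have tE : t = t0 + (t - t0) by rewrite addrC subrK.
rewrite {1}tE; apply: mean_value => s s01.
have sr : nm (t0 + s%:C *: (t - t0) - c) < r by apply: nm_segment => //; rewrite -tE.
have [dfs dfE] := df 0%N _ (ltn0Sn _) sr; split => //.
rewrite (diff_deriv _ dfs) nmM dfE exprS mulrCA ler_wpM2l ?nm_ge0//.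
apply: le_trans (ih' _ sr) _; rewrite ler_wpM2l// lerXn2r ?nnegrE ?nm_ge0//.
rewrite addrC addKr nmZc nm_real; case/andP: s01 => s0 s1.
by rewrite ger0_norm// ler_piMl// nm_ge0.
Qed.

(** [taylor_zero] applied to the differences f l - q l, where q l is the l-th derivative of the
    leading monomial. *)
Lemma order_expand f m c r t0 a K : deriv_seq f m c r -> nm (t0 - c) < r ->
  (forall l, (l < m)%N -> f l t0 = 0) ->
  (forall t, nm (t - c) < r -> nm (f m t - a) <= K) ->
  forall t, nm (t - c) < r ->
  nm (f 0%N t - a / m`!%:R * (t - t0) ^+ m) <= K * nm (t - t0) ^+ m.
Proof.
move=> df t0r f0 fa t tr.
pose q l t := a / (m - l)`!%:R * (t - t0) ^+ (m - l).
have -> : a / m`!%:R * (t - t0) ^+ m = q 0%N t by rewrite /q subn0.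
apply: (@taylor_zero (fun l t => f l t - q l t) m c r t0 _ _ t0r _ _ t tr).
- move=> l s lm sr; have [d1 d1E] := df l s lm sr.
  have [d2 d2E] := diff_pow (a / (m - l)`!%:R) t0 (m - l) s.
  have [d3 d3E] := diff_sub d1 d2; split => //.
  apply: etrans (d3E 1) (congr2 (fun x y => x - y) d1E (etrans d2E _)).
  rewrite /q subnS -{1 2}(@prednK (m - l)) ?subn_gt0//.
  set k := (m - l).-1; rewrite factS natrM.
  have k1 : (k.+1%:R : C) != 0 by rewrite pnatr_eq0.
  have k2 : (k`!%:R : C) != 0 by rewrite pnatr_eq0 -lt0n fact_gt0.
  rewrite mulrA; congr (_ * _); rewrite invfM.
  by rewrite -!mulrA; congr (a * _); rewrite mulrCA mulVf// mulr1.
- by move=> l lm; rewrite f0// /q subrr expr0n subn_eq0 leqNgt lm mulr0 subrr.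
- move=> s sr; rewrite /q subnn fact0 expr0 divr1 mulr1; exact: fa.
Qed.

(** With this tolerance on f m, the error in [order_expand] is at most half the leading term. A zero
    of order m is thus alone in a disc whose size does not depend on t0. *)
Lemma order_nonzero f m c r t0 a : deriv_seq f m c r -> nm (t0 - c) < r ->
  (forall l, (l < m)%N -> f l t0 = 0) -> a != 0 ->
  (forall t, nm (t - c) < r -> nm (f m t - a) <= nm a / (2 * m`!%:R)) ->
  forall t, nm (t - c) < r -> f 0%N t = 0 -> t = t0.
Proof.
move=> df t0r f0 a0 fa t tr ft0; apply/eqP/negPn/negP => tt0.
have fm0 : 0 < (m`!%:R : R) by rewrite ltr0n fact_gt0.
have := order_expand df t0r f0 fa tr.
rewrite ft0 sub0r nmN nmM nmX nmM nmV nm_nat.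
apply/negP; rewrite -ltNge ltr_pM2r ?exprn_gt0 ?nm_gt0 ?subr_eq0//.
by rewrite ltr_pM2l ?nm_gt0// ltf_pV2 ?posrE ?mulr_gt0// ltr_pMl// ltr1n.
Qed.

(* Dividing by (t - t0)^n keeps [f 0] differentiable, so the bound at the
   centre of a square applies to the quotient. *)
Lemma flat_bound f n c r t0 M : 0 < r -> deriv_seq f n.+3 c r -> nm (t0 - c) <= r / 16 ->
  (forall l, (l < n.+2)%N -> f l t0 = 0) ->
  (forall t, nm (t - c) < r -> nm (f 0%N t) <= M) ->
  nm (f 0%N c) <= 2 * M * 2 ^- n.
Proof.
move=> r0 df t0c f0 fM.
have cc : nm (c - c) < r by rewrite subrr nm0.
have M0 : 0 <= M by apply: le_trans (nm_ge0 _) (fM _ cc).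
have [->|ct0] := eqVneq c t0.
  by rewrite f0// nm0 mulr_ge0 ?mulr_ge0// ltW// half_gt0.
have t0r : nm (t0 - c) < r by lra.
pose g (t : C) := f 0%N t * (t - t0) ^- n.
have dg t : nm (t - c) < r -> differentiable g t.
  move=> tr; have [tt0|tt0] := eqVneq t t0; last first.
    apply: diff_mul; first by have [] := df 0%N t erefl tr.
    have [dp _] := diff_pow 1 t0 n t.
    have : differentiable (fun s : C => (s - t0) ^+ n) t.
      have -> : (fun s : C => (s - t0) ^+ n) = (fun s : C => 1 * (s - t0) ^+ n) by apply: funext => s; rewrite mul1r.
      exact: dp.
    move=> dp'; apply: (@differentiableV C C (fun s : C => (s - t0) ^+ n) t) => //.
    by rewrite expf_neq0// subr_eq0.
  rewrite tt0; have [dfn _] := df n.+2 t0 (ltnSn _) t0r.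
  have [d d0 dP] := (proj1 (contP _ _)) (differentiable_continuous dfn) 1 ltr01.
  pose r' := Num.min d (r / 2).
  have r'0 : 0 < r' by rewrite lt_min d0 divr_gt0.
  pose K := nm (f n.+2 t0) + 1.
  have t00 : nm (t0 - t0) < r' by rewrite subrr nm0.
  have fK x : nm (x - t0) < r' -> nm (f n.+2 x) <= K.
    by rewrite lt_min => /andP[/dP le1 _]; have := nmBl (f n.+2 x) (f n.+2 t0); rewrite /K; lra.
  have df' : deriv_seq f n.+2 t0 r'.
    move=> l x lm; rewrite lt_min => /andP[_ xr].
    apply: df; first exact: ltnW.
    by apply: le_lt_trans (nm_tri t0 _ _) _; lra.
  have gK := taylor_zero df' t00 f0 fK.
  have K0 : 0 < K by rewrite ltr_wpDl ?nm_ge0.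
  (* Vanishing to order n + 2 leaves a factor of size |w|^2 after the division, so that [g] has
     value and derivative 0 at t0. *)
  suff [] : differentiable g t0 /\ 'd g t0 1 = 0 by [].
  apply: frechet_deriv => e e0; exists (Num.min r' (e / K)).
    by rewrite lt_min r'0 divr_gt0.
  move=> w; rewrite lt_min => /andP[wr]; rewrite ltr_pdivlMr// => we.
  have -> : g (t0 + w) - g t0 - 0 * w = f 0%N (w + t0) * w ^- n.
    by rewrite /g (f0 0%N)// !mul0r !subr0 (addrC t0) addrK.
  rewrite nmM nmV nmX; have [->|w0] := eqVneq w 0.
    by rewrite add0r (f0 0%N)// !nm0 mul0r mulr0.
  have nw : 0 < nm w by rewrite nm_gt0.
  rewrite ler_pdivrMr ?exprn_gt0//.
  have := gK (w + t0); rewrite addrK => /(_ wr) /le_trans; apply.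
  rewrite !exprS !mulrA ler_wpM2r ?exprn_ge0 ?nm_ge0// ler_wpM2r ?nm_ge0//.
  by rewrite mulrC ltW.
(* Outside |u| < 1 the point c + u p has distance at least r/3 - r/16 >= r/4 from t0, so the
   quotient is at most M (4/r)^n. Multiplying back by the n-th power of nm (c - t0) <= r/16 leaves
   4^-n, which is below 2^-n. *)
pose p : C := (r / 3)%:C.
have np : nm p = r / 3 by rewrite nm_real gtr0_norm// divr_gt0.
have inb (u : C) : nm u <= 2 -> nm (c + u *: p - c) < r.
  by move=> u2; rewrite addrC addKr nmZc np; nra.
have n2 (u : C) : `|complex.Re u| <= 1 -> `|complex.Im u| <= 1 -> nm u <= 2.
  by move=> u1 u2; apply: le_trans (nm_le_ReIm _) _; lra.
have far (u : C) : 1 <= nm u -> r / 4 <= nm (c + u *: p - t0).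
  move=> u1; have := nmBl (u *: p) (t0 - c); rewrite nmZc np opprB addrA (addrC _ c).
  by have := mulr_ge0 (ltW r0) (_ : 0 <= nm u - 1); rewrite subr_ge0 => /(_ u1); lra.
have := @center_bound R (fun u => g (c + u *: p)) (M * (4 / r) ^+ n).
rewrite scale0r addr0 => H.
have {H} : nm (g c) <= 2 * (M * (4 / r) ^+ n).
  apply: H.
  - by move=> u u1 u2 _; have [] := diff_line (dg _ (inb u (n2 u u1 u2))).
  - apply: differentiable_continuous.
    by have [] := diff_line (dg _ (inb 0 (_ : _ <= 2))); rewrite ?nm0.
  move=> u /andP[u1 u2] _ _; rewrite /g nmM nmV nmX.
  apply: ler_pM; rewrite ?nm_ge0 ?invr_ge0 ?exprn_ge0 ?nm_ge0//; first exact: fM (inb u u2).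
  rewrite -exprVn lerXn2r ?nnegrE ?invr_ge0 ?nm_ge0 ?divr_ge0 ?(ltW r0)//.
  rewrite -[4 / r]invf_div; have fu := far u u1.
  by rewrite lef_pV2 ?posrE ?divr_gt0//; apply: lt_le_trans fu; rewrite divr_gt0.
have nct : 0 < nm (c - t0) by rewrite nm_gt0 subr_eq0.
rewrite /g nmM nmV nmX ler_pdivrMr ?exprn_gt0// => /le_trans; apply.
have -> : 2 * (M * (4 / r) ^+ n) * nm (c - t0) ^+ n = 2 * M * (4 / r * nm (c - t0)) ^+ n.
  by rewrite [in RHS]exprMn; ring.
rewrite ler_wpM2l ?mulr_ge0// -exprVn lerXn2r ?nnegrE ?mulr_ge0 ?invr_ge0 ?nm_ge0 ?(ltW r0)//.
rewrite nm_distC; apply: le_trans (_ : 4 / r * (r / 16) <= _).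
  by rewrite ler_wpM2l// divr_ge0// ltW.
by have -> : 4 / r * (r / 16) = 1 / 4 by [field; rewrite gt_eqF]; lra.
Qed.

End Order.

(** * Generic parameters *)

Section Thick.
Context {R : realType}.
Local Notation C := (Cplx R).
Context {V : normedModType C}.
Implicit Types (P : C -> V -> Prop) (A K : set C) (l : V) (d e : R).

Lemma pair_sub (a c : C) (b d : V) : ((a, b) : C * V) - ((c, d) : C * V) = (a - c, b - d).
Proof. by []. Qed.

Lemma nm_pair_lt (t : C) l (r : R) : (nm ((t, l) : C * V) < r) = (nm t < r) && (nm l < r).
Proof.
have -> : (nm ((t, l) : C * V) < r) = (`|((t, l) : C * V)| < r%:C).
  by rewrite nmE ltcR.
rewrite prod_normE /= !nmE.
have -> : Num.max ((nm t)%:C) ((nm l)%:C) = (Num.max (nm t) (nm l))%:C :> C.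
  by rewrite /Order.max ltcR; case: ifP.
by rewrite ltcR gt_max.
Qed.

(* Open density, near l0, of the parameters that are good for all t in A; as the
   neighbourhood of l0 is fixed first, this is additive in A. *)
Definition thick P A l0 := exists2 e, 0 < e & forall l1 d, 0 < d -> nm (l1 - l0) + d <= e ->
  exists l2 d2, [/\ 0 < d2, nm (l2 - l1) + d2 <= d &
    forall t l, A t -> nm (l - l2) < d2 -> P t l].

Lemma ball_sub l0 l1 d e l : nm (l1 - l0) + d <= e -> nm (l - l1) < d -> nm (l - l0) < e.
Proof. by move=> le1 lt2; apply: le_lt_trans (nm_tri l1 _ _) _; lra. Qed.

Lemma sub_ball_trans l0 l1 l2 d d2 e : nm (l1 - l0) + d <= e -> nm (l2 - l1) + d2 <= d ->
  nm (l2 - l0) + d2 <= e.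
Proof. by move=> le1 le2; have := nm_tri l1 l2 l0; lra. Qed.

Lemma thick_compact P K l0 : compact K ->
  (forall t, K t -> exists2 U, nbhs t U & thick P U l0) -> thick P K l0.
Proof.
move=> cK loc; apply: (compact_local_global cK _ _ _ loc).
- by exists 1 => // l1 d d0 _; exists l1, d; rewrite subrr nm0 add0r; split.
- move=> A B [e e0 eB] AB; exists e => // l1 d d0 le1.
  have [l2 [d2 [d20 le2 BP]]] := eB l1 d d0 le1.
  by exists l2, d2; split=> // t l /AB; apply: BP.
- move=> A B [e1 e10 eA] [e2 e20 eB]; exists (Num.min e1 e2); first by rewrite lt_min e10.
  move=> l1 d d0; rewrite le_min => /andP[le1 le2].
  have [l2 [d2 [d20 le3 AP]]] := eA l1 d d0 le1.
  have [l3 [d3 [d30 le4 BP]]] := eB l2 d2 d20 (sub_ball_trans le2 le3).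
  exists l3, d3; split=> //; first exact: sub_ball_trans le3 le4.
  by move=> t l [At|Bt] ld; [apply: AP => //; apply: ball_sub le4 ld | apply: BP].
Qed.

Lemma tube P K l0 : compact K ->
  (forall t, K t -> exists2 d, 0 < d &
     forall s l, nm (s - t) < d -> nm (l - l0) < d -> P s l) ->
  exists2 d, 0 < d & forall s l, K s -> nm (l - l0) < d -> P s l.
Proof.
move=> cK loc.
apply: (@compact_local_global _ K (fun A => exists2 d, 0 < d &
   forall s l, A s -> nm (l - l0) < d -> P s l)) => //.
- by exists 1.
- by move=> A B [d d0 dB] AB; exists d => // s l /AB; apply: dB.
- move=> A B [d d0 dA] [d' d'0 dB]; exists (Num.min d d'); first by rewrite lt_min d0.
  by move=> s l [As|Bs]; rewrite lt_min => /andP[ld ld']; [apply: dA | apply: dB].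
- move=> t /loc[d d0 dP]; exists [set s | nm (s - t) < d]; first by apply/(@nearP R C t); exists d.
  by exists d => // s l sd ld; apply: dP.
Qed.

End Thick.

Section CommonZeros.
Context {R : realType}.
Local Notation C := (Cplx R).
Context {V : normedModType C} {k : nat}.
Implicit Types (F : 'I_k -> C * V -> C) (G : C * V -> C) (t : C) (l : V) (r d : R).

Definition Dt (n : nat) G : C * V -> C := iter n (fun G p => 'd G p (1, 0)) G.

Lemma holo_Dt n G p r : 0 < r -> holo_ball G p r -> holo_ball (Dt n G) p r.
Proof.
move=> r0 hG; elim: n => [|n ih]//= q qr.
apply: (@holo_derive R _ _ q (1, 0) (r - nm (q - p))); first by rewrite subr_gt0.
by apply: holo_sub ih _; lra.
Qed.

Lemma Dt_cont n G p r q : 0 < r -> holo_ball G p r -> nm (q - p) < r ->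
  forall e, 0 < e -> exists2 d, 0 < d & forall s l, nm (s - q.1) < d -> nm (l - q.2) < d ->
  nm (Dt n G (s, l) - Dt n G q) < e.
Proof.
move=> r0 hG qr e e0.
have [d d0 dP] := (proj1 (contP _ _)) (differentiable_continuous (holo_Dt n r0 hG qr)) e e0.
exists d => // s l sd ld; apply: dP.
by case: q qr sd ld => q1 q2 qr sd ld; rewrite pair_sub nm_pair_lt sd.
Qed.

Lemma Dt_seq G n m t0 l0 r l t d : holo_ball G (t0, l0) r -> 0 < r ->
  nm (l - l0) < r -> nm (t - t0) + d <= r -> deriv_seq (fun j s => Dt (n + j) G (s, l)) m t d.
Proof.
move=> hG r0 lr tdr j s _ st.
have sr : nm ((s, l) - (t0, l0) : C * V) < r.
  by rewrite pair_sub nm_pair_lt lr andbT; apply: ball_sub tdr st.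
pose z0 : (C * V)%type := (0, l); pose v0 : (C * V)%type := (1, 0).
have E (u : C) : z0 + u *: v0 = (u, l).
  have -> : z0 + u *: v0 = (0 + u * 1, l + u *: 0) by [].
  by rewrite scaler0 addr0 mulr1 add0r.
have dD : differentiable (Dt (n + j) G) (z0 + s *: v0).
  by rewrite E; apply: (holo_Dt _ r0 hG).
have [d1 d1E] := diff_line dD.
have fE : (fun u : C => Dt (n + j) G (z0 + u *: v0)) = (fun u => Dt (n + j) G (u, l)).
  by apply: funext => u; rewrite E.
rewrite fE in d1 d1E; split => //.
by rewrite d1E E addnS scale1r.
Qed.

End CommonZeros.

(** * Lowering the order of the common zeros *)

Section GenericParameter.
Context {R : realType}.
Local Notation C := (Cplx R).
Context {V : normedModType C} {k : nat} (F : 'I_k -> C * V -> C).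
Context (t0 : C) (l0 : V) (r M : R) (r0 : 0 < r).
Context (hF : forall i, holo_ball (F i) (t0, l0) r).
Context (FM : forall i p, nm (p - (t0, l0)) < r -> nm (F i p) <= M).
(* Both of the next assumptions hold when the common zero set comes from a set
   without regular points of codimension 0 and 1. *)
Context (no_slice : forall t1 l1 d, 0 < d -> nm (t1 - t0) < r ->
  (forall l, nm (l - l1) < d -> nm (l - l0) < r /\ forall i, F i (t1, l) = 0) -> False).
Context (no_divisor : forall t1 l1 d (G : C * V -> C), 0 < d ->
  nm ((t1, l1) - (t0, l0) : C * V) < r ->
  holo_ball G (t1, l1) d -> (forall i, F i (t1, l1) = 0) ->
  (forall p, nm (p - (t1, l1)) < d -> (forall i, F i p = 0) <-> G p = 0) ->
  forall v, 'd G (t1, l1) (0, v) = 0).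

(** The common order of vanishing in t of all F i is less than m; in particular [order_lt 1] says
    that (t, l) is not a common zero. *)
Definition order_lt (m : nat) (t : C) (l : V) : Prop :=
  exists i j, (j < m)%N /\ Dt j (F i) (t, l) != 0.

Lemma in_box t l : nm (t - t0) < r -> nm (l - l0) < r -> nm ((t, l) - (t0, l0) : C * V) < r.
Proof. by move=> tr lr; rewrite pair_sub nm_pair_lt tr. Qed.

Lemma order_lt_open m t l : nm (t - t0) < r -> nm (l - l0) < r -> order_lt m t l ->
  exists2 d, 0 < d & forall s l', nm (s - t) < d -> nm (l' - l) < d -> order_lt m s l'.
Proof.
move=> tr lr [i [j [jm Dn]]].
have Dn' : 0 < nm (Dt j (F i) (t, l)) by rewrite nm_gt0.
have [d d0 dP] := Dt_cont j r0 (hF i) (in_box tr lr) Dn'.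
exists d => // s l' sd ld; exists i, j; split=> //.
apply: contraTneq (dP s l' sd ld) => ->.
by rewrite sub0r nmN ltxx.
Qed.

(** The condition is open and K compact, so one good l yields a ball of good ones. Failure therefore
    means that every l of the ball is bad for some t, and bad times become a function of l. *)
Lemma order_dichotomy m (K : set C) l1 d : compact K -> (forall t, K t -> nm (t - t0) < r) ->
  0 < d -> nm (l1 - l0) + d <= r ->
  (exists l2 d2, [/\ 0 < d2, nm (l2 - l1) + d2 <= d &
     forall t l, K t -> nm (l - l2) < d2 -> order_lt m t l]) \/
  (forall l, nm (l - l1) < d -> exists2 t, K t & ~ order_lt m t l).
Proof.
move=> cK Kr d0 ld.
have [H|H] := pselect (exists2 l, nm (l - l1) < d & forall t, K t -> order_lt m t l); last first.
  right=> l ll; apply: contrapT => nt; apply: H; exists l => // t Kt.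
  by apply: contrapT => nP; apply: nt; exists t.
have [l ll lP] := H; left.
have lr : nm (l - l0) < r by apply: ball_sub ld ll.
have [|d2 d20 d2P] := @tube R V (order_lt m) K l cK.
  by move=> t Kt; apply: order_lt_open (Kr t Kt) lr (lP t Kt).
exists l, (Num.min d2 (d - nm (l - l1))); split.
- by rewrite lt_min d20 subr_gt0.
- by rewrite -lerBrDl ge_min lexx orbT.
- by move=> t l' Kt; rewrite lt_min => /andP[ld2 _]; apply: d2P.
Qed.

(** Otherwise every l of the ball has, for each n, a common zero of order at least n + 2 within r /
    16 of t0. By [flat_bound] all F i (t0, l) vanish, against [no_slice]. *)
Lemma order_finite l1 d : 0 < d -> nm (l1 - l0) + d <= r ->
  exists m l2 d2, [/\ 0 < d2, nm (l2 - l1) + d2 <= d &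
     forall t l, nm (t - t0) <= r / 16 -> nm (l - l2) < d2 -> order_lt m t l].
Proof.
move=> d0 ld; apply: contrapT => nH.
have t0r : nm (t0 - t0) < r by rewrite subrr nm0.
apply: (@no_slice t0 l1 d d0 t0r) => l ll.
have lr : nm (l - l0) < r by apply: ball_sub ld ll.
split=> // i; apply/eqP; rewrite -nm_eq0 eq_le nm_ge0 andbT.
apply: (@geom_le0 R (2 * M)) => n.
have KR t : nm (t - t0) <= r / 16 -> nm (t - t0) < r.
  by move=> tr; apply: le_lt_trans tr _; rewrite ltr_pdivrMr// ltr_pMr// ltr1n.
have [H|H] := @order_dichotomy n.+2 _ l1 d (@compact_disc R t0 (r / 16)) KR d0 ld.
  by case: nH; exists n.+2.
have [t tK nt] := H l ll.
apply: (@flat_bound R (fun j s => Dt (0 + j) (F i) (s, l)) n t0 r t M r0 _ tK).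
- by apply: (@Dt_seq R V (F i) 0 n.+3 t0 l0 r l t0 r) => //; rewrite subrr nm0 add0r.
- move=> j jn; apply/eqP/negPn/negP => Dn; apply: nt; exists i, j; by split.
- by move=> s sr; apply: FM; apply: in_box.
Qed.

(* Otherwise near (t1, l1) the common zeros of the F i are the zeros of
   G = Dt m (F i), which form the graph of a function tau of l. By no_divisor
   tau has derivative zero, so it is constant, against no_slice. *)
Lemma order_descend_near m t1 l1 : nm (t1 - t0) < r -> nm (l1 - l0) < r ->
  order_lt m.+2 t1 l1 -> exists2 U, nbhs t1 U & thick (order_lt m.+1) U l1.
Proof.
move=> t1r l1r [i [j [jm Dn]]].
have [low|nlow] := pselect (order_lt m.+1 t1 l1).
  have [e e0 eP] := order_lt_open t1r l1r low.
  exists [set t | nm (t - t1) < e]; first by apply/(@nearP R C t1); exists e.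
  exists e => // l2 d d0 le2; exists l2, d; rewrite subrr nm0 add0r; split=> //.
  by move=> t l te ld; apply: eP => //; apply: ball_sub le2 ld.
have jE : j = m.+1.
  apply/eqP; move: jm; rewrite ltnS leq_eqVlt => /orP[//|jm].
  by case: nlow; exists i, j.
move: Dn; rewrite {j jm}jE; set c := Dt m.+1 (F i) (t1, l1) => c0.
have nc : 0 < nm c by rewrite nm_gt0.
(* The tolerance of [order_nonzero] at order m + 1; being at most nm c / 2, it also serves the
   first-order expansion of G. *)
pose K := nm c / (2 * (m.+1)`!%:R).
have K0 : 0 < K by rewrite divr_gt0// mulr_gt0// ltr0n fact_gt0.
have [d1 d10 d1P] := Dt_cont m.+1 r0 (hF i) (in_box t1r l1r) K0.
pose D := Num.min d1 (Num.min (r - nm (t1 - t0)) (r - nm (l1 - l0))).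
have D0 : 0 < D by rewrite !lt_min d10 !subr_gt0 t1r.
have Dd1 : D <= d1 by rewrite ge_min lexx.
have Dt_ : nm (t1 - t0) + D <= r.
  by rewrite -lerBrDl !ge_min lexx orbT.
have Dl : nm (l1 - l0) + D <= r.
  by rewrite -lerBrDl !ge_min lexx !orbT.
clearbody D.
pose e := D / 2; have e0 : 0 < e by rewrite divr_gt0.
have eD : e < D by rewrite ltr_pdivrMr// ltr_pMr// ltr1n.
exists [set t | nm (t - t1) <= e].
  by apply/(@nearP R C t1); exists e => // w /ltW.
exists e => // l2 d d0 le2.
have l2r : nm (l2 - l0) + d <= r by apply: sub_ball_trans Dl _; lra.
have lD l : nm (l - l2) < d -> nm (l - l1) < D.
  by move=> ld; apply: lt_trans (ball_sub le2 ld) eD.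
have lr l : nm (l - l2) < d -> nm (l - l0) < r by move=> ld; apply: ball_sub Dl (lD l ld).
have tr t : nm (t - t1) < D -> nm (t - t0) < r by move=> tD; apply: ball_sub Dt_ tD.
have [H|H] := @order_dichotomy m.+1 _ l2 d (@compact_disc R t1 e)
   (fun t tK => tr t (le_lt_trans tK eD)) d0 l2r; first exact: H.
exfalso.
have /choice[tau tauP] : forall l, exists t, nm (l - l2) < d -> nm (t - t1) <= e /\ ~ order_lt m.+1 t l.
  move=> l; have [ld|] := pselect (nm (l - l2) < d); last by exists 0.
  by have [t t1_ t2] := H l ld; exists t.
have tau_zero l n p : nm (l - l2) < d -> (n < m.+1)%N -> Dt n (F p) (tau l, l) = 0.
  move=> ld nm_; apply/eqP/negPn/negP => Dn.
  by have [_] := tauP l ld; apply; exists p, n.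
have tauD l : nm (l - l2) < d -> nm (tau l - t1) < D.
  by move=> ld; have [te _] := tauP l ld; apply: le_lt_trans te eD.
have near_c t l : nm (t - t1) < D -> nm (l - l2) < d -> nm (Dt m.+1 (F i) (t, l) - c) <= K.
  move=> tD ld; apply: ltW; apply: d1P; first exact: lt_le_trans Dd1.
  exact: lt_le_trans (lD l ld) Dd1.
(* The disc in which tau l is the only zero of F i is the same for all l, so every common zero near
   (t1, l1) lies on the graph of tau. *)
have zeroF t l : nm (t - t1) < D -> nm (l - l2) < d -> F i (t, l) = 0 -> t = tau l.
  move=> tD ld Ft.
  apply: (@order_nonzero R (fun j s => Dt (0 + j) (F i) (s, l)) m.+1 t1 D (tau l) c _ (tauD l ld) _ c0 _ t tD Ft).
  - exact: (@Dt_seq R V (F i) 0 m.+1 t0 l0 r l t1 D (hF i) r0 (lr l ld) Dt_).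
  - by move=> n nm_; apply: tau_zero.
  - by move=> s sD; apply: near_c.
pose G := Dt m (F i).
have hG : holo_ball G (t0, l0) r by apply: holo_Dt.
have expG t l : nm (t - t1) < D -> nm (l - l2) < d ->
    nm (G (t, l) - c * (t - tau l)) <= nm c / 2 * nm (t - tau l).
  move=> tD ld.
  have := @order_expand R (fun j s => Dt (m + j) (F i) (s, l)) 1 t1 D (tau l) c (nm c / 2)
    (@Dt_seq R V (F i) m 1 t0 l0 r l t1 D (hF i) r0 (lr l ld) Dt_) (tauD l ld) _ _ t tD.
  rewrite addn0 !expr1 (_ : 1`! = 1%N)// divr1; apply.
    by move=> [|//] _; rewrite addn0; apply: tau_zero.
  move=> s sD; rewrite addn1; apply: le_trans (near_c s l sD ld) _.
  rewrite /K ler_pM2l// lef_pV2 ?posrE// ?mulr_gt0 ?ltr0n ?fact_gt0//.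
  by rewrite ler_pMr// ler1n fact_gt0.
have lowG t l : nm (t - t1) < D -> nm (l - l2) < d -> nm c / 2 * nm (t - tau l) <= nm (G (t, l)).
  move=> tD ld; have := expG t l tD ld.
  have := nmBl (c * (t - tau l)) (G (t, l)); rewrite (nm_distC _ (G _)) nmM; lra.
have Gtau l : nm (l - l2) < d -> G (tau l, l) = 0 by move=> ld; apply: tau_zero.
have eqv t l : nm (t - t1) < D -> nm (l - l2) < d -> (forall p, F p (t, l) = 0) <-> G (t, l) = 0.
  move=> tD ld; split=> [F0|G0]; first by rewrite (zeroF t l tD ld (F0 i)) Gtau.
  suff -> : t = tau l by move=> p; apply: (tau_zero l 0%N p ld).
  apply/eqP; rewrite -subr_eq0 -nm_eq0 eq_le nm_ge0 andbT.
  have := lowG t l tD ld; rewrite G0 nm0.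
  by rewrite pmulr_rle0// divr_gt0.
have dG l v : nm (l - l2) < d -> 'd G (tau l, l) (0, v) = 0.
  move=> ld.
  pose d' := Num.min (D - nm (tau l - t1)) (d - nm (l - l2)).
  have d'0 : 0 < d' by rewrite lt_min !subr_gt0 tauD.
  have near_box s l' : nm (s - tau l) < d' -> nm (l' - l) < d' ->
      nm (s - t1) < D /\ nm (l' - l2) < d.
    rewrite !lt_min => /andP[s1 _] /andP[_ s2]; split.
      by apply: le_lt_trans (nm_tri (tau l) _ _) _; lra.
    by apply: le_lt_trans (nm_tri l _ _) _; lra.
  apply: (@no_divisor (tau l) l d' G d'0); first by apply: in_box; [apply/tr/tauD | apply: lr].
  - move=> [s l']; rewrite pair_sub nm_pair_lt => /andP[s1 s2].
    have [sD ld'] := near_box s l' s1 s2.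
    by apply: hG; apply: in_box; [apply: tr | apply: lr].
  - by move=> p; apply: (tau_zero l 0%N p ld).
  - move=> [s l']; rewrite pair_sub nm_pair_lt => /andP[s1 s2].
    by have [sD ld'] := near_box s l' s1 s2; apply: eqv.
(* Neither differentiability nor continuity of tau is assumed. For x, y on the segment, G (tau x, y)
   is at least nm c / 2 times the distance of tau x and tau y, and it is o(|y - x|) because G and
   its derivative in l vanish at (tau x, x). The mean value inequality with constant 0 concludes. *)
have tau_const l : nm (l - l2) < d -> tau l = tau l2.
  move=> ld; apply/eqP; rewrite -subr_eq0 -nm_eq0 eq_le nm_ge0 andbT.
  have := @mean_value_path R C (fun s => tau (l2 + s%:C *: (l - l2))) 0.
  rewrite scale1r scale0r addr0 [l2 + _]addrC subrK; apply => s s01 q q0.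
  have seg x : 0 <= x <= 1 -> nm (l2 + x%:C *: (l - l2) - l2) < d.
    move=> x01; apply: nm_segment => //; first by rewrite subrr nm0.
    by rewrite [l2 + _]addrC subrK.
  have ls := seg s s01; set x := l2 + _ in ls *.
  have dGx : differentiable G (tau x, x).
    by apply: hG; apply: in_box; [apply/tr/tauD | apply: lr].
  have q'0 : 0 < nm c / 2 * q / (nm (l - l2) + 1).
    by rewrite divr_gt0 ?mulr_gt0 ?divr_gt0// ltr_wpDl// nm_ge0.
  have [d2 d20 d2P] := diff_frechet dGx q'0.
  have nl1 : 0 < nm (l - l2) + 1 by rewrite ltr_wpDl// nm_ge0.
  exists (d2 / (nm (l - l2) + 1)); first by rewrite divr_gt0.
  move=> u u01; rewrite ltr_pdivlMr// => us.
  have lu := seg u u01; set y := l2 + _ in lu *.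
  have yx : y - x = (u - s)%:C *: (l - l2).
    by rewrite /y /x opprD addrACA subrr add0r rmorphB scalerBl.
  have nyx : nm (y - x) <= `|u - s| * (nm (l - l2) + 1).
    by rewrite yx nmZc nm_real ler_wpM2l// lerDl.
  have n0 : nm ((0, y - x) : C * V) = nm (y - x).
    apply/eqP; rewrite eq_le; apply/andP; split.
      apply/ler_addgt0Pr => a a0; apply/ltW; rewrite nm_pair_lt nm0 ltrDl a0 andbT.
      by rewrite ltr_wpDl// nm_ge0.
    apply/ler_addgt0Pr => a a0; apply/ltW.
    have : nm ((0, y - x) : C * V) < nm ((0, y - x) : C * V) + a by rewrite ltrDl.
    by rewrite nm_pair_lt => /andP[].
  have := d2P (0, y - x); rewrite n0 dG// subr0 => /(_ (le_lt_trans nyx us)).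
  have -> : ((tau x, x) : C * V) + (0, y - x) = (tau x + 0, x + (y - x)) by [].
  rewrite addr0 [x + _]addrC subrK Gtau// subr0 => le1.
  have le3 := lowG (tau x) y (tauD x ls) lu.
  have le4 : nm c / 2 * q / (nm (l - l2) + 1) * nm (y - x) <= nm c / 2 * (q * `|u - s|).
    rewrite mulrAC ler_pdivrMr// -!mulrA ler_pM2l// ler_pM2l ?invr_gt0// ler_pM2l//.
  rewrite add0r nm_distC -(ler_pM2l (_ : 0 < nm c / 2)) ?divr_gt0//.
  exact: le_trans le3 (le_trans le1 le4).
have l22 : nm (l2 - l2) < d by rewrite subrr nm0.
apply: (@no_slice (tau l2) l2 d d0); first by apply/tr/tauD.
move=> l ld; split; first exact: lr.
by move=> p; rewrite -(tau_const l ld); apply: (tau_zero l 0%N p ld).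
Qed.

(** [order_descend_near] is local in t; [thick] glues it over the disc, so a smaller ball of
    parameters lowers the order by one for all t at once. *)
Lemma order_descend m l1 d : 0 < d -> nm (l1 - l0) + d <= r ->
  (forall t l, nm (t - t0) <= r / 16 -> nm (l - l1) < d -> order_lt m.+1 t l) ->
  exists l2 d2, [/\ 0 < d2, nm (l2 - l1) + d2 <= d &
     forall t l, nm (t - t0) <= r / 16 -> nm (l - l2) < d2 -> order_lt 1 t l].
Proof.
elim: m l1 d => [|m ih] l1 d d0 ld low.
  by exists l1, d; rewrite subrr nm0 add0r; split.
have [|e e0 eP] := @thick_compact R V (order_lt m.+1) [set t | nm (t - t0) <= r / 16] l1 (@compact_disc R t0 (r / 16)).
  move=> t tK; apply: order_descend_near.
  - by apply: le_lt_trans tK _; rewrite ltr_pdivrMr// ltr_pMr// ltr1n.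
  - by apply: lt_le_trans ld; rewrite ltrDl.
  - by apply: low => //; rewrite subrr nm0.
have m0 : 0 < Num.min d e by rewrite lt_min d0.
have [|l2 [d2 [d20 le2 P2]]] := eP l1 (Num.min d e) m0.
  by rewrite subrr nm0 add0r ge_min lexx orbT.
have le2' : nm (l2 - l1) + d2 <= d by apply: le_trans le2 _; rewrite ge_min lexx.
have [l3 [d3 [d30 le3 P3]]] := ih l2 d2 d20 (sub_ball_trans ld le2') P2.
by exists l3, d3; split=> //; apply: sub_ball_trans le2' le3.
Qed.

Theorem generic_no_common_zero :
  thick (fun t l => exists i, F i (t, l) != 0) [set t | nm (t - t0) <= r / 16] l0.
Proof.
exists r => // l1 d d0 ld.
have [m [l2 [d2 [d20 le2 P2]]]] := order_finite d0 ld.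
have P2' t l : nm (t - t0) <= r / 16 -> nm (l - l2) < d2 -> order_lt m.+1 t l.
  by move=> tK ll; have [i [j [jm Dn]]] := P2 t l tK ll; exists i, j; split=> //; apply: ltnW.
have [l3 [d3 [d30 le3 P3]]] := order_descend d20 (sub_ball_trans ld le2) P2'.
exists l3, d3; split=> //; first exact: sub_ball_trans le2 le3.
by move=> t l tK ll; have [i [j []]] := P3 t l tK ll; case: j => // _ Dn; exists i.
Qed.

End GenericParameter.

(** * The torus *)

Section Rows.
Context {R : realType} {n : nat}.
Local Notation C := (Cplx R).
Local Notation V := 'rV[C]_n.

Lemma nm_row_lt (z : V) (d : R) : 0 < d -> (nm z < d) <-> (forall i, nm (z 0 i) < d).
Proof.
move=> d0; have dC : 0 < d%:C :> C by rewrite ltcR.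
have E (W : normedModType C) (w : W) : (nm w < d) <-> ball (0 : W) d%:C w.
  by rewrite -ball_normE /= sub0r normrN nmE ltcR.
rewrite E; split=> [zd i|zd]; first by apply/E; have := zd.2 ord0 i; rewrite mxE.
by split=> // i j; rewrite mxE ord1; apply/E.
Qed.

Lemma nm_row_le (z : V) i : nm (z 0 i) <= nm z.
Proof.
apply/ler_addgt0Pr => e e0; apply: ltW.
have d0 : 0 < nm z + e by rewrite ltr_wpDl// nm_ge0.
by apply: (proj1 (nm_row_lt z d0)); rewrite ltrDl.
Qed.

Lemma nm_row_leP (z : V) (d : R) : 0 <= d -> (forall i, nm (z 0 i) <= d) -> nm z <= d.
Proof.
move=> d0 zd; apply/ler_addgt0Pr => e e0; apply/ltW.
have de : 0 < d + e by rewrite ltr_wpDl.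
by apply/(nm_row_lt z de) => i; apply: le_lt_trans (zd i) _; rewrite ltrDl.
Qed.

Lemma diff_row (U : normedModType C) (H : U -> V) (z : U) :
  (forall i, differentiable (fun u => H u 0 i) z) ->
  differentiable H z /\ forall v i, ('d H z v) 0 i = 'd (fun u => H u 0 i) z v.
Proof.
move=> dH; pose L v : V := \row_i 'd (fun u => H u 0 i) z v.
suff [dHz dE] : differentiable H z /\ forall v, 'd H z v = L v.
  by split=> // v i; rewrite dE mxE.
apply: frechet_is_diff.
  split; first by move=> a x y; apply/rowP => i; rewrite !mxE linearP.
  have /choice[K KP] : forall i, exists K, 0 <= K /\ forall v, nm ('d (fun u => H u 0 i) z v) <= K * nm v.
    by move=> i; have [K K0 KP] := linear_bound (diff_continuous (dH i)); exists K.
  exists (\sum_i K i) => v; apply: nm_row_leP.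
    by rewrite mulr_ge0 ?nm_ge0// sumr_ge0// => i _; have [] := KP i.
  move=> i; rewrite mxE; apply: le_trans ((KP i).2 v) _; rewrite ler_wpM2r ?nm_ge0//.
  by rewrite (bigD1 i)//= lerDl sumr_ge0// => j _; have [] := KP j.
move=> e e0.
have : \forall w \near (0 : U), forall i, nm (H (z + w) 0 i - H z 0 i - L w 0 i) <= e * nm w.
  apply: filter_forall => i; apply/nearP; have [d d0 dP] := diff_frechet (dH i) e0.
  by exists d => // w; rewrite subr0 mxE => /dP.
move=> /nearP[d d0 dP]; exists d => // w wd.
apply: nm_row_leP; first by rewrite mulr_ge0 ?nm_ge0// ltW.
by move=> i; have := dP w; rewrite subr0 => /(_ wd i); rewrite !mxE.
Qed.

Lemma diff_coord (U : normedModType C) (H : U -> V) (z : U) i :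
  differentiable H z -> differentiable (fun u => H u 0 i) z /\
  forall v, 'd (fun u => H u 0 i) z v = ('d H z v) 0 i.
Proof.
move=> dH; apply: frechet_is_diff.
  have [K K0 KP] := linear_bound (diff_continuous dH).
  split; first by move=> a x y; rewrite linearP !mxE.
  by exists K => v; apply: le_trans (nm_row_le _ _) (KP v).
move=> e e0; have [d d0 dP] := diff_frechet dH e0; exists d => // w /dP.
by apply: le_trans; apply: le_trans _ (nm_row_le _ i); rewrite !mxE.
Qed.

End Rows.

(** * The lattice, and local equations lifted to C^n *)

Section Lattice.
Context {R : realType} {n : nat} {Om : 'M[Cplx R]_(n.*2, n)}.
Context (hOm : period_matrix Om).
Local Notation C := (Cplx R).
Local Notation V := 'rV[C]_n.
Local Notation pi := (torus_pi Om).

Lemma piE (x y : V) : pi x = pi y <-> in_lattice Om (x - y).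
Proof.
rewrite /torus_pi; split=> [/eqmodP/asboolP//|xy]; exact/eqmodP/asboolP.
Qed.

(** The real matrix B = (Re Om | Im Om) has free rows by [period_matrix], so a right inverse
    recovers the integer coefficients of z with norm at most K times nm z; integers of absolute
    value below 1 vanish. *)
Lemma lattice_discrete : exists2 d : R, 0 < d & forall z, in_lattice Om z -> nm z < d -> z = 0.
Proof.
pose B : 'M[R]_(n.*2, n + n) :=
  row_mx (map_mx (@complex.Re R) Om) (map_mx (@complex.Im R) Om).
have BE (x : 'rV[R]_(n.*2)) i :
    (x *m B) 0 (lshift n i) = complex.Re ((map_mx (real_complex R) x *m Om) 0 i) /\
    (x *m B) 0 (rshift n i) = complex.Im ((map_mx (real_complex R) x *m Om) 0 i).
  have reS (I : finType) (G : I -> C) : complex.Re (\sum_k G k) = \sum_k complex.Re (G k).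
    by elim/big_rec2: _ => // k y1 y2 _ <-; rewrite ReD.
  have imS (I : finType) (G : I -> C) : complex.Im (\sum_k G k) = \sum_k complex.Im (G k).
    by elim/big_rec2: _ => // k y1 y2 _ <-; rewrite ImD.
  split; rewrite [LHS]mxE [in RHS]mxE ?reS ?imS; apply: eq_bigr => j _.
    by rewrite row_mxEl !mxE; case: (Om j i) => a b /=; ring.
  by rewrite row_mxEr !mxE; case: (Om j i) => a b /=; ring.
have Bfree : row_free B.
  apply: inj_row_free => x xB; apply: hOm; apply/rowP => i; rewrite [RHS]mxE.
  have [re im] := BE x i; rewrite xB !mxE in re im.
  by apply/eqP; rewrite eq_complex mxE -re -im !eqxx.
pose P := pinvmx B; pose K := \sum_i \sum_j `|P i j|.
have K0 : 0 <= K by rewrite sumr_ge0// => i _; rewrite sumr_ge0.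
exists (K + 1)^-1; first by rewrite invr_gt0 ltr_wpDl.
move=> z [m zE]; rewrite -[_^-1]mul1r ltr_pdivlMr ?ltr_wpDl// => zK.
suff m0 j : m 0 j = 0.
  have mz : m = 0 by apply/rowP => j; rewrite m0 mxE.
  by rewrite zE mz raddf0 mul0mx.
pose x : 'rV[R]_(n.*2) := map_mx intr m.
have xz : z = map_mx (real_complex R) x *m Om.
  rewrite zE; congr (_ *m _); apply/rowP => i.
  by rewrite !mxE rmorph_int.
have xBle i : `|(x *m B) 0 i| <= nm z.
  case: (split_ordP i) => i' ->; have [re im] := BE x i'; rewrite -xz in re im.
    by rewrite re; apply: le_trans (Re_le_nm _) (nm_row_le _ _).
  by rewrite im; apply: le_trans (Im_le_nm _) (nm_row_le _ _).
have xj : `|x 0 j| < 1.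
  have -> : x = x *m B *m P by rewrite mulmxKp.
  rewrite mxE; apply: le_lt_trans (ler_norm_sum _ _ _) _.
  apply: le_lt_trans (_ : nm z * K < 1); last first.
    by apply: le_lt_trans zK; rewrite ler_wpM2l ?nm_ge0// lerDl.
  rewrite mulr_sumr; apply: ler_sum => i _; rewrite normrM; apply: ler_pM => //.
  by rewrite (bigD1 j)//= lerDl sumr_ge0.
move: xj; rewrite mxE -intr_norm -[1]/(1%:~R) ltr_int.
by case: (m 0 j) => -[].
Qed.

Lemma pi_open_ball (z : V) (d : R) : open (pi @` [set y | nm (y - z) < d]).
Proof.
rewrite /open /= /quotient_open openE => x /= [y yz /piE yx].
apply/(@nearP R V x); exists (d - nm (y - z)); first by rewrite subr_gt0.
move=> w wx; exists (y + (w - x)) => /=.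
  by rewrite addrAC; apply: le_lt_trans (nmD _ _) _; lra.
by apply/piE; rewrite -addrA [w - x]addrC addrK.
Qed.

Lemma pi_near (U : set (torus Om)) (z : V) : open_nbhs (pi z) U ->
  exists2 d : R, 0 < d & forall y, nm (y - z) < d -> U (pi y).
Proof.
move=> [oU Uz]; apply/(@nearP R V z); apply: open_nbhs_nbhs; split=> //.
Qed.

Lemma pi_repr (a : torus Om) : pi (repr a) = a.
Proof. exact: reprK. Qed.

Lemma analytic_local (Z : set (torus Om)) (z : V) : analytic_set Z ->
  exists (k : nat) (f : 'I_k -> V -> C) (d M : R), [/\ 0 < d,
    forall i, holo_ball (f i) z d,
    forall i y, nm (y - z) < d -> nm (f i y) <= M &
    forall y, nm (y - z) < d -> Z (pi y) <-> forall i, f i y = 0].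
Proof.
move=> /(_ (pi z))[U [Unb [k [f [hf Zf]]]]].
have [d d0 dU] := pi_near Unb.
have hfz i : differentiable (f i \o pi) z by apply: hf; have [] := Unb.
have : \forall y \near z, forall i, nm ((f i \o pi) y) <= nm ((f i \o pi) z) + 1.
  apply: (@filter_forall V 'I_k (fun i y => nm ((f i \o pi) y) <= nm ((f i \o pi) z) + 1) (nbhs z)) => i; apply/(@nearP R V z).
  have [e e0 eP] := (proj1 (contP _ _)) (differentiable_continuous (hfz i)) 1 ltr01.
  by exists e => // w /eP; have := nmBl ((f i \o pi) w) ((f i \o pi) z); lra.
move=> /(@nearP R V z)[e e0 eP].
exists k, (fun i => f i \o pi), (Num.min d e), (\sum_i (nm ((f i \o pi) z) + 1)); split.
- by rewrite lt_min d0.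
- by move=> i y; rewrite lt_min => /andP[yd _]; apply: hf; apply: dU.
- move=> i y; rewrite lt_min => /andP[_ /eP/(_ i)] le1; apply: le_trans le1 _.
  by rewrite (bigD1 i)//= lerDl sumr_ge0// => j _; rewrite addr_ge0// nm_ge0.
- by move=> y; rewrite lt_min => /andP[yd _]; apply: Zf; apply: dU.
Qed.

Lemma analytic_closed (Z : set (torus Om)) (z : V) : analytic_set Z -> ~ Z (pi z) ->
  exists2 d : R, 0 < d & forall y, nm (y - z) < d -> ~ Z (pi y).
Proof.
move=> aZ nZ; have [k [f [d [M [d0 hf _ Zf]]]]] := analytic_local z aZ.
have zd : nm (z - z) < d by rewrite subrr nm0.
have [i fi] : exists i, f i z <> 0.
  by apply: contrapT => nf; apply: nZ; apply/(Zf _ zd) => i; apply: contrapT => fi; apply: nf; exists i.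
have fi0 : 0 < nm (f i z) by rewrite nm_gt0; apply/eqP.
have [e e0 eP] := (proj1 (contP _ _)) (differentiable_continuous (hf i z zd)) _ fi0.
exists (Num.min d e); first by rewrite lt_min d0.
move=> y; rewrite lt_min => /andP[yd /eP ye] /(Zf _ yd)/(_ i) fy.
by move: ye; rewrite fy sub0r nmN ltxx.
Qed.

Lemma differentialE (f : torus Om -> C) (z v : V) : differentiable (f \o pi) z ->
  differential f (pi z) v = 'd (f \o pi) z v.
Proof.
move=> df; rewrite /differential; set w := repr (pi z).
have wz : in_lattice Om (w - z) by apply/piE; rewrite pi_repr.
clearbody w.
have E : (f \o pi) = (fun y => (f \o pi) (y + (z - w))).
  apply: funext => y /=; congr f; apply/piE.
  by rewrite opprD addrA subrr sub0r opprB.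
have zw : w + (z - w) = z by rewrite addrC subrK.
have df' : differentiable (f \o pi) (w + (z - w)) by rewrite zw.
have [_ dE] := diff_shift df'.
have e1 : 'd (f \o pi) w v = 'd (fun y => (f \o pi) (y + (z - w))) w v :=
  congr1 (fun F : V -> C => 'd F w v) E.
have e2 : 'd (f \o pi) (w + (z - w)) v = 'd (f \o pi) z v :=
  congr1 (fun x : V => 'd (f \o pi) x v) zw.
exact: (etrans e1 (etrans (dE v) e2)).
Qed.

Lemma regular_open (Z : set (torus Om)) (z : V) (d : R) : 0 < d ->
  (forall y, nm (y - z) < d -> Z (pi y)) -> regular_point Z 0 (pi z).
Proof.
move=> d0 Zd; split; first by apply: Zd; rewrite subrr nm0.
exists (pi @` [set y | nm (y - z) < d]); split.
  by split; [exact: pi_open_ball | exists z => //=; rewrite subrr nm0].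
exists (fun=> fun=> 0); split.
- by move=> [].
- by move=> _ [y yz <-]; split=> [_ []//|_]; apply: Zd.
- by move=> w; exists 0 => -[].
Qed.

(** A regular point needs an equation on the torus. G is brought down by the local inverse [sec] of
    the projection, which is injective on balls of radius at most half the length [e] of
    [lattice_discrete]. *)
Lemma regular_divisor (Z : set (torus Om)) (z v : V) (d : R) (G : V -> C) : 0 < d ->
  holo_ball G z d -> (forall y, nm (y - z) < d -> Z (pi y) <-> G y = 0) ->
  G z = 0 -> 'd G z v != 0 -> regular_point Z 1 (pi z).
Proof.
move=> d0 hG ZG Gz dG.
have [e e0 eP] := lattice_discrete.
pose s := Num.min d (e / 2).
have s0 : 0 < s by rewrite lt_min d0 divr_gt0.
have sd y : nm (y - z) < s -> nm (y - z) < d by rewrite lt_min => /andP[].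
have uniq y y' : nm (y - z) < s -> nm (y' - z) < s -> pi y = pi y' -> y = y'.
  rewrite !lt_min => /andP[_ y1] /andP[_ y2] /piE/eP H; apply/eqP; rewrite -subr_eq0.
  apply/eqP/H; apply: le_lt_trans (nm_tri z _ _) _; rewrite (nm_distC z).
  by clear -y1 y2; lra.
pose sec (a : torus Om) : V := xget z [set y | nm (y - z) < s /\ pi y = a].
have secE y : nm (y - z) < s -> sec (pi y) = y.
  move=> ys; rewrite /sec; case: xgetP => [x _ [xs xy]|/(_ y)]; last by case.
  exact: uniq.
pose f a := G (sec a).
pose U := pi @` [set y | nm (y - z) < s].
(* Holomorphy concerns every w above U, not only those in the ball around z; a lattice translation
   by y - w reduces to the ball. *)
have hf : holomorphic_on U f.
  move=> w [y ys yw].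
  have lw : in_lattice Om (y - w) by apply/piE.
  have d1 : differentiable G (w + (y - w)) by rewrite addrC subrK; apply: hG; apply: sd.
  have [d2 _] := diff_shift d1.
  have [] // := @near_diff R _ _ (fun x => G (x + (y - w))) (f \o pi) w (s - nm (y - z)) _ _ d2.
    by rewrite subr_gt0.
  move=> x xw; rewrite /f /=.
  have xs : nm (x + (y - w) - z) < s.
    have -> : x + (y - w) - z = (x - w) + (y - z) by rewrite addrA addrAC -!addrA; congr (_ + _); rewrite addrCA.
    by apply: le_lt_trans (nmD _ _) _; lra.
  have -> : pi x = pi (x + (y - w)) by apply/esym/piE; rewrite addrC addKr.
  by rewrite secE.
have zs : nm (z - z) < s by rewrite subrr nm0.
have Uz : U (pi z) by exists z.
split; first by apply/(ZG z (sd _ zs)).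
exists U; split; first by split=> //; exact: pi_open_ball.
exists (fun=> f); split=> //.
  move=> _ [y ys <-]; rewrite /f secE//; split=> [Zy _|/(_ ord0) Gy]; first exact/(ZG _ (sd _ ys)).
  exact/(ZG _ (sd _ ys)).
move=> w; exists (((w ord0) / 'd G z v) *: v) => i; rewrite (ord1 i).
rewrite differentialE; last exact: hf.
have dGz : differentiable G z by apply: hG; apply: sd.
have [] := @near_diff R _ _ G (f \o pi) z s s0 _ dGz.
  by move=> y ys; rewrite /f /= secE.
by move=> _ dE; rewrite dE linear_mul divfK.
Qed.

Context (Z : set (torus Om)) (aZ : analytic_set Z) (cZ : codim_ge Z 2).

(** The codimension at a is a statement about nearby regular points; here it is evaluated at a
    itself. All uses of [cZ] pass through this. *)
Lemma codim2_regular (a : torus Om) c : regular_point Z c a -> (2 <= c)%N.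
Proof. by move=> ra; have := nbhs_singleton (cZ (proj1 ra)); apply. Qed.

Lemma codim2_no_ball (z : V) (d : R) : 0 < d ->
  (forall y, nm (y - z) < d -> Z (pi y)) -> False.
Proof. by move=> d0 /(regular_open d0)/codim2_regular. Qed.

Lemma codim2_no_divisor (z v : V) (d : R) (G : V -> C) : 0 < d ->
  holo_ball G z d -> (forall y, nm (y - z) < d -> Z (pi y) <-> G y = 0) ->
  G z = 0 -> 'd G z v = 0.
Proof.
move=> d0 hG ZG Gz; apply/eqP/negPn/negP => dG.
by have := codim2_regular (regular_divisor d0 hG ZG Gz dG).
Qed.

End Lattice.

Section Family.
Context {R : realType} {V : normedModType (Cplx R)}.
Local Notation C := (Cplx R).

Lemma diff_compose (U W : normedModType C) (f : U -> V) (g : V -> W) (x : U) :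
  differentiable f x -> differentiable g (f x) ->
  differentiable (fun u => g (f u)) x /\
  forall v, 'd (fun u => g (f u)) x v = 'd g (f x) ('d f x v).
Proof.
move=> df dg; split=> [|v]; first exact: (differentiable_comp df dg).
exact: (congr1 (@^~ v) (diff_comp df dg)).
Qed.

Lemma diff_affine (W : normedModType C) (a : W) (y0 y : V) (L : V -> W) :
  bounded_linear L -> differentiable (fun y => a + L (y - y0)) y /\
  forall v, 'd (fun y => a + L (y - y0)) y v = L v.
Proof.
move=> bL; apply: frechet_is_diff => // e e0; exists 1 => // w _.
have [linL _] := bL.
pose L' : {linear V -> W} := HB.pack L (GRing.isLinear.Build _ _ _ _ L linL).
have -> : a + L (y + w - y0) - (a + L (y - y0)) - L w = 0.
  have -> : L (y + w - y0) = L (y - y0) + L w by rewrite addrAC; exact: (linearD L').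
  by move: (L (y - y0)) (L w) => X Y; rewrite addrA [a + X + Y]addrC addrK subrr.
by rewrite nm0 mulr_ge0 ?nm_ge0// ltW.
Qed.

Lemma nm_fst_le (u : C) (w : V) : nm u <= nm ((u, w) : C * V).
Proof.
apply/ler_addgt0Pr => a a0; apply/ltW.
have : nm ((u, w) : C * V) < nm ((u, w) : C * V) + a by rewrite ltrDl.
by rewrite nm_pair_lt => /andP[].
Qed.

Lemma nm_snd_le (u : C) (w : V) : nm w <= nm ((u, w) : C * V).
Proof.
apply/ler_addgt0Pr => a a0; apply/ltW.
have : nm ((u, w) : C * V) < nm ((u, w) : C * V) + a by rewrite ltrDl.
by rewrite nm_pair_lt => /andP[].
Qed.

Lemma nm_0pair (w : V) : nm ((0, w) : C * V) = nm w.
Proof.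
apply/eqP; rewrite eq_le nm_snd_le andbT.
apply/ler_addgt0Pr => a a0; apply/ltW; rewrite nm_pair_lt nm0 ltrDl a0 andbT.
by rewrite ltr_wpDl// nm_ge0.
Qed.

Lemma diff_family (H : C -> V) (g : C -> C) (t : C) (l : V) :
  differentiable H t -> differentiable g t ->
  differentiable (fun p : C * V => H p.1 + g p.1 *: p.2) (t, l).
Proof.
move=> dH dg; pose L (p : (C * V)%type) : V := 'd H t p.1 + 'd g t p.1 *: l + g t *: p.2.
have [K1 K10 K1P] := linear_bound (diff_continuous dH).
have [K2 K20 K2P] := linear_bound (diff_continuous dg).
apply: (proj1 (@frechet_is_diff R _ _ _ (t, l) L _ _)).
  split.
    move=> a [u w] [u' w'] /=; rewrite /L /= !linearP /= !scalerDr !scalerA.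
    rewrite -[a *: 'd g t u]/(a * 'd g t u) scalerDl !addrA.
    by rewrite [LHS](ACl (1*3*5*2*4*6)).
  exists (K1 + K2 * nm l + nm (g t)) => -[u w] /=; rewrite /L /=.
  set p := nm (_, _); have up : nm u <= p := nm_fst_le u w; have wp : nm w <= p := nm_snd_le u w.
  apply: le_trans (nmD _ _) _; rewrite mulrDl; apply: lerD; last first.
    by rewrite nmZc ler_wpM2l ?nm_ge0.
  apply: le_trans (nmD _ _) _; rewrite mulrDl; apply: lerD.
    by apply: le_trans (K1P u) _; rewrite ler_wpM2l.
  rewrite nmZc mulrAC ler_wpM2r ?nm_ge0//.
  by apply: le_trans (K2P u) _; rewrite ler_wpM2l.
move=> e e0.
have e3 : 0 < e / 3 by rewrite divr_gt0.
have l1 : 0 < nm l + 1 by rewrite ltr_wpDl// nm_ge0.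
have e4 : 0 < e / 3 / (nm l + 1) by rewrite divr_gt0.
have [d1 d10 d1P] := diff_frechet dH e3.
have [d2 d20 d2P] := diff_frechet dg e4.
have [d3 d30 d3P] := (proj1 (contP _ _)) (differentiable_continuous dg) _ e3.
exists (Num.min d1 (Num.min d2 d3)); first by rewrite !lt_min d10 d20.
move=> [u w]; rewrite !lt_min !nm_pair_lt => /andP[/andP[u1 _] /andP[/andP[u2 _] /andP[u3 _]]].
set p := nm (_, _); have up : nm u <= p := nm_fst_le u w; have wp : nm w <= p := nm_snd_le u w.
have -> : ((t, l) : C * V) + (u, w) = (t + u, l + w) by [].
rewrite /L /=.
have -> : H (t + u) + g (t + u) *: (l + w) - (H t + g t *: l) -
   ('d H t u + 'd g t u *: l + g t *: w) =
   (H (t + u) - H t - 'd H t u) + (g (t + u) - g t - 'd g t u) *: l + (g (t + u) - g t) *: w.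
  rewrite !scalerDr !scalerBl !opprD !addrA.
  by rewrite [LHS](ACl (1*4*6*2*5*7*3*8)).
have -> : e * p = e / 3 * p + e / 3 * p + e / 3 * p by field.
apply: le_trans (nmD _ _) _; apply: lerD; last first.
  rewrite nmZc; apply: ler_pM; rewrite ?nm_ge0//.
  by apply/ltW/d3P; rewrite addrC addKr.
apply: le_trans (nmD _ _) _; apply: lerD.
  by apply: le_trans (d1P u u1) _; rewrite ler_wpM2l// ltW.
rewrite nmZc; apply: le_trans (ler_wpM2r (nm_ge0 l) (d2P u u2)) _.
have -> : e / 3 / (nm l + 1) * nm u * nm l = e / 3 * (nm u * (nm l / (nm l + 1))) by ring.
rewrite ler_wpM2l ?(ltW e3)//; apply: le_trans up; rewrite ler_piMr ?nm_ge0//.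
by rewrite ler_pdivrMr// mul1r lerDl.
Qed.

End Family.

(** * Curves that avoid Z for generic parameters *)

Section CurveAvoid.
Context {R : realType} {n : nat} {Om : 'M[Cplx R]_(n.*2, n)}.
Context (hOm : period_matrix Om).
Local Notation C := (Cplx R).
Local Notation V := 'rV[C]_n.
Local Notation pi := (torus_pi Om).
Context (Z : set (torus Om)) (aZ : analytic_set Z) (cZ : codim_ge Z 2).
Context (H : C -> V) (g : C -> C) (dH : forall t, differentiable H t)
  (dg : forall t, differentiable g t).

(** For t near t0 the factor g t is nonzero, so l -> H t + g t l is invertible. A slice of common
    zeros would then be a ball inside Z, and a divisor G restricted to fixed t would be an equation
    of Z; both are excluded. *)
Lemma curve_thick t0 l0 : g t0 != 0 -> exists2 U, nbhs t0 U &
  thick (fun t l => ~ Z (pi (H t + g t *: l))) U l0.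
Proof.
move=> gt0.
pose Phi (p : (C * V)%type) : V := H p.1 + g p.1 *: p.2.
pose z := Phi (t0, l0).
have dPhi p : differentiable Phi p by case: p => t l; exact: diff_family.
have [k [f [d [M [d0 hf fM Zf]]]]] := analytic_local z aZ.
have [d1 d10 d1P] := (proj1 (contP _ _)) (differentiable_continuous (dPhi (t0, l0))) d d0.
have ngt0 : 0 < nm (g t0) by rewrite nm_gt0.
have [d2 d20 d2P] := (proj1 (contP _ _)) (differentiable_continuous (dg t0)) _ ngt0.
pose r := Num.min d1 d2.
have r0 : 0 < r by rewrite lt_min d10.
have Phir p : nm (p - (t0, l0) : C * V) < r -> nm (Phi p - z) < d.
  by rewrite lt_min => /andP[/d1P].
have gr t : nm (t - t0) < r -> 0 < nm (g t).
  rewrite lt_min => /andP[_ /d2P]; rewrite nm_gt0; apply: contraTneq => ->.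
  by rewrite sub0r nmN ltxx.
have box (t : C) (l : V) : nm (t - t0) < r -> nm (l - l0) < r -> nm ((t, l) - (t0, l0) : C * V) < r.
  by move=> tr lr; rewrite pair_sub nm_pair_lt tr.
clearbody r.
pose F i p := f i (Phi p).
have hF i : holo_ball (F i) (t0, l0) r.
  by move=> p pr; have [] := diff_compose (dPhi p) (hf i _ (Phir p pr)).
have FM i p : nm (p - (t0, l0) : C * V) < r -> nm (F i p) <= M by move=> pr; apply: fM; apply: Phir.
have ZF p : nm (p - (t0, l0) : C * V) < r -> Z (pi (Phi p)) <-> forall i, F i p = 0.
  by move=> pr; apply: Zf; apply: Phir.
have solve (t1 : C) (l1 y : V) : 0 < nm (g t1) ->
    Phi (t1, l1 + (g t1)^-1 *: (y - Phi (t1, l1))) = y.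
  rewrite nm_gt0 => g0; rewrite /Phi /= scalerDr scalerA divff// scale1r addrA.
  by rewrite addrC subrK.
have solve_nm (t1 : C) (y y1 : V) (s : R) : 0 < nm (g t1) -> nm (y - y1) < s * nm (g t1) ->
    nm ((g t1)^-1 *: (y - y1)) < s.
  by move=> g0 ys; rewrite nmZc nmV mulrC ltr_pdivrMr.
have noslice t1 l1 s : 0 < s -> nm (t1 - t0) < r ->
    (forall l, nm (l - l1) < s -> nm (l - l0) < r /\ forall i, F i (t1, l) = 0) -> False.
  move=> s0 t1r sF; have g1 := gr t1 t1r.
  apply: (@codim2_no_ball R n Om Z cZ (Phi (t1, l1)) (s * nm (g t1))); first by rewrite mulr_gt0.
  move=> y ys; rewrite -(solve t1 l1 y g1).
  have [|lr Fl] := sF (l1 + (g t1)^-1 *: (y - Phi (t1, l1))).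
    by rewrite addrC addKr; apply: solve_nm.
  by apply/ZF => //; apply: box.
have nodiv t1 l1 s (G : C * V -> C) : 0 < s -> nm ((t1, l1) - (t0, l0) : C * V) < r ->
    holo_ball G (t1, l1) s -> (forall i, F i (t1, l1) = 0) ->
    (forall p, nm (p - (t1, l1)) < s -> (forall i, F i p = 0) <-> G p = 0) ->
    forall v, 'd G (t1, l1) (0, v) = 0.
  move=> s0 t1r hG F1 FG v.
  have /andP[t1r1 _] : (nm (t1 - t0) < r) && (nm (l1 - l0) < r).
    by rewrite -nm_pair_lt -pair_sub.
  have g1 := gr t1 t1r1.
  pose y1 := Phi (t1, l1).
  pose L (v : V) : (C * V)%type := (0, (g t1)^-1 *: v).
  have bL : bounded_linear L.
    split.
      move=> a x y; rewrite /L scalerDr scalerA mulrC -scalerA.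
      have -> : a *: ((0, (g t1)^-1 *: x) : C * V) + (0, (g t1)^-1 *: y) =
        (a * 0 + 0, a *: ((g t1)^-1 *: x) + (g t1)^-1 *: y) by [].
      by rewrite mulr0 addr0.
    by exists (nm (g t1)^-1) => x; rewrite nm_0pair nmZc.
  pose A y : (C * V)%type := (t1, l1) + L (y - y1).
  have AE y : A y = (t1, l1 + (g t1)^-1 *: (y - y1)).
    by have -> : A y = (t1 + 0, l1 + (g t1)^-1 *: (y - y1)) by []; rewrite addr0.
  have A1 : A y1 = (t1, l1) by rewrite AE subrr scaler0 addr0.
  pose s' := Num.min s (r - nm ((t1, l1) - (t0, l0) : C * V)).
  have s'0 : 0 < s' by rewrite lt_min s0 subr_gt0.
  have As y : nm (y - y1) < s' * nm (g t1) ->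
      nm (A y - (t1, l1)) < s /\ nm (A y - (t0, l0)) < r.
    move=> ys; have : nm (A y - (t1, l1)) < s'.
      by rewrite AE pair_sub subrr nm_0pair addrC addKr; apply: solve_nm.
    rewrite /s' lt_min => /andP[A1s A1r]; split; first exact: A1s.
    by apply: (le_lt_trans (nm_tri (t1, l1) _ _)); rewrite -ltrBrDr.
  have dA y := diff_affine (t1, l1) y1 y bL.
  have hGA : holo_ball (fun y => G (A y)) y1 (s' * nm (g t1)).
    move=> y ys; have [As1 _] := As y ys.
    by have [] := diff_compose (dA y).1 (hG _ As1).
  have : 'd (fun y => G (A y)) y1 (g t1 *: v) = 0.
    apply: (@codim2_no_divisor R n Om hOm Z cZ y1 _ (s' * nm (g t1))) => //.
    - by rewrite mulr_gt0.
    - move=> y ys; have [As1 As2] := As y ys.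
      have -> : pi y = pi (Phi (A y)) by rewrite AE solve.
      exact: iff_trans (ZF _ As2) (FG _ As1).
    - by rewrite A1; apply/FG => //; rewrite subrr nm0.
  have dG1 : differentiable G (A y1) by rewrite A1; apply: hG; rewrite subrr nm0.
  have [_ dE] := diff_compose (dA y1).1 dG1.
  move=> d00.
  have e1 : 'd G (A y1) ('d A y1 (g t1 *: v)) = 0 := etrans (esym (dE (g t1 *: v))) d00.
  have e2 : 'd A y1 (g t1 *: v) = L (g t1 *: v) := (dA y1).2 (g t1 *: v).
  have e3 : L (g t1 *: v) = (0, v) by rewrite /L scalerA mulVf ?scale1r// -nm_gt0.
  by rewrite e2 e3 A1 in e1.
have [e e0 eP] := generic_no_common_zero r0 hF FM noslice nodiv.
exists [set t | nm (t - t0) <= r / 16].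
  by apply/(@nearP R C t0); exists (r / 16); [rewrite divr_gt0 | move=> w /ltW].
exists (Num.min e r); first by rewrite lt_min e0.
move=> l1 s s0; rewrite le_min => /andP[le1 le2].
have [l2 [s2 [s20 le3 P2]]] := eP l1 s s0 le1.
exists l2, s2; split=> // t l tK ll Zt.
have [i /eqP] := P2 t l tK ll; apply.
have lr : nm (l - l0) < r by apply: ball_sub (sub_ball_trans le2 le3) ll.
have tr : nm (t - t0) < r by apply: le_lt_trans tK _; rewrite ltr_pdivrMr// ltr_pMr// ltr1n.
by move: i; apply/(ZF (t, l) (box t l tr lr)).
Qed.

End CurveAvoid.

(** * Construction of the curve *)

Section Entire.
Context {R : realType}.
Local Notation C := (Cplx R).

Definition entire (W : normedModType C) (H : C -> W) := forall t, differentiable H t.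

Lemma entire_cst (W : normedModType C) (w : W) : entire (fun=> w).
Proof. by move=> t; exact: differentiable_cst. Qed.

Lemma entire_mul (f g : C -> C) : entire f -> entire g -> entire (fun t => f t * g t).
Proof. by move=> df dg t; exact: diff_mul. Qed.

Lemma entire_sub (W : normedModType C) (f g : C -> W) : entire f -> entire g ->
  entire (fun t => f t - g t).
Proof. by move=> df dg t; have [] := diff_sub (df t) (dg t). Qed.

Lemma entire_id : entire (fun t : C => t).
Proof.
move=> t; apply: (proj1 (@frechet_deriv R _ t 1 _)) => e e0; exists 1 => // w _.
have -> : t + w - t - 1 * w = 0 by ring.
by rewrite nm0 mulr_ge0 ?nm_ge0// ltW.
Qed.

Lemma entire_prod (T : seq C) (f : C -> C -> C) : (forall x, entire (f x)) ->
  entire (fun t => \prod_(x <- T) f x t).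
Proof.
move=> df; elim: T => [|x T ih].
  have -> : (fun t => \prod_(x <- [::]) f x t) = (fun=> 1) by apply: funext => t; rewrite big_nil.
  exact: entire_cst.
have -> : (fun t => \prod_(y <- x :: T) f y t) = (fun t => f x t * \prod_(y <- T) f y t).
  by apply: funext => t; rewrite big_cons.
exact: entire_mul.
Qed.

Lemma bounded_disc (W : normedModType C) (H : C -> W) (c : C) (r : R) : entire H ->
  exists2 B, 0 <= B & forall t, nm (t - c) <= r -> nm (H t) <= B.
Proof.
move=> eH; apply: (@compact_local_global _ _ (fun A => exists2 B, 0 <= B & forall t, A t -> nm (H t) <= B)
  (@compact_disc R c r)).
- by exists 0.
- by move=> A B [b b0 bP] AB; exists b => // t /AB/bP.
- move=> A B [b b0 bP] [b' b'0 b'P]; exists (b + b'); first by rewrite addr_ge0.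
  by move=> t [/bP|/b'P] le1; lra.
move=> t _; have [d d0 dP] := (proj1 (contP _ _)) (differentiable_continuous (eH t)) 1 ltr01.
exists [set s | nm (s - t) < d]; first by apply/(@nearP R C t); exists d.
exists (nm (H t) + 1); first by rewrite addr_ge0// nm_ge0.
by move=> s /dP; have := nmBl (H s) (H t); lra.
Qed.

Lemma entire_axpy n (H X : C -> 'rV[C]_n) (f : C -> C) : entire H -> entire f -> entire X ->
  entire (fun t => H t + f t *: X t).
Proof.
move=> eH ef eX t; apply: (proj1 (diff_row _)) => i.
have -> : (fun u => (H u + f u *: X u) 0 i) = (fun u => H u 0 i - (- 1) * (f u * X u 0 i)).
  by apply: funext => u; rewrite !mxE mulN1r opprK.
have [dHi _] := diff_coord i (eH t); have [dXi _] := diff_coord i (eX t).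
have d1 := diff_mul (entire_cst (-1 : C) t) (diff_mul (ef t) dXi).
by have [] := diff_sub dHi d1.
Qed.

(* A polynomial with superattracting fixed points 0 and 1: iterating it turns
   a function close to 0 on one disc and to 1 on another into a good
   approximation of the corresponding characteristic function. *)
Definition smooth (w : C) : C := 3 * w ^+ 2 - 2 * w ^+ 3.

Lemma smooth_iter_small k (w : C) : nm w <= 8^-1 -> nm (iter k smooth w) <= 2 ^- k.
Proof.
move=> w8; suff [] : nm (iter k smooth w) <= 8^-1 /\ nm (iter k smooth w) <= 2 ^- k by [].
elim: k => [|k [ih1 ih2]]; first by rewrite expr0 invr1 /=; split=> //; apply: le_trans w8 _; lra.
rewrite iterS; move: (iter k smooth w) ih1 ih2 => x x8 x2.
(* For nm x <= 1/8 the factor x (3 - 2 x) has norm at most (1/8) (3 + 1/4) < 1/2. *)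
have sx : nm (smooth x) <= nm x / 2.
  have -> : smooth x = x * (x * (3 - 2 * x)) by rewrite /smooth; ring.
  have := nmB (3 : C) (2 * x); rewrite nmM !nm_nat => le1.
  rewrite nmM ler_wpM2l ?nm_ge0// nmM.
  by have := nm_ge0 x; have := nm_ge0 (3 - 2 * x); nra.
rewrite halfS; split; last by apply: le_trans sx _; lra.
by have := nm_ge0 x; lra.
Qed.

Lemma smooth_iter_compl k (w : C) : 1 - iter k smooth w = iter k smooth (1 - w).
Proof.
elim: k => // k; rewrite !iterS => <-; move: (iter k smooth w) => x.
by rewrite /smooth; ring.
Qed.

Lemma smooth_iter0 k : iter k smooth 0 = 0.
Proof. by elim: k => // k; rewrite iterS => ->; rewrite /smooth !expr0n /= !mulr0 subrr. Qed.

Lemma smooth_iter1 k : iter k smooth 1 = 1.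
Proof. by apply/eqP; rewrite -subr_eq0 -opprB smooth_iter_compl subrr smooth_iter0 oppr0. Qed.

Lemma entire_smooth k (f : C -> C) : entire f -> entire (fun t => iter k smooth (f t)).
Proof.
move=> ef; elim: k => [//|k ih].
have -> : (fun t => iter k.+1 smooth (f t)) = (fun t => 3 * (iter k smooth (f t) * iter k smooth (f t))
    - 2 * (iter k smooth (f t) * (iter k smooth (f t) * iter k smooth (f t)))).
  by apply: funext => t; rewrite iterS /smooth; ring.
apply: entire_sub; (apply: entire_mul; first exact: entire_cst);
  by do ?[apply: entire_mul | exact: ih].
Qed.

(** Each factor differs from 1 by (t - b) / (b - x), which tends to 0 as b grows while t stays
    within 2 of b. *)
Lemma prod_near1 (T : seq C) (eta : R) : 0 < eta -> exists b0 : R, forall b : R, b0 <= b ->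
  forall t : C, nm (t - b%:C) <= 2 -> nm (\prod_(x <- T) ((t - x) / ((b%:C : C) - x)) - 1) <= eta.
Proof.
elim: T eta => [|x T ih] eta eta0.
  by exists 0 => b _ t _; rewrite big_nil subrr nm0 ltW.
pose e := Num.min 1 (eta / 3).
have e0 : 0 < e by rewrite lt_min ltr01 divr_gt0.
have [e1 e3] : e <= 1 /\ e <= eta / 3 by rewrite !ge_min !lexx orbT.
clearbody e.
have [b0 b0P] := ih e e0; exists (Num.max b0 (nm x + 2 / e)) => b; rewrite ge_max => /andP[bb0 bx] t tb.
have bx0 : 2 / e <= nm ((b%:C : C) - x).
  have := nmBl (b%:C : C) x; rewrite nm_real; have := ler_norm b; lra.
have bxp : 0 < nm ((b%:C : C) - x) by apply: lt_le_trans bx0; rewrite divr_gt0.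
have bxn : (b%:C : C) - x != 0 by rewrite -nm_gt0.
have f1 : nm ((t - x) / ((b%:C : C) - x) - 1) <= e.
  have -> : (t - x) / ((b%:C : C) - x) - 1 = (t - b%:C) / ((b%:C : C) - x) by field.
  rewrite nmM nmV ler_pdivrMr//; apply: le_trans tb _.
  by rewrite mulrC -ler_pdivrMr.
have f2 := b0P b bb0 t tb.
rewrite big_cons; move: (_ / _) (\prod_(_ <- _) _) f1 f2 => p q f1 f2.
have -> : p * q - 1 = (p - 1) * (q - 1) + (p - 1) + (q - 1) by ring.
apply: le_trans (nmD _ _) _; have := nmD ((p - 1) * (q - 1)) (p - 1); rewrite nmM.
have : nm (p - 1) * nm (q - 1) <= 1 * e.
  by apply: ler_pM; rewrite ?nm_ge0//; apply: le_trans f1 e1.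
by lra.
Qed.

(** For b >= 17 r every factor is at most 2 r / (16 r) in norm. The extra node 0 ensures at least
    one factor when T is empty. *)
Lemma prod_near0 (T : seq C) (r : R) : 0 < r -> (forall x, x \in T -> nm x <= r) ->
  forall b : R, 17 * r <= b -> forall t : C, nm t <= r ->
  nm (\prod_(x <- 0 :: T) ((t - x) / ((b%:C : C) - x))) <= 8^-1.
Proof.
move=> r0 Tr b br t tr.
have f8 x : nm x <= r -> nm ((t - x) / ((b%:C : C) - x)) <= 8^-1.
  move=> xr; have bx : 16 * r <= nm ((b%:C : C) - x).
    have := nmBl (b%:C : C) x; rewrite nm_real; have := ler_norm b; lra.
  rewrite nmM nmV ler_pdivrMr; last by apply: lt_le_trans bx; rewrite mulr_gt0.
  by have := nmB t x; lra.
rewrite big_cons nmM -[8^-1]mulr1; apply: ler_pM; rewrite ?nm_ge0//.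
  by apply: f8; rewrite nm0 ltW.
elim: T Tr => [|x T ih] Tr; first by rewrite big_nil nm1.
have x1 : nm ((t - x) / ((b%:C : C) - x)) <= 1.
  by apply: le_trans (f8 x (Tr x _)) _; [rewrite mem_head | lra].
have Tr' y : y \in T -> nm y <= r by move=> yT; apply: Tr; rewrite inE yT orbT.
by have := ler_pM (nm_ge0 _) (nm_ge0 _) x1 (ih Tr'); rewrite mulr1 big_cons nmM.
Qed.

(** The product [w] vanishes on T, equals 1 at b, and is within 1/8 of 0 on the old disc and of 1 on
    the new one. Iterating [smooth] preserves the exact values 0 and 1, so the nodes are
    interpolated exactly, and drives the two errors to 0. *)
Lemma attach_line n (H : C -> 'rV[C]_n) (T : seq C) (r e : R) (q v : 'rV[C]_n) :
  entire H -> 0 < r -> (forall x, x \in T -> nm x <= r) -> 0 < e ->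
  exists (G : C -> 'rV[C]_n) (b : C), [/\ entire G,
    forall x, x \in T -> G x = H x, G b = q,
    forall t, nm t <= r -> nm (G t - H t) <= e &
    forall t, nm (t - b) <= 2 -> nm (G t - (q + (t - b) *: v)) <= e].
Proof.
move=> eH r0 Tr e0.
have e8 : 0 < (8 : R)^-1 by rewrite invr_gt0.
have [b0 b0P] := prod_near1 (0 :: T) e8.
pose b' := Num.max b0 (17 * r); pose b : C := b'%:C.
have [b'0 b'r] : b0 <= b' /\ 17 * r <= b' by rewrite /b' !le_max !lexx orbT.
pose w t := \prod_(x <- 0 :: T) ((t - x) / (b - x)).
have w0 t : nm t <= r -> nm (w t) <= 8^-1 by apply: prod_near0.
have w1 t : nm (t - b) <= 2 -> nm (w t - 1) <= 8^-1 by apply: b0P.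
have wT x : x \in T -> w x = 0.
  move=> xT; apply/eqP; rewrite /w prodf_seq_eq0; apply/hasP; exists x; first by rewrite inE xT orbT.
  by rewrite subrr mul0r eqxx.
have nb : nm b = b' by rewrite nm_real ger0_norm//; lra.
have wb : w b = 1.
  rewrite /w big1_seq// => x; rewrite inE => /andP[_ xT]; rewrite divff// subr_eq0.
  have xr : nm x <= r by case/orP: xT => [/eqP->|/Tr//]; rewrite nm0 ltW.
  by apply: contraTneq xr => <-; rewrite nb -ltNge; lra.
have ew : entire w.
  apply: entire_prod => x; apply: entire_mul; last exact: entire_cst.
  by apply: entire_sub; [exact: entire_id | exact: entire_cst].
pose X t := q + (t - b) *: v - H t.
have eX : entire X.
  apply: entire_sub eH; apply: entire_axpy; [exact: entire_cst | | exact: entire_cst].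
  by apply: entire_sub; [exact: entire_id | exact: entire_cst].
have [B1 B10 B1P] := bounded_disc 0 r eX.
have [B2 B20 B2P] := bounded_disc b 2 eX.
(* The size of X depends on b, so b is chosen for the fixed accuracy 1/8 and only then the number of
   iterations. *)
have [k kP] := half_small (B1 + B2) e0.
pose chi t := iter k smooth (w t).
have small (x y : R) : 0 <= x -> x <= 2 ^- k -> 0 <= y -> y <= B1 + B2 -> x * y <= e.
  by move=> x0 xk y0 yB; apply: le_trans (ltW (kP k (leqnn _))); rewrite mulrC; apply: ler_pM.
exists (fun t => H t + chi t *: X t), b; split.
- by apply: entire_axpy => //; apply: entire_smooth.
- by move=> x xT; rewrite /chi wT// smooth_iter0 scale0r addr0.
- by rewrite /chi wb smooth_iter1 scale1r /X subrr scale0r addr0 addrC subrK.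
- move=> t tr; rewrite addrC addKr nmZc; apply: small; rewrite ?nm_ge0//.
    exact: smooth_iter_small (w0 t tr).
  by apply: le_trans (B1P t _) _; [rewrite subr0 | lra].
- move=> t tb.
  have -> : H t + chi t *: X t - (q + (t - b) *: v) = - ((1 - chi t) *: X t).
    rewrite [in RHS]scalerBl scale1r opprB; move: (chi t *: _) => y.
    by rewrite /X opprB addrA [y + H t]addrC.
  rewrite nmN nmZc; apply: small; rewrite ?nm_ge0//.
    rewrite /chi smooth_iter_compl; apply: smooth_iter_small.
    by rewrite nm_distC; apply: w1.
  by apply: le_trans (B2P t tb) _; lra.
Qed.

(** The rate is known only from index N on; the finitely many earlier terms merely enlarge the
    constant in [glimE]. *)
Lemma glim_shift (u : nat -> C) (N : nat) (K : R) :
  (forall k, nm (u (N + k.+1)%N - u (N + k)%N) <= K * 2 ^- k) ->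
  forall k, nm (u (N + k)%N - glim u) <= 4 * K * 2 ^- k.
Proof.
move=> uK; pose v k := u (N + k)%N.
have [l lP] := @geom_cvg R v K uK.
suff -> : glim u = l by exact: lP.
have K0 : 0 <= 4 * K by have := le_trans (nm_ge0 _) (lP 0%N); rewrite expr0 invr1 mulr1.
apply: (@glimE R u (4 * K * 2 ^+ N + \sum_(k < N) nm (u k - l) * 2 ^+ k)) => k.
have S0 (I : finType) (P : pred I) (f g : I -> R) : (forall i, 0 <= f i) -> (forall i, 0 <= g i) ->
    0 <= \sum_(i | P i) f i * g i by move=> f0 g0; apply: sumr_ge0 => i _; apply: mulr_ge0.
have p2 (i : nat) : 0 <= (2 : R) ^+ i by rewrite exprn_ge0.
rewrite ler_pdivlMr ?exprn_gt0//.
have [Nk|kN] := leqP N k.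
  have := lP (k - N)%N; rewrite /v subnKC// -(ler_pM2r (_ : 0 < 2 ^+ k)) ?exprn_gt0// => /le_trans; apply.
  rewrite -{2}(subnK Nk) exprD mulrA -[4 * K * _ * _]mulrA mulVf ?expf_neq0// mulr1 lerDl.
  by apply: S0 => i //; apply: nm_ge0.
rewrite (bigD1 (Ordinal kN))//= addrCA lerDl addr_ge0//; first by rewrite mulr_ge0.
by apply: S0 => i //; apply: nm_ge0.
Qed.

End Entire.

(** * Stages of the construction and their limit *)

Section Construction.
Context {R : realType} {n : nat} {Om : 'M[Cplx R]_(n.*2, n)}.
Context (hOm : period_matrix Om).
Local Notation C := (Cplx R).
Local Notation V := 'rV[C]_n.
Local Notation pi := (torus_pi Om).
Context (Z : set (torus Om)) (aZ : analytic_set Z) (cZ : codim_ge Z 2).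

Lemma row_tri (w u v : V) : nm (u - v) <= nm (u - w) + nm (w - v).
Proof. exact: nm_tri. Qed.

Lemma row_subl (u v : V) : nm u - nm v <= nm (u - v).
Proof. exact: nmBl. Qed.

(** At a zero of g, which is a node, openness of the complement of Z suffices; elsewhere
    [curve_thick] applies. Compactness yields one l for the whole disc, taken below e / (B + 1) with
    B a bound for g. *)
Lemma perturb (H : C -> V) (T : seq C) (r e : R) : entire H ->
  (forall x, x \in T -> ~ Z (pi (H x))) -> 0 < e ->
  exists G : C -> V, [/\ entire G, forall x, x \in T -> G x = H x,
    forall t, nm t <= r -> nm (G t - H t) <= e &
    forall t, nm t <= r -> ~ Z (pi (G t))].
Proof.
move=> eH HT e0; pose g (t : C) := \prod_(x <- T) (t - x).
have eg : entire g.
  by apply: entire_prod => x; apply: entire_sub; [exact: entire_id | exact: entire_cst].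
have gT x : (g x == 0) = (x \in T).
  rewrite /g prodf_seq_eq0; apply/hasP/idP => [[y yT /=]|xT].
    by rewrite subr_eq0 => /eqP ->.
  by exists x => //=; rewrite subrr.
have [a a0 aP] : thick (fun t l => ~ Z (pi (H t + g t *: l))) [set t | nm (t - 0) <= r] 0.
  apply: (thick_compact (@compact_disc R 0 r)) => t _.
  have [gt0|gt0] := eqVneq (g t) 0; last exact: curve_thick.
  have nZ : ~ Z (pi (H t)) by apply: HT; rewrite -gT gt0.
  have [d d0 dP] := analytic_closed aZ nZ.
  have dPhi := @diff_family R V H g t 0 (eH t) (eg t).
  have [d1 d10 d1P] := (proj1 (contP _ _)) (differentiable_continuous dPhi) d d0.
  exists [set s | nm (s - t) < d1]; first by apply/(@nearP R C t); exists d1.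
  exists d1 => // l1 d2 d20 le1; exists l1, d2; rewrite subrr nm0 add0r; split=> // s l sd ll.
  have := d1P (s, l); rewrite pair_sub nm_pair_lt /= scaler0 addr0 => le2.
  by apply: dP; apply: le2; rewrite sd (ball_sub le1 ll).
have [B B0 BP] := bounded_disc 0 r eg.
have B1 : 0 < B + 1 by rewrite ltr_wpDl.
have m0 : 0 < Num.min a (e / (B + 1)) by rewrite lt_min a0 divr_gt0.
have [|l [d [d0 le1 lP]]] := aP 0 _ m0; first by rewrite subrr nm0 add0r ge_min lexx.
have nl : nm l <= e / (B + 1).
  have : nm (l - 0) + d <= e / (B + 1) by apply: le_trans le1 _; rewrite ge_min lexx orbT.
  by rewrite subr0; lra.
exists (fun t => H t + g t *: l); split.
- by apply: entire_axpy => //; exact: entire_cst.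
- by move=> x xT; have /eqP -> : g x == 0 by [rewrite gT]; rewrite scale0r addr0.
- move=> t tr; rewrite addrC addKr nmZc; apply: le_trans (_ : (B + 1) * (e / (B + 1)) <= _).
    apply: ler_pM; rewrite ?nm_ge0//; apply: le_trans (BP t _) _; first by rewrite subr0.
    by rewrite lerDl.
  by rewrite mulrC divfK// gt_eqF.
- by move=> t tr; apply: lP; rewrite /= ?subr0// subrr nm0.
Qed.

Lemma margin (H : C -> V) (r : R) : entire H -> (forall t, nm t <= r -> ~ Z (pi (H t))) ->
  exists2 m, 0 < m & forall t w, nm t <= r -> nm (w - H t) <= m -> ~ Z (pi w).
Proof.
move=> eH HZ.
suff [m m0 mP] : exists2 m, 0 < m & forall t w, nm (t - 0) <= r -> nm (w - H t) <= m -> ~ Z (pi w).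
  by exists m => // t w tr; apply: mP; rewrite subr0.
apply: (@compact_local_global _ _ (fun A => exists2 m, 0 < m &
   forall t w, A t -> nm (w - H t) <= m -> ~ Z (pi w)) (@compact_disc R 0 r)).
- by exists 1.
- by move=> A B [m m0 mP] AB; exists m => // t w /AB; apply: mP.
- move=> A B [m m0 mP] [m' m'0 m'P]; exists (Num.min m m'); first by rewrite lt_min m0.
  by move=> t w [At|Bt]; rewrite le_min => /andP[wm wm']; [apply: mP At wm | apply: m'P Bt wm'].
move=> t tr; have nZ : ~ Z (pi (H t)) by apply: HZ; rewrite -[t]subr0.
have [d d0 dP] := analytic_closed aZ nZ.
have d2 : 0 < d / 2 by rewrite divr_gt0.
have [d1 d10 d1P] := (proj1 (contP _ _)) (differentiable_continuous (eH t)) _ d2.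
exists [set s | nm (s - t) < d1]; first by apply/(@nearP R C t); exists d1.
exists (d / 3); first by rewrite divr_gt0.
move=> s w /d1P le1 le2; apply: dP; apply: le_lt_trans (nm_tri (H s) _ _) _.
by clear -le1 le2 d0; lra.
Qed.

Record stage := Stage { curve : C -> V; nodes : seq C; radius : R; tol : R }.

(** The room around the curve is 2 * tol because the limit of all later stages is controlled within
    exactly that distance. *)
Definition valid (s : stage) : Prop := [/\ entire (curve s), 0 < radius s, 0 < tol s,
  forall x, x \in nodes s -> nm x <= radius s &
  forall t w, nm t <= radius s -> nm (w - curve s t) <= 2 * tol s -> ~ Z (pi w)].

Definition refines (q v : V) (e : R) (s s' : stage) (b : C) : Prop :=
  [/\ valid s', [/\ {subset nodes s <= nodes s'}, b \in nodes s' & curve s' b = q],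
    forall x, x \in nodes s -> curve s' x = curve s x,
    [/\ radius s + 1 <= radius s', nm b + 2 <= radius s', tol s' <= tol s / 2 & tol s' <= e] &
    (forall t, nm t <= radius s -> nm (curve s' t - curve s t) <= tol s / 2) /\
    (forall t, nm (t - b) <= 2 -> nm (curve s' t - (q + (t - b) *: v)) <= e)].

Lemma refine_stage (q v : V) (e : R) (s : stage) : 0 < e -> ~ Z (pi q) -> valid s ->
  exists s' b, refines q v e s s' b.
Proof.
move=> e0 qZ [eH r0 m0 Tr HZ].
(* Two corrections are made, each of size at most e1; together they stay below tol s / 2 on the old
   disc and below e on the new one. *)
pose e1 := Num.min (tol s / 4) (e / 2).
have e10 : 0 < e1 by rewrite lt_min !divr_gt0.
have [e1m e1e] : e1 <= tol s / 4 /\ e1 <= e / 2 by rewrite !ge_min !lexx orbT.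
clearbody e1.
have [G [b [eG GT Gb Gr Gl]]] := attach_line q v eH r0 Tr e10.
have GTZ x : x \in b :: nodes s -> ~ Z (pi (G x)).
  rewrite inE => /orP[/eqP->|xT]; first by rewrite Gb.
  rewrite GT//; apply: (HZ x); first exact: Tr.
  by rewrite subrr nm0 mulr_ge0// ltW.
pose r' := radius s + nm b + 2.
have [K [eK KT Kr KZ]] := @perturb G (b :: nodes s) r' e1 eG GTZ e10.
have [m mp mP] := margin eK KZ.
(* m / 2 leaves the room demanded by [valid], tol s / 2 makes tolerances geometric, and e bounds the
   later drift on the disc of the new line. *)
pose m' := Num.min (m / 2) (Num.min (tol s / 2) e).
have m'0 : 0 < m' by rewrite !lt_min !divr_gt0.
have [m'1 m'2 m'3] : [/\ m' <= m / 2, m' <= tol s / 2 & m' <= e].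
  by rewrite !ge_min !lexx !orbT.
clearbody m'.
have nb := nm_ge0 b.
exists (Stage K (b :: nodes s) r' m'), b; split => /=.
- split=> //=.
  + by rewrite /r'; lra.
  + by move=> x; rewrite inE => /orP[/eqP->|/Tr xr]; rewrite /r'; lra.
  + by move=> t w tr wm; apply: (mP t) => //; lra.
- split; first by move=> x xT; rewrite inE xT orbT.
    exact: mem_head.
  by rewrite KT ?mem_head.
- by move=> x xT; rewrite KT ?GT// inE xT orbT.
- by rewrite /r'; split=> //; lra.
- split=> t tr.
    have tr' : nm (t : C) <= r' by rewrite /r'; lra.
    have le1 := row_tri (G t) (K t) (curve s t); have le2 := Kr t tr'; have le3 := Gr t tr.
    by clear -le1 le2 le3 e1m; lra.
  have tr' : nm (t : C) <= r'.
    by have := nmD ((t : C) - b) b; rewrite subrK /r'; lra.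
  have le1 := row_tri (G t) (K t) (q + (t - b) *: v); have le2 := Kr t tr'; have le3 := Gl t tr.
  by clear -le1 le2 le3 e1e; lra.
Qed.

Theorem avoiding_curve (q v : nat -> V) (e : nat -> R) :
  (forall j, ~ Z (pi (q j))) -> (forall j, 0 < e j) ->
  exists H : C -> V, [/\ entire H, forall t, ~ Z (pi (H t)) &
    exists b : nat -> C, forall j, H (b j) = q j /\
      forall t, nm (t - b j) <= 1 -> nm (H t - (q j + (t - b j) *: v j)) <= e j].
Proof.
move=> qZ e0.
(* One third is the error of stage j.+1 on its line; the later drift is at most 2 * tol, hence two
   thirds. *)
have eps0 j : 0 < e j / 3 by rewrite divr_gt0.
have [m0 m00 m0P] := @margin (fun=> q 0%N) 1 (entire_cst _) (fun _ _ => qZ 0%N).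
pose s0 := Stage (fun=> q 0%N) [::] 1 (m0 / 2).
have vs0 : valid s0.
  split; [exact: entire_cst | exact: ltr01 | by rewrite /= divr_gt0 | by [] | rewrite /=].
  by move=> t w tr wm; apply: (m0P t) => //; lra.
(* Choice needs a total function, so invalid stages receive a dummy successor. *)
have step (js : nat * stage) : exists sb : stage * C,
    valid js.2 -> refines (q js.1) (v js.1) (e js.1 / 3) js.2 sb.1 sb.2.
  have [vs|nv] := pselect (valid js.2); last by exists (s0, 0).
  by have [s' [b sb]] := refine_stage (v js.1) (eps0 js.1) (qZ js.1) vs; exists (s', b).
have [next nextP] := choice step.
pose S := fix S j := if j is k.+1 then (next (k, S k)).1 else s0.
pose b j := (next (j, S j)).2.
have vS j : valid (S j).
  elim: j => [//|j ih]; have [vn _ _ _ _] := nextP (j, S j) ih; exact: vn.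
have ref j : refines (q j) (v j) (e j / 3) (S j) (S j.+1) (b j) := nextP (j, S j) (vS j).
pose h j := curve (S j).
have rad j : j%:R <= radius (S j).
  elim: j => [|j ih]; first by rewrite /= ler01.
  by have [_ _ _ [le1 _ _ _] _] := ref j; rewrite -natr1; lra.
have radm j k : radius (S j) <= radius (S (j + k)%N).
  elim: k => [|k ih]; first by rewrite addn0.
  by rewrite addnS; have [_ _ _ [le1 _ _ _] _] := ref (j + k)%N; lra.
have tolm j k : tol (S (j + k)%N) <= tol (S j) * 2 ^- k.
  elim: k => [|k ih]; first by rewrite addn0 expr0 invr1 mulr1.
  by rewrite addnS halfS; have [_ _ _ [_ _ le1 _] _] := ref (j + k)%N; lra.
have stepS j t k : nm t <= radius (S j) ->
    nm (h (j + k.+1)%N t - h (j + k)%N t) <= tol (S j) / 2 * 2 ^- k.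
  move=> tr; rewrite addnS; have [_ _ _ _ [le1 _]] := ref (j + k)%N.
  have := le1 t (le_trans tr (radm j k)); have := tolm j k; rewrite /h; lra.
pose H t : V := \row_i glim (fun j => h j t 0 i).
have HP j t k : nm t <= radius (S j) -> nm (h (j + k)%N t - H t) <= 2 * tol (S j) * 2 ^- k.
  move=> tr; have [_ _ tol0 _ _] := vS j; apply: nm_row_leP.
    by rewrite !mulr_ge0// ?invr_ge0 ?exprn_ge0// ltW.
  move=> i; rewrite !mxE.
  have := @glim_shift R (fun j => h j t 0 i) j (tol (S j) / 2).
  have -> : 2 * tol (S j) = 4 * (tol (S j) / 2) by lra.
  apply=> l; apply: le_trans (stepS j t l tr).
  by apply: le_trans (nm_row_le _ i); rewrite !mxE.
have HP0 j t : nm t <= radius (S j) -> nm (H t - h j t) <= 2 * tol (S j).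
  by move=> tr; have := HP j t 0%N tr; rewrite addn0 expr0 invr1 mulr1 nm_distC.
have arch (t : C) : exists j, nm t <= radius (S j).
  by exists (Num.bound (nm t)); apply: le_trans (rad _); apply/ltW/archi_boundP/nm_ge0.
have nodesH j x : x \in nodes (S j) -> H x = h j x.
  move=> xT; have all k : x \in nodes (S (j + k)%N) /\ h (j + k)%N x = h j x.
    elim: k => [|k [ih1 ih2]]; first by rewrite addn0.
    rewrite addnS; have [_ [sub _ _] eq _ _] := ref (j + k)%N.
    by split; [exact: sub | rewrite /h eq// -/(h _) ih2].
  have [_ _ _ Tr _] := vS j; have xr := Tr x xT.
  apply/esym/eqP; rewrite -subr_eq0 -nm_eq0 eq_le nm_ge0 andbT.
  apply: (@geom_le0 R (2 * tol (S j))) => k.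
  by have := HP j x k xr; rewrite (all k).2.
exists H; split.
- move=> t; apply: (proj1 (diff_row _)) => i.
  (* Stage j.+1 is used because its radius exceeds that of stage j by at least 1 and thus covers the
     unit disc around t. *)
  have [j jr] := arch t; have [_ _ tol0 _ _] := vS j.+1.
  have yr (y : C) : nm (y - t) < 1 -> nm y <= radius (S j.+1).
    move=> yt; have [_ _ _ [le1 _ _ _] _] := ref j.
    by have := nmD (y - t) t; rewrite subrK; lra.
  have [eh _ _ _ _] := vS j.+1.
  have [B B0 BP] := bounded_disc t 1 eh.
  apply: (@weierstrass R _ (fun k y => h (j.+1 + k)%N y 0 i) (fun y => H y 0 i) t 1
    (2 * tol (S j.+1)) (B + 4 * tol (S j.+1))) => //.
  + move=> k y _; have [ehk _ _ _ _] := vS (j.+1 + k)%N.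
    by have [] := diff_coord i (ehk y).
  + move=> k y yt; apply: le_trans (nm_row_le _ i) _.
    have le1 := HP j.+1 y k (yr y yt); have le2 := HP0 j.+1 y (yr y yt).
    have le3 := BP y (ltW yt).
    have le4 : 2 * tol (S j.+1) * 2 ^- k <= 2 * tol (S j.+1).
      rewrite -[X in _ <= X]mulr1; apply: ler_wpM2l; first by rewrite mulr_ge0// ltW.
      by rewrite invf_le1 ?exprn_gt0// exprn_ege1// ler1n.
    have le5 := row_subl (h (j.+1 + k)%N y) (h j.+1 y).
    have le6 := row_tri (H y) (h (j.+1 + k)%N y) (h j.+1 y).
    rewrite /h in le1 le2 le5 le6 *.
    by clear -le1 le2 le3 le4 le5 le6; lra.
  + move=> k y yt; apply: le_trans (HP j.+1 y k (yr y yt)).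
    by apply: le_trans (nm_row_le _ i); rewrite !mxE.
- move=> t; have [j jr] := arch t; have [_ _ _ _ HZ] := vS j.
  exact: HZ jr (HP0 j t jr).
exists b => j; have [_ [_ bT bq] _ [_ br _ te] [_ line]] := ref j.
split; first by rewrite (nodesH j.+1 _ bT).
move=> t tb.
have tr : nm t <= radius (S j.+1) by have := nmD (t - b j) (b j); rewrite subrK; lra.
have tb2 : nm (t - b j) <= 2 by lra.
have le1 := line t tb2; have le2 := HP0 j.+1 t tr.
have le3 := row_tri (h j.+1 t) (H t) (q j + (t - b j) *: v j); rewrite /h in le2 le3.
by clear -le1 le2 le3 te; lra.
Qed.

End Construction.

(** * Transversality *)

Section Newton.
Context {R : realType}.
Local Notation C := (Cplx R).

(** Newton's iteration with the fixed slope c. As the derivative differs from c by at most nm c / 2,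
    each residue is at most half the previous one, and the iterates move by less than 2 nm (G b) /
    nm c < r / 4 in total. *)
Lemma newton_zero (G : C -> C) (b c : C) (r : R) : 0 < r -> c != 0 ->
  (forall t, nm (t - b) < r -> differentiable G t /\ nm ('d G t 1 - c) <= nm c / 2) ->
  nm (G b) < nm c * (r / 8) -> exists2 t, nm (t - b) < r & G t = 0.
Proof.
move=> r0 c0 dG Gb.
have nc : 0 < nm c by rewrite nm_gt0.
pose beta := nm (G b) / nm c.
have beta0 : 0 <= beta by rewrite divr_ge0 ?nm_ge0.
have betar : beta < r / 8 by rewrite ltr_pdivrMr// mulrC.
have lin s w : nm (s - b) < r -> nm (s + w - b) < r ->
    nm (G (s + w) - G s - c * w) <= nm c / 2 * nm w.
  move=> s1 s2.
  have -> : G (s + w) - G s - c * w = (G (s + w) - c * (s + w)) - (G s - c * s) by ring.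
  apply: (@mean_value R C C (fun u => G u - c * u)) => x x01.
  have [d1 d1E] := dG _ (nm_segment s1 s2 x01).
  have [d2 d2E] : differentiable (fun u : C => c * u) (s + x%:C *: w) /\
      'd (fun u : C => c * u) (s + x%:C *: w) 1 = c.
    apply: frechet_deriv => e e0; exists 1 => // y _.
    have -> : c * (s + x%:C *: w + y) - c * (s + x%:C *: w) - c * y = 0 by ring.
    by rewrite nm0 mulr_ge0 ?nm_ge0// ltW.
  have [d3 d3E] := diff_sub d1 d2; split=> //.
  have e3 := diff_deriv w d3.
  have e4 : 'd (fun u => G u - c * u) (s + x%:C *: w) 1 = 'd G (s + x%:C *: w) 1 - c :=
    etrans (d3E 1) (congr1 (fun y => _ - y) d2E).
  have e5 : 'd (fun u => G u - c * u) (s + x%:C *: w) w = w * ('d G (s + x%:C *: w) 1 - c) :=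
    etrans e3 (congr1 (fun y => w * y) e4).
  by apply: le_trans (_ : nm (w * ('d G (s + x%:C *: w) 1 - c)) <= _);
    [rewrite le_eqVlt; apply/orP; left; apply/eqP/congr1/e5 | rewrite nmM mulrC ler_wpM2r ?nm_ge0].
pose u := fix u k := if k is j.+1 then u j - G (u j) / c else b.
have uS k : u k.+1 = u k + - (G (u k) / c) by [].
have key k : nm (u k - b) <= 2 * beta * (1 - 2 ^- k) /\ nm (G (u k)) <= nm (G b) * 2 ^- k.
  elim: k => [|k [ih1 ih2]].
    by rewrite /= subrr nm0 expr0 invr1 subrr !mulr0 mulr1.
  have h0 : 0 < (2 : R) ^- k := half_gt0 k.
  have uk : nm (u k - b) < r by have := mulr_ge0 beta0 (ltW h0); lra.
  have step : nm (- (G (u k) / c)) <= beta * 2 ^- k.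
    by rewrite nmN nmM nmV ler_pdivrMr// /beta mulrAC divfK ?gt_eqF.
  have le1 : nm (u k.+1 - b) <= 2 * beta * (1 - 2 ^- k.+1).
    rewrite uS addrAC halfS; apply: le_trans (nmD _ _) _; lra.
  have uk1 : nm (u k + - (G (u k) / c) - b) < r.
    by rewrite -uS; have := half_gt0 k.+1; have := mulr_ge0 beta0 (ltW (half_gt0 k.+1)); lra.
  split=> //; have := lin (u k) _ uk uk1.
  have -> : G (u k + - (G (u k) / c)) - G (u k) - c * - (G (u k) / c) = G (u k.+1).
    by rewrite uS; field.
  rewrite nmN nmM nmV => /le_trans; apply; rewrite halfS.
  have -> : nm c / 2 * (nm (G (u k)) / nm c) = nm (G (u k)) / 2 by field; rewrite gt_eqF.
  lra.
have [|t tP] := @geom_cvg R u beta.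
  move=> k; rewrite uS addrC addKr nmN nmM nmV ler_pdivrMr//.
  by rewrite /beta mulrAC divfK ?gt_eqF//; have [] := key k.
have tb : nm (t - b) < r.
  by have := tP 0%N; rewrite expr0 invr1 mulr1 /= nm_distC; lra.
exists t => //; apply/eqP; rewrite -nm_eq0 eq_le nm_ge0 andbT.
apply: (@geom_le0 R (nm (G b) + 3 / 2 * nm c * (4 * beta))) => k.
have [uk Gk] := key k.
have ukr : nm (u k - b) < r.
  by have := mulr_ge0 beta0 (ltW (half_gt0 k : 0 < (2 : R) ^- k)); lra.
have tE : u k + (t - u k) = t by rewrite addrC subrK.
have := lin (u k) (t - u k) ukr; rewrite tE => /(_ tb) le1.
have := tP k; rewrite nm_distC => le2.
have le3 : 3 / 2 * nm c * nm (t - u k) <= 3 / 2 * nm c * (4 * beta * 2 ^- k).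
  by rewrite ler_wpM2l// mulr_ge0// ltW.
have : nm (G t) <= nm (G t - G (u k) - c * (t - u k)) + nm (G (u k)) + nm c * nm (t - u k).
  have {1}-> : G t = (G t - G (u k) - c * (t - u k)) + G (u k) + c * (t - u k) by ring.
  by apply: le_trans (nmD _ _) _; rewrite nmM lerD2r nmD.
lra.
Qed.

End Newton.

Section RationalPoints.
Context {R : realType} {n : nat}.
Local Notation C := (Cplx R).
Local Notation V := 'rV[C]_n.

Definition rational_point (ab : 'rV[rat]_n * 'rV[rat]_n) : V :=
  \row_i ((ratr (ab.1 0 i) : R) +i* ratr (ab.2 0 i)).

Lemma rational_dense (z : V) (d : R) : 0 < d -> exists ab, nm (rational_point ab - z) < d.
Proof.
move=> d0; have d3 : 0 < d / 3 by rewrite divr_gt0.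
have approx (x : R) : exists q : rat, `|ratr q - x| < d / 3.
  have [|q] := @rat_in_itvoo R (x - d / 3) (x + d / 3); first lra.
  rewrite in_itv /= => /andP[q1 q2]; exists q.
  by rewrite ltr_norml; apply/andP; split; lra.
have /choice[a aP] := fun i : 'I_n => approx (complex.Re (z 0 i)).
have /choice[b bP] := fun i : 'I_n => approx (complex.Im (z 0 i)).
exists (\row_i a i, \row_i b i); apply/(nm_row_lt _ d0) => i; rewrite !mxE /=.
apply: le_lt_trans (nm_le_ReIm _) _; rewrite ReD ImD ReN ImN /= ?mxE.
by have := aP i; have := bP i; lra.
Qed.

End RationalPoints.

Section Transversality.
Context {R : realType} {n : nat}.
Local Notation C := (Cplx R).
Local Notation V := 'rV[C]_n.

(** A Cauchy estimate of radius 1/2 for each coordinate of the difference to the line: 12 e / (1/2)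
    = 24 e. *)
Lemma velocity_near_line (H : C -> V) (q w : V) (b t : C) (e : R) : entire H ->
  (forall s, nm (s - b) <= 1 -> nm (H s - (q + (s - b) *: w)) <= e) ->
  nm (t - b) < 2^-1 -> nm ('d H t 1 - w) <= 24 * e.
Proof.
move=> eH He tb.
have e0 : 0 <= e by apply: le_trans (nm_ge0 _) (He b _); rewrite subrr nm0.
have bL : bounded_linear (fun u : C => u *: w).
  split; first by move=> x y z; rewrite scalerDl scalerA.
  by exists (nm w) => x; rewrite nmZc mulrC.
pose E s := H s - (q + (s - b) *: w).
have dE s : differentiable E s /\ 'd E s 1 = 'd H s 1 - w.
  have [d1 d1E] := diff_affine q b s bL.
  have [d2 d2E] := diff_sub (eH s) d1; split; first exact: d2.
  have e1 : 'd (fun y : C => q + (y - b) *: w) s 1 = w := etrans (d1E 1) (scale1r w).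
  exact: (etrans (d2E 1) (congr1 (fun y => 'd H s 1 - y) e1)).
rewrite -(dE t).2; apply: nm_row_leP => [|i]; first by rewrite mulr_ge0.
have [_ dEi] := diff_coord i (dE t).1.
have half0 : 0 < 2^-1 :> R by rewrite invr_gt0.
have hE : holo_ball (fun u => E u 0 i) t 2^-1.
  by move=> y _; have [] := diff_coord i (dE y).1.
have EM y : nm (y - t) < 2^-1 -> nm (E y 0 i) <= e.
  move=> yt; apply: le_trans (nm_row_le _ i) _; apply: He.
  by have := nm_tri t y b; lra.
have := cauchy_est half0 hE EM 1; rewrite nm1 mulr1 => le1.
have e2 : nm ('d (fun u => E u 0 i) t 1) = nm (('d E t 1) 0 i) := congr1 _ (dEi 1).
by rewrite -e2; apply: le_trans le1 _; rewrite invrK; lra.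
Qed.

(** The point is the order of quantifiers: s and e precede H, q and b, so a rational q and a
    precision 2^-k can be chosen from a list that is fixed before the curve. *)
Lemma transverse_zero (phi : V -> C) (z w : V) (d0 : R) : 0 < d0 -> holo_ball phi z d0 ->
  phi z = 0 -> 'd phi z w != 0 ->
  exists s e : R, [/\ 0 < s, 0 < e & forall (H : C -> V) q b, entire H -> nm (q - z) < s ->
    H b = q -> (forall t, nm (t - b) <= 1 -> nm (H t - (q + (t - b) *: w)) <= e) ->
    exists t, [/\ nm (H t - z) < d0, phi (H t) = 0 & 'd phi (H t) ('d H t 1) != 0]].
Proof.
move=> d00 hphi phiz c0; set c := 'd phi z w in c0.
have nc : 0 < nm c by rewrite nm_gt0.
have zz : nm (z - z) < d0 by rewrite subrr nm0.
have [d1 d10 d1P] := (proj1 (contP _ _)) (differentiable_continuous (hphi z zz)) 1 ltr01.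
pose d2 := Num.min d0 d1; have d20 : 0 < d2 by rewrite lt_min d00.
have [d2d0 d2d1] : d2 <= d0 /\ d2 <= d1 by rewrite !ge_min !lexx orbT.
clearbody d2.
have hphi2 : holo_ball phi z d2 by move=> y yz; apply: hphi; apply: lt_le_trans yz d2d0.
have phiM y : nm (y - z) < d2 -> nm (phi y) <= 1.
  by move=> yz; have := d1P y (lt_le_trans yz d2d1); rewrite phiz subr0 => /ltW.
have c8 : 0 < nm c / 8 by rewrite divr_gt0.
have [d3 d30 d3P] := (proj1 (contP _ _)) (differentiable_continuous (holo_derive w d20 hphi2)) _ c8.
pose B := 12 * 1 / (d2 / 2).
have B0 : 0 < B by rewrite divr_gt0 ?mulr1// divr_gt0.
have phiB y v : nm (y - z) < d2 / 2 -> nm ('d phi y v) <= B * nm v.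
  move=> yz; apply: cauchy_est; first by rewrite divr_gt0.
    by apply: holo_sub hphi2 _; clear -yz; lra.
  move=> x xy; apply: phiM; apply: (le_lt_trans (row_tri y x z)).
  by rewrite [d2]splitr; exact: ltrD.
clearbody B.
pose delta := Num.min (d2 / 2) d3.
have delta0 : 0 < delta by rewrite lt_min d30 divr_gt0.
have [de1 de2] : delta <= d2 / 2 /\ delta <= d3 by rewrite !ge_min !lexx orbT.
clearbody delta.
have w1 : 0 < nm w + 1 by rewrite ltr_wpDl// nm_ge0.
(* 2^-1 is the range of [velocity_near_line]; the other bound keeps the line within delta / 4 of
   q. *)
pose rho := Num.min 2^-1 (delta / 4 / (nm w + 1)).
have rho0 : 0 < rho.
  by rewrite lt_min; apply/andP; split; [rewrite invr_gt0 | rewrite divr_gt0// divr_gt0].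
have [rho1 rho2] : rho <= 2^-1 /\ rho <= delta / 4 / (nm w + 1) by rewrite !ge_min !lexx orbT.
clearbody rho.
have g0 : 0 < nm c * (rho / 8) by rewrite mulr_gt0// divr_gt0.
have [d4 d40 d4P] := (proj1 (contP _ _)) (differentiable_continuous (hphi z zz)) _ g0.
(* d4 makes phi q small enough for Newton's iteration. Three distances delta / 4 (q to z, along the
   line, line to curve) keep the curve within delta of z. The last bound gives B * 24 e <= nm c / 8
   for the error of the velocity. *)
exists (Num.min d4 (delta / 4)), (Num.min (delta / 4) (nm c / 8 / (24 * B))).
have B24 : 0 < 24 * B by rewrite mulr_gt0.
split; first by rewrite lt_min d40 divr_gt0.
  by rewrite lt_min; apply/andP; split; rewrite divr_gt0.
move=> H q b eH; rewrite lt_min => /andP[q1 q2] Hb He.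
set e := Num.min _ _ in He.
have [e1 e2] : e <= delta / 4 /\ e <= nm c / 8 / (24 * B) by rewrite !ge_min !lexx orbT.
clearbody e.
have Hz t : nm (t - b) < rho -> nm (H t - z) < delta.
  move=> tb.
  have t1 : nm (t - b) <= 1 by clear -tb rho1; lra.
  have le1 := He t t1.
  have le2 : nm ((t - b) *: w) <= delta / 4.
    rewrite nmZc; apply: le_trans (_ : rho * (nm w + 1) <= _); last by rewrite -ler_pdivlMr.
    by apply: ler_pM; rewrite ?nm_ge0 ?(ltW tb)// lerDl.
  have le3 := row_tri (q + (t - b) *: w) (H t) z.
  have := nmD (q - z) ((t - b) *: w); rewrite addrAC => le4.
  by clear -le1 le2 le3 le4 q2 e1 delta0; lra.
have dG t : nm (t - b) < rho ->
    differentiable (fun u => phi (H u)) t /\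
    'd (fun u => phi (H u)) t 1 = 'd phi (H t) ('d H t 1) /\
    nm ('d (fun u => phi (H u)) t 1 - c) <= nm c / 2.
  move=> tb; have Htz := Hz t tb.
  have dphi : differentiable phi (H t) by apply: hphi2; clear -Htz de1 d20; lra.
  have [d5 d5E] := diff_compose (eH t) dphi.
  have e6 := d5E 1.
  split; first exact: d5.
  split; first exact: e6.
  have -> : nm ('d (fun u => phi (H u)) t 1 - c) = nm ('d phi (H t) ('d H t 1) - c) :=
    congr1 (fun y : C => nm (y - c)) e6.
  have vel : nm ('d H t 1 - w) <= 24 * e by apply: (velocity_near_line eH He); exact: lt_le_trans tb rho1.
  have le3 : nm ('d phi (H t) ('d H t 1 - w)) <= B * nm ('d H t 1 - w) by apply: phiB; exact: lt_le_trans Htz de1.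
  have le4 : nm ('d phi (H t) w - c) < nm c / 8 by apply: d3P; exact: lt_le_trans Htz de2.
  have le5 : B * nm ('d H t 1 - w) <= nm c / 8.
    apply: le_trans (ler_wpM2l (ltW B0) vel) _; rewrite mulrCA mulrA.
    by rewrite mulrC -ler_pdivlMr.
  have -> : 'd phi (H t) ('d H t 1) - c = 'd phi (H t) ('d H t 1 - w) + ('d phi (H t) w - c).
    by rewrite linearB /= addrA subrK.
  by apply: le_trans (nmD _ _) _; clear -le3 le4 le5 nc; lra.
have [||t tb Gt] := @newton_zero R (fun u => phi (H u)) b c rho rho0 c0.
- by move=> t tb; have [? [_ ?]] := dG t tb.
- by have := d4P q q1; rewrite phiz subr0 Hb.
exists t; have [_ [dE le1]] := dG t tb; split=> //.
- by have le2 := Hz t tb; clear -le2 de1 d2d0 d20; lra.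
- have le2 : nm ('d phi (H t) ('d H t 1) - c) <= nm c / 2 by rewrite -dE.
  rewrite -nm_gt0; have := nmBl c ('d phi (H t) ('d H t 1)).
  by rewrite (nm_distC c) => le3; clear -le2 le3 nc; lra.
Qed.

End Transversality.

Section HypersurfaceRegular.
Context {R : realType} {n : nat} {Om : 'M[Cplx R]_(n.*2, n)}.

(** Without regular points of codimension 1, the bound c >= 1 near a would improve to c >= 2, which
    codimension exactly 1 forbids. *)
Lemma hypersurface_regular (D : set (torus Om)) : hypersurface D ->
  exists a, regular_point D 1 a.
Proof.
move=> [_ [a Da] /(_ a Da)[ge1 nge2]]; apply: contrapT => nreg; apply: nge2.
apply: filterS ge1 => z zc c rc; have := zc c rc.
by rewrite leq_eqVlt => /orP[/eqP c1|//]; case: nreg; exists z; rewrite c1.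
Qed.

End HypersurfaceRegular.

(** * Enumeration of the prescribed lines, and the resulting curve *)

Theorem theorem8p1 (R : realType) (n : nat) (Om : 'M[Cplx R]_(n.*2, n))
    (hOm : period_matrix Om)
    (Z : set (torus Om)) (Z_analytic : analytic_set Z) (Z_codim : codim_ge Z 2)
    (M : set (torus Om)) (M_countable : countable M) (M_sub : M `<=` ~` Z) :
  exists h : Cplx R -> torus Om,
    [/\ entire_curve h,
        forall t, ~ Z (h t),
        dense (range h),
        M `<=` range h &
        forall D : set (torus Om), hypersurface D -> meets_transversally h D].
Proof.
pose pi := torus_pi Om.
(* Z is closed without interior, so a ball contains a smaller ball outside Z, and that one contains
   a rational point. *)
have good_point (z : 'rV[Cplx R]_n) (d : R) : 0 < d -> exists ab,
    nm (rational_point ab - z) < d /\ ~ Z (pi (rational_point ab)).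
  move=> d0.
  have [y yz nZ] : exists2 y, nm (y - z) < d & ~ Z (pi y).
    apply: contrapT => ny; apply: (codim2_no_ball Z_codim d0) => y yz.
    by apply: contrapT => nZ; apply: ny; exists y; [exact: yz | exact: nZ].
  have [d1 d10 d1P] := analytic_closed Z_analytic nZ.
  have m0 : 0 < Num.min d1 (d - nm (y - z)) by rewrite lt_min d10 subr_gt0.
  have [ab] := rational_dense y m0; rewrite lt_min => /andP[ab1 ab2].
  exists ab; split; last exact: d1P.
  by apply: (le_lt_trans (row_tri y (rational_point ab) z)); rewrite -ltrBrDr.
have [ab0 [_ nZ0]] := good_point 0 1 ltr01.
have [f finj] : exists f : torus Om -> nat, {in M &, injective f} by apply/pcard_injP.
(* A code that names no point of M, or a rational point inside Z, is sent to the fixed point ab0, so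
   that every prescribed point avoids Z. *)
pose pt (x : nat + 'rV[rat]_n * 'rV[rat]_n) : 'rV[Cplx R]_n :=
  match x with
  | inl m => xget (rational_point ab0) [set z | M (pi z) /\ f (pi z) = m]
  | inr ab => if pselect (Z (pi (rational_point ab))) then rational_point ab0 else rational_point ab
  end.
have ptZ x : ~ Z (pi (pt x)).
  case: x => [m|ab] /=; last by case: pselect.
  by case: xgetP => [z _ [Mz _]|_]; [exact: M_sub | exact: nZ0].
have pt_rat ab : ~ Z (pi (rational_point ab)) -> pt (inr ab) = rational_point ab.
  by rewrite /pt; case: pselect.
have pt_M a : M a -> pi (pt (inl (f a))) = a.
  move=> Ma; rewrite /pt; case: xgetP => [z _ [Mz fz]|nz].
    by apply: finj; rewrite ?inE.
  have piK : pi (repr a) = a := pi_repr a.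
  by exfalso; apply: (nz (repr a)); split; rewrite piK.
clearbody pt.
(* Entries are a base point, a direction and a precision exponent. None stands for the direction 0,
   used when only the point matters; it also keeps the type inhabited when n = 0. *)
pose X : countType := ((nat + 'rV[rat]_n * 'rV[rat]_n) * option 'I_n * nat)%type.
pose dec j : X := odflt (inl 0%N, None, 0%N) (unpickle j).
have decK x : dec (pickle x) = x by rewrite /dec pickleK.
pose dir (o : option 'I_n) : 'rV[Cplx R]_n := if o is Some i then delta_mx 0 i else 0.
have [H [eH HZ [b bP]]] := @avoiding_curve R n Om hOm Z Z_analytic Z_codim
  (fun j => pt (dec j).1.1) (fun j => dir (dec j).1.2) (fun j => 2 ^- (dec j).2)
  (fun j => ptZ _) (fun j => half_gt0 _).
exists (pi \o H); split.
- by move=> t; exists H; apply/(@nearP R (Cplx R) t); exists 1.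
- by move=> t; exact: HZ.
- move=> O [a Oa] oO.
  have onb : open_nbhs (pi (repr a)) O by split=> //; rewrite /pi pi_repr.
  have [d d0 dO] := pi_near onb.
  have [ab [abd abZ]] := good_point (repr a) d d0.
  exists (pi (rational_point ab)); split; first exact: dO.
  exists (b (pickle ((inr ab, None, 0%N) : X))) => //=.
  by rewrite (bP _).1 decK /= pt_rat.
- move=> a Ma; exists (b (pickle ((inl (f a), None, 0%N) : X))) => //=.
  by rewrite (bP _).1 decK /= pt_M.
move=> D /hypersurface_regular[a [Da [U [Ua [g [hg gD gsurj]]]]]].
pose phi := g ord0 \o pi.
have Ua' : open_nbhs (pi (repr a)) U by rewrite /pi pi_repr.
have [d d0 dU] := pi_near Ua'.
have hphi : holo_ball phi (repr a) d by move=> y yd; apply: hg; apply: dU.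
have phia : phi (repr a) = 0.
  by rewrite /phi /= /pi pi_repr; move: ord0; apply/(gD a Ua.2).
(* The differential is onto C, hence nonzero on some vector of the standard basis; finitely many
   directions suffice. *)
have [i ci] : exists i : 'I_n, 'd phi (repr a) (delta_mx 0 i) != 0.
  apply: contrapT => ni; have [v /(_ ord0)] := gsurj (fun=> 1).
  rewrite /differential (row_sum_delta v) linear_sum big1 => [/eqP|j _].
    by rewrite eq_sym oner_eq0.
  rewrite linear_mul; suff -> : 'd phi (repr a) (delta_mx 0 j) = 0 by rewrite mulr0.
  by apply/eqP/negPn/negP => nj; apply: ni; exists j.
have [s [e [s0 e0 trans]]] := transverse_zero d0 hphi phia ci.
have [ab [abd abZ]] := good_point (repr a) s s0.
have [k kP] := half_small 1 e0.
pose j := pickle ((inr ab, Some i, k) : X).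
have [bq bl] := bP j; rewrite decK /= pt_rat// in bq bl.
have [t tb|t [tz phit dphit]] := trans H (rational_point ab) (b j) eH abd bq.
  by apply: le_trans (bl t tb) _; have := kP k (leqnn _); rewrite mul1r => /ltW.
have Ut : U (pi (H t)) by exact: dU.
exists t; split; first by apply/(gD _ Ut) => l; rewrite (ord1 l).
exists ('d H t 1).
  exists H.
    by apply/(@nearP R (Cplx R) t); exists 1.
  by rewrite derive1E'//; exact: eH.
(* The local equation of D is itself a test function for the tangent space, and its differential
   does not vanish on the velocity. *)
move=> /(_ U (g ord0)); rewrite /= => tan.
have Ut' : open_nbhs (pi (H t)) U by split=> //; exact: Ua.1.
have := tan Ut' (hg ord0) (fun c Uc Dc => proj1 (gD c Uc) Dc ord0).
rewrite differentialE; last exact: hg.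
by move/eqP: dphit.
Qed.
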